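(* Let $\bar c_D=\sup_Dc$ and let $g:D\to(-\infty,0]$ be Borel measurable. Assume that the minorization condition $M(\bar c_D,\psi,\nu)$ holds for some function $\psi:D\to[0,\infty)$ and some $\sigma$-finite Borel measure $\nu$ on $D$, i.e. $R^D_{\bar c_D}f(x)\ge\psi(x)\int_Df\,d\nu$ for all $x\in D$ and $f\in B_b^+(D)$. Suppose furthermore that $u\in\mathcal U_c^+(g)$. Then $$\bar u_{D_S}-u(x)\ge\psi(x)\Big\{\bar u_{D_S}\int_Dc\,v_{c,D}\,d\nu+\int_Dg^-\,d\nu\Big\},\qquad x\in D,$$ where $g^-=\max\{-g,0\}$ and $v_{c,D}(x)=\mathbb E_x[e_c(\tau_D)]$.
   Context: Setting and standing assumptions. $D\subset\mathbb R^d$ is a domain (open connected set). $B_b(E)$ (resp. $B_b^+(E)$) denotes the bounded (resp. non-negative bounded) Borel functions on $E$. $A$ is the operator $$Au(x)=\tfrac12\mathrm{Tr}(\mathbf Q(x)\nabla^2u(x))+b(x)\cdot\nabla u(x)+\int_{\mathbb R^d}\Big(u(x+y)-u(x)-\frac{y\cdot\nabla u(x)}{1+|y|^2}\Big)N(x,dy).$$ (A1) The entries of the symmetric non-negative definite matrix $\mathbf Q(x)$ and of the vector $b(x)$ are bounded Borel functions on $\mathbb R^d$. (A2) $N(x,dy)$ is a kernel of $\sigma$-finite Borel measures on $\mathbb R^d\setminus\{0\}$ with $\sup_x\int\min\{1,|y|^2\}N(x,dy)<\infty$. (A3) $c:D\to[0,\infty)$ is bounded and Borel. (A4) There is a strong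 Markovian solution $(P_x)_{x\in\mathbb R^d}$ of the martingale problem for $A$, which is fixed: Borel probability measures on the Skorokhod space of càdlàg paths $[0,\infty)\to\mathbb R^d$ with canonical process $X_t$ and natural filtration $(\mathcal F_t)$, such that $P_x(X_0=x)=1$; for each $f\in C_b^2(\mathbb R^d)$ the process $f(X_t)-f(X_0)-\int_0^tAf(X_r)dr$ is a $P_x$-martingale; $x\mapsto P_x[C]$ is measurable for Borel $C$; $X$ is strong Markov; and $P_\mu=\int P_x\,\mu(dx)$ solves the martingale problem with initial law $\mu$ for every Borel probability measure $\mu$. $\mathbb E_x$ is expectation under $P_x$. Let $\tau_D=\inf\{t>0:X_t\notin D\}$. (ET) $P_x(\tau_D<\infty)=1$ for all $x\in D$. Semigroup and resolvent: $P^D_tf(x)=\mathbb E_x[f(X_t);\,t<\tau_D]$, $R^D_\alpha f(x)=\int_0^\infty e^{-\alpha t}P^D_tf(x)\,dt$ for $\alpha\ge0$. Extended closure: $\mathcal S(D)=\bigcup_{x\in D}(x+\mathrm{supp}\,N(x,\cdot))$, $\partial_SD=\partial D\cup(\mathcal S(D)\setminus D)$, $D_S=D\cup\partial_SD$; $\bar u_B=\sup_Bu$. Subsolutions: with $e_c(t)=\exp\{-\int_0^tc(X_r)dr\}$, $u\in B_b(\mathbb R^d)$ is a weak subsolution of $(-A+c)v=g$ in $D$ if $u(x)\le\mathbb E_x[e_c(\tau_D\wedge t)u(X_{\tau_D\wedge t})]+\mathbb E_x[\int_0^{\tau_D\wedge t}e_c(r)g(X_r)dr]$ for all $x\in D$,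 $t\ge0$. $\mathcal U_c^+(g)$ is the set of such $u$ with $\bar u_{D_S}\ge0$. *)

(* Defs.v *)
From HB Require Import structures.
From mathcomp Require Import all_boot all_order all_algebra.
From mathcomp Require Import all_classical all_reals all_analysis.

Set Implicit Arguments.
Unset Strict Implicit.
Unset Printing Implicit Defensive.

Import Order.TTheory GRing.Theory Num.Theory.
Import numFieldNormedType.Exports.

Local Open Scope classical_set_scope.
Local Open Scope ring_scope.

HB.instance Definition _ (R : realType) (m n : nat) :=
  @isMeasurable.Build (sigma_display (@open 'M[R]_(m, n))) 'M[R]_(m, n)
    <<s @open 'M[R]_(m, n) >> (@sigma_algebra0 _ setT _)
    (@sigma_algebraC _ _) (@sigma_algebra_bigcup _ setT _).

Section skorokhod_space.
Context {R : realType} {d : nat}.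
Implicit Types (w : R -> 'rV[R]_d) (s t T e : R).

(* A path indexed by [0, +oo[ is represented by a function on R which is
   frozen at its initial value on the negative half-line; with this
   normalization, two paths are equal iff they agree on [0, +oo[, and the
   conditions at t < 0 (and the left limit at 0) hold trivially. *)
Definition cadlag w : Prop :=
  [/\ forall t, w s @[s --> t^'+] --> w t,
      forall t, cvg (w s @[s --> t^'-]) &
      forall t, t < 0 -> w t = w 0].

Record skorokhod := Skorokhod {
  path_fun :> R -> 'rV[R]_d ;
  path_cadlag : cadlag path_fun }.

Lemma cadlag_cst (a : 'rV[R]_d) : cadlag (fun=> a).
Proof. by split=> // t; [exact: cvg_cst | exact: is_cvg_cst]. Qed.

HB.instance Definition _ := gen_eqMixin skorokhod.
HB.instance Definition _ := gen_choiceMixin skorokhod.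
HB.instance Definition _ := isPointed.Build skorokhod
  (Skorokhod (cadlag_cst 0)).

(* Strictly increasing bijections of [0, +oo[. *)
Definition time_change (l : R -> R) : Prop :=
  (forall s t, 0 <= s -> s < t -> l s < l t) /\
  l @` [set t | 0 <= t] = [set t | 0 <= t].

(* Basic neighborhoods of the Skorokhod J1 topology on D([0, +oo[, R^d):
   v_n --> v in J1 iff for all T, e one has J1_nbhd v T e v_n eventually
   (Ethier and Kurtz, Markov Processes, Prop. 3.5.3(c)). *)
Definition J1_nbhd (v : skorokhod) T e : set skorokhod :=
  [set v' | exists2 l, time_change l &
    forall t, 0 <= t <= T -> `|l t - t| < e /\ `|v' t - v (l t)| < e].

Definition J1_open (U : set skorokhod) : Prop :=
  forall v, U v -> exists T e, 0 < e /\ J1_nbhd v T e `<=` U.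

Lemma J1_nbhdS v T T' e e' : T' <= T -> e <= e' ->
  J1_nbhd v T e `<=` J1_nbhd v T' e'.
Proof.
move=> TT ee v' [l tl lP]; exists l => // t /andP[t0 tT].
have [|h1 h2] := lP t; first by rewrite t0 (le_trans tT).
by split; [exact: lt_le_trans h1 ee | exact: lt_le_trans h2 ee].
Qed.

Lemma J1_openT : J1_open setT.
Proof. by move=> v _; exists 0, 1. Qed.

Lemma J1_openI : setI_closed J1_open.
Proof.
move=> U V oU oV v [/oU[T1 [e1 [e10 sU]]] /oV[T2 [e2 [e20 sV]]]].
exists (Num.max T1 T2), (Num.min e1 e2); split; first by rewrite lt_min e10.
move=> v' v'P; split.
  by apply/sU; apply: J1_nbhdS v'P; rewrite ?le_max ?ge_min lexx.
by apply/sV; apply: J1_nbhdS v'P; rewrite ?le_max ?ge_min lexx orbT.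
Qed.

Lemma J1_open_bigcup (I : Type) (f : I -> set skorokhod) :
  (forall i, J1_open (f i)) -> J1_open (\bigcup_i f i).
Proof.
move=> of_ v [i _ /of_[T [e [e0 sf]]]]; exists T, e; split=> // v' /sf.
by exists i.
Qed.

HB.instance Definition _ :=
  isOpenTopological.Build skorokhod J1_openT J1_openI J1_open_bigcup.

HB.instance Definition _ :=
  @isMeasurable.Build (sigma_display (@open skorokhod)) skorokhod
    <<s @open skorokhod >> (@sigma_algebra0 _ setT _)
    (@sigma_algebraC _ _) (@sigma_algebra_bigcup _ setT _).

Lemma cadlag_shift t w : cadlag w -> cadlag (fun s => w (t + Num.max s 0)).
Proof.
move=> [wr wl _]; split=> s.
- have [s0|s0] := ltP s 0.
    apply: cvg_near_cst; near=> r.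
    have r0 : r <= 0 by near: r; exact: nbhs_right_le.
    by rewrite (max_idPr r0).
  have h : w (t + r) @[r --> s^'+] --> w (t + s).
    apply: (cvg_comp (fun r => t + r) w _ (wr (t + s))).
    move=> B [e /= e0 eB]; exists e => //= r /= rs sr.
    by apply: eB; rewrite /= ?ltrD2l// opprD addrACA subrr add0r.
  apply: cvg_trans h; apply: near_eq_cvg; near=> r.
  have sr : s <= r by near: r; exact: nbhs_right_ge.
  by rewrite (max_idPl (le_trans s0 sr)).
- have [s0|s0] := leP s 0.
    apply/cvg_ex; exists (w (t + 0)); apply: cvg_near_cst; near=> r.
    have rs : r <= s by near: r; exact: nbhs_left_le.
    by rewrite (max_idPr (le_trans rs s0)).
  have /cvg_ex[l wlt] := wl (t + s).
  apply/cvg_ex; exists l.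
  have h : w (t + r) @[r --> s^'-] --> l.
    apply: (cvg_comp (fun r => t + r) w _ wlt).
    move=> B [e /= e0 eB]; exists e => //= r /= rs sr.
    by apply: eB; rewrite /= ?ltrD2l// opprD addrACA subrr add0r.
  apply: cvg_trans h; apply: near_eq_cvg; near=> r.
  have r0 : 0 <= r by near: r; exact: nbhs_left_ge.
  by rewrite (max_idPl r0).
- by move=> s0; rewrite (max_idPr (ltW s0)) maxxx.
Unshelve. all: by end_near. Qed.

Definition shift t (v : skorokhod) : skorokhod :=
  Skorokhod (cadlag_shift t (path_cadlag v)).

Definition natural_filtration t : set (set skorokhod) :=
  <<s [set C | exists (r : R) (B : set 'rV[R]_d),
         [/\ 0 <= r <= t, measurable B & C = [set v : skorokhod | B (v r)]]] >>.

Definition stopping_time (S : skorokhod -> \bar R) : Prop :=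
  (forall v, (0 <= S v)%E) /\
  (forall t, 0 <= t -> natural_filtration t [set v | (S v <= t%:E)%E]).

Definition stopping_events (S : skorokhod -> \bar R) : set (set skorokhod) :=
  [set C | measurable C /\
    forall t, 0 <= t -> natural_filtration t (C `&` [set v | (S v <= t%:E)%E])].

Definition martingale (P : {measure set skorokhod -> \bar R})
    (M : R -> skorokhod -> R) : Prop :=
  [/\ forall t, 0 <= t -> forall B, measurable B ->
        natural_filtration t (M t @^-1` B),
      forall t, 0 <= t -> P.-integrable setT (EFin \o M t) &
      forall s t, 0 <= s <= t -> forall C, natural_filtration s C ->
        (\int[P]_(v in C) (M t v)%:E = \int[P]_(v in C) (M s v)%:E)%E].

End skorokhod_space.
Arguments skorokhod : clear implicits.

Section operator.
Context {R : realType} {d : nat}.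
Local Notation E := 'rV[R]_d.
Implicit Types (f : E -> R) (x y : E).

Definition borel_bounded (D : set E) f : Prop :=
  measurable_fun D f /\ [bounded f x | x in D].

(* Euclidean inner product; note that the norm `|x| on 'rV[R]_d is the maximum
   norm, so |y|^2 is written dot y y. *)
Definition dot x y : R := \sum_i x 0 i * y 0 i.

Definition partial (i : 'I_d) f : E -> R := 'D_(delta_mx 0 i) f.

Definition gradient f x : E := \row_i partial i f x.

Definition hessian f x : 'M[R]_d := \matrix_(i, j) partial i (partial j f) x.

Definition Cb f : Prop := continuous f /\ [bounded f x | x in setT].

Definition Cb2 f : Prop :=
  Cb f /\
  forall i, [/\ forall x, derivable f x (delta_mx 0 i), Cb (partial i f) &
    forall j, (forall x, derivable (partial i f) x (delta_mx 0 j)) /\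
              Cb (partial j (partial i f))].

Definition levy_operator (Q : E -> 'M[R]_d) (b : E -> E)
    (N : R.-sigmafker E ~> E) f x : R :=
  2^-1 * \tr (Q x *m hessian f x) + dot (b x) (gradient f x) +
  \int[N x]_y (f (x + y) - f x - dot y (gradient f x) / (1 + dot y y)).

Definition diffusion_drift_assumption (Q : E -> 'M[R]_d) (b : E -> E) : Prop :=
  [/\ forall x, (Q x)^T = Q x,
      forall x (y : E), 0 <= (y *m Q x *m y^T) 0 0,
      forall i j, borel_bounded setT (fun x => Q x i j) &
      forall i, borel_bounded setT (fun x => b x 0 i)].

(* Measures on R^d \ {0} are represented as measures on R^d without atom
   at 0. *)
Definition levy_kernel_assumption (N : R.-sigmafker E ~> E) : Prop :=
  (forall x, N x [set 0] = 0%E) /\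
  (ereal_sup [set \int[N x]_y (Num.min 1 (dot y y))%:E | x in setT] < +oo)%E.

(* Whether supp (N x), as the support of a measure on R^d, contains 0 is
   immaterial below: x + 0 already belongs to D. *)
Definition supp (mu : {measure set E -> \bar R}) : set E :=
  [set y | forall U : set E, open U -> U y -> (0 < mu U)%E].

Definition jump_range (N : R.-sigmafker E ~> E) (D : set E) : set E :=
  \bigcup_(x in D) [set x + y | y in supp (N x)].

Definition boundary (D : set E) : set E := closure D `\` D°.

Definition extended_boundary N D : set E :=
  boundary D `|` (jump_range N D `\` D).

Definition extended_closure N D : set E := D `|` extended_boundary N D.

Definition domain (D : set E) : Prop := open D /\ connected D.

End operator.

Section martingale_problem.
Context {R : realType} {d : nat}.
Local Notation E := 'rV[R]_d.
Local Notation Omega := (skorokhod R d).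
Local Notation leb := (@lebesgue_measure R).
Variables (A : (E -> R) -> E -> R).

Definition solves_martingale_problem (P : {measure set Omega -> \bar R})
    : Prop :=
  forall f, Cb2 f ->
    martingale P (fun t (v : Omega) =>
      f (v t) - f (v 0) - \int[leb]_(r in `[0, t]) A f (v r)).

Definition strong_markov (P : R.-pker E ~> Omega) : Prop :=
  forall (x : E) (S : Omega -> \bar R), stopping_time S ->
  forall C, stopping_events S C -> forall H, measurable H ->
    let CS := C `&` [set v | (S v < +oo)%E] in
    (P x (CS `&` [set v | H (shift (fine (S v)) v)]) =
     \int[P x]_(v in CS) P (v (fine (S v))) H)%E.

(* The measurability of x |-> P_x(C) is part of the type R.-pker E ~> Omega.
   In the last clause Pmu is the mixture of the P_x with respect to mu (which
   exists, by composition of kernels, and is unique). *)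
Record strong_markov_solution (P : R.-pker E ~> Omega) : Prop := {
  sms_initial : forall x, (P x [set v : Omega | v 0%R = x] = 1)%E ;
  sms_martingale : forall x, solves_martingale_problem (P x) ;
  sms_strong_markov : strong_markov P ;
  sms_mixture : forall (mu : probability E R) (Pmu : probability Omega R),
    (forall C, measurable C -> Pmu C = \int[mu]_x P x C)%E ->
    (forall B, measurable B -> Pmu [set v : Omega | B (v 0)] = mu B) /\
    solves_martingale_problem Pmu }.

End martingale_problem.

(* Functions on D are total functions on R^d, of which only the values on D
   matter. Times in [0, +oo] are extended reals, and time integrals are taken
   over [0, t[, so that up to tau_D they only see values of c, g, f on D. *)
Section exit_time.
Context {R : realType} {d : nat}.
Local Notation E := 'rV[R]_d.
Local Notation Omega := (skorokhod R d).
Local Notation leb := (@lebesgue_measure R).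
Variables (P : R.-pker E ~> Omega) (D : set E).
Implicit Types (x : E) (v : Omega) (f g u c : E -> R).
Local Open Scope ereal_scope.

Definition exit_time v : \bar R :=
  ereal_inf [set t%:E | t in [set t : R | (0 < t)%R /\ ~ D (v t)]].

Definition before (t : \bar R) : set R := [set r | (0 <= r)%R /\ r%:E < t].

(* Hitting times of cadlag paths are measurable only for the completions of the
   P_x. Off the Borel sets, measures in the library take arbitrary values, but
   the almost-everywhere filter refers to the completion; likewise, the library
   integral of the positive (negative) part is a supremum over simple functions
   below it, so it agrees with that of any a.e. equal Borel function. *)
Definition exits_almost_surely : Prop :=
  forall x, D x -> {ae P x, forall v, exit_time v < +oo}.

Definition killed_semigroup (t : R) f x : \bar R :=
  \int[P x]_(v in [set v | t%:E < exit_time v]) (f (v t))%:E.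

Definition resolvent (alpha : R) f x : \bar R :=
  \int[leb]_(t in `[0%R, +oo[) ((expR (- (alpha * t)))%:E *
                                 killed_semigroup t f x).

Definition discount c (t : \bar R) v : \bar R :=
  expeR (- \int[leb]_(r in before t) (c (v r))%:E).

Definition exit_discount c x : \bar R :=
  \int[P x]_v discount c (exit_time v) v.

Definition weak_subsolution c g u : Prop :=
  borel_bounded setT u /\
  forall x, D x -> forall t : R, (0 <= t)%R ->
    let S v := Order.min (exit_time v) t%:E in
    (u x)%:E <=
      \int[P x]_v (discount c (S v) v * (u (v (fine (S v))))%:E) +
      \int[P x]_v \int[leb]_(r in before (S v))
        (discount c r%:E v * (g (v r))%:E).

Definition nonneg_weak_subsolution (N : R.-sigmafker E ~> E) c g u : Prop :=
  weak_subsolution c g u /\ (0 <= sup (u @` extended_closure N D))%R.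

Definition minorization (alpha : R) (psi : E -> R)
    (nu : {measure set E -> \bar R}) : Prop :=
  forall f, borel_bounded D f -> (forall y, D y -> (0 <= f y)%R) ->
  forall x, D x ->
    (psi x)%:E * \int[nu]_(y in D) (f y)%:E <= resolvent alpha f x.

End exit_time.

(* Main.v *)
(* Let T be the limit of the entrance times into shrinking neighborhoods of the
   complement of D. It is Borel, whereas tau_D is only measurable for the
   completions; approximating indicators of open sets by C_b^2 functions that
   vanish on D and stopping the corresponding martingales shows that a.s.
   T = tau_D and X_T lies in the extended closure of D, since from D the process
   can jump only into x + supp N(x, .).

   Hence X at min(tau_D, n) is bounded by the supremum of u over the extended
   closure whenever tau_D < n, and n -> oo in the subsolution inequality gives
     u(x) + E_x int_0^T e_c(r) g^-(X_r) dr <= ubar v(x),  v = E[e_c(tau_D)].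
   On the other hand the path identity
     int_0^T c(X_r) exp(- int_r^T c(X_s) ds) dr = 1 - e_c(T)
   and the Markov property at r give E_x int_0^T c(X_r) v(X_r) dr <= 1 - v(x).
   As exp(- cbar r) <= min(1, e_c(r)) before T, the resolvent at cbar of the
   function ubar c v + g^- is at most ubar (1 - v(x)) + ubar v(x) - u(x), and the
   minorization condition, applied to the truncations min(g^-, n), concludes. *)

Require Import Defs.
From HB Require Import structures.
From mathcomp Require Import all_boot all_order all_algebra.
From mathcomp Require Import all_classical all_reals all_analysis.
From mathcomp Require Import measurable_realfun ring lra.

Set Implicit Arguments.
Unset Strict Implicit.
Unset Printing Implicit Defensive.

Import Order.TTheory GRing.Theory Num.Theory.
Import numFieldNormedType.Exports.

Local Open Scope classical_set_scope.
Local Open Scope ring_scope.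

(** Two facts about the position at $T$ call for opposite test functions. That $X_T \notin D$ is a
    form of quasi-left-continuity: a function supported at positive distance from the complement of
    $D$ vanishes at late entrance times $T_n$, so Dynkin's formula between $T_n$ and $T$ bounds
    $E[f(X_T); T < t]$ by $C\,E[T\wedge t - T_n\wedge t]$, which tends to 0. For the exit position
    the functions vanish on $D$; there the local part of $Af$ disappears, and the law of $X_{T\wedge
    t}$ off the closure of $D$ is the expected time integral of the jump rate. As $u$ is only Borel,
    the set where it exceeds its supremum need not be open, so this identity is extended from open
    to Borel sets. The Markov hypothesis speaks of events only: $[0,1]$-valued functionals are
    therefore expanded into binary digits, that is, into series of indicators. It also requires $\{r
    < T\}$ to lie in the raw filtration at time $r$, which holds because $T$ is a limit of entrance
    times. *)

Section lower_integral.
Context d (T : measurableType d) (R : realType).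
Variable mu : {measure set T -> \bar R}.
Local Open Scope ereal_scope.
Import HBSimple HBNNSimple.

(* No measurability is needed: the integral of a non-negative function is the
   supremum of the integrals of the simple functions below it. *)
Lemma ge0_ae_le_lower_integral (f g : T -> \bar R) :
  (forall x, 0 <= f x) -> (forall x, 0 <= g x) ->
  {ae mu, forall x, f x <= g x} -> \int[mu]_x f x <= \int[mu]_x g x.
Proof.
move=> f0 g0 [N [mN muN sN]].
rewrite !ge0_integralTE//; apply: ge_ereal_sup => _ [h /= hf <-].
apply: ereal_sup_ubound => /=.
(* Setting the simple function to 0 on the exceptional null set brings it below [g] everywhere and
   leaves its integral unchanged. *)
exists (proj_nnsfun h (measurableC mN)) => [x|].
  rewrite -mrestrict /patch; case: ifPn => [xN|_]; last by rewrite g0.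
  rewrite (le_trans (hf x))//.
  by apply: contrapT => /sN; exact: set_mem xN.
rewrite -!integralT_nnsfun; apply: ge0_ae_eq_integral => //.
- exact/measurable_EFinP.
- exact/measurable_EFinP.
- by move=> x _; rewrite lee_fin.
- by move=> x _; rewrite lee_fin.
- exists N; split=> // x /=; apply: contra_notP => Nx _.
  by congr (_%:E); rewrite -[LHS]/(proj_nnsfun h (measurableC mN) x) -mrestrict /patch mem_set.
Qed.

Lemma ae_eq_lower_integral (f g : T -> \bar R) :
  {ae mu, forall x, f x = g x} -> \int[mu]_x f x = \int[mu]_x g x.
Proof.
move=> fg; rewrite integralE [RHS]integralE; congr (_ - _); apply/eqP;
  rewrite eq_le; apply/andP; split; apply: ge0_ae_le_lower_integral => //;
  by apply: filterS fg => x fgx; rewrite ?funeposE ?funenegE fgx.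
Qed.

(** The domains too may differ on a null set: this replaces the event $t < \tau_D$ of the killed
    semigroup by the Borel event $t < T$. *)
Lemma ae_eq_lower_integral_set (A B : set T) (f g : T -> \bar R) :
  {ae mu, forall x, (A x <-> B x) /\ (A x -> f x = g x)} ->
  \int[mu]_(x in A) f x = \int[mu]_(x in B) g x.
Proof.
move=> fg; rewrite integral_mkcond [RHS]integral_mkcond.
apply: ae_eq_lower_integral; apply: filterS fg => x [AB fgx].
rewrite /patch; case: ifPn => [/set_mem Ax|Ax].
  by rewrite mem_set ?fgx//; exact/AB.
by case: ifPn => // /set_mem /AB Bx; rewrite mem_set in Ax.
Qed.

End lower_integral.

Lemma countable_bigcapT_measurable d (T : measurableType d) U (F : U -> set T) :
  countable [set: U] -> (forall i, measurable (F i)) -> measurable (\bigcap_i F i).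
Proof.
move=> cU mF; rewrite -[X in measurable X]setCK setC_bigcap; apply: measurableC.
by apply: countable_bigcupT_measurable => // i; exact: measurableC.
Qed.

Lemma measurable_cst_set d (T : measurableType d) (P : Prop) : measurable [set _ : T | P].
Proof.
have [p|np] := pselect P.
  by rewrite (_ : [set _ | P] = setT)//; apply/seteqP; split.
by rewrite (_ : [set _ | P] = set0)//; apply/seteqP; split.
Qed.

(** * Borel sets of $\mathbb R^d$ and a countable base of balls *)

Section borel_vectors.
Context {R : realType} {d : nat}.
Local Notation E := 'rV[R]_d.

Lemma open_measurable_rV (U : set E) : open U -> measurable U.
Proof. by move=> oU; exact: sub_sigma_algebra. Qed.

Lemma closed_measurable_rV (U : set E) : closed U -> measurable U.
Proof.
move=> cU; rewrite -(setCK U); apply: measurableC; apply: open_measurable_rV.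
exact: closed_openC.
Qed.

Lemma measurable_set1_rV (x : E) : measurable [set x].
Proof.
apply: closed_measurable_rV; apply: accessible_closed_set1.
by apply: hausdorff_accessible; exact: norm_hausdorff.
Qed.

Lemma measurable_fun_rV (d' : measure_display) (T : measurableType d') (D : set T)
    (f : T -> E) :
  (forall U : set E, open U -> measurable (D `&` f @^-1` U)) -> measurable_fun D f.
Proof.
by move=> h; apply: (@measurability _ _ T E D f (@open E)) => // _ [U oU <-]; exact: h.
Qed.

Lemma continuous_measurable_rV (f : E -> R) : continuous f -> measurable_fun setT f.
Proof.
move=> cf; apply: (measurability _ (RGenOpens.measurableE R)).
move=> _ [_ [a [b ->]] <-]; rewrite setTI; apply: open_measurable_rV.
by apply: open_comp => // x _; exact: cf.
Qed.

Definition ratv (a : 'rV[rat]_d) : E := map_mx ratr a.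

Definition rball (p : 'rV[rat]_d * nat) : set E := ball (ratv p.1) (p.2.+1%:R^-1).

Lemma open_rball p : open (rball p). Proof. exact: ball_open. Qed.

Lemma ratv_dense (x : E) (e : R) : 0 < e -> exists a, ball x e (ratv a).
Proof.
move=> e0.
have /choice[f fP] : forall j : 'I_d, exists q : rat, x 0 j - e < ratr q < x 0 j + e.
  move=> j.
  have /rat_in_itvoo[q]: x 0 j - e < x 0 j + e by lra.
  by rewrite in_itv/= => h; exists q.
exists (\row_j f j); split=> // i j; rewrite !mxE (ord1 i) /ball/=.
by have := fP j; rewrite distrC ltr_distl.
Qed.

Lemma rball_small (x : E) (e : R) : 0 < e ->
  exists p, rball p x /\ rball p `<=` ball x e.
Proof.
move=> e0; have e20 : 0 < e / 2 by rewrite divr_gt0.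
have [n ne] := ltr_add_invr e20; rewrite add0r in ne.
have [|a xa] := @ratv_dense x n.+1%:R^-1; first by [].
exists (a, n); split; first exact/ball_sym.
move=> y ay; apply: (@le_ball _ _ _ (n.+1%:R^-1 + n.+1%:R^-1)).
  by rewrite [leRHS]splitr lerD// ltW.
exact: ball_triangle xa ay.
Qed.

Lemma rball_basis (U : set E) x : open U -> U x ->
  exists p, rball p x /\ rball p `<=` U.
Proof.
move=> oU Ux.
have /nbhs_ballP[e /= e0 eU] : nbhs x U by exact: open_nbhs_nbhs.
have [p [px pe]] := rball_small x e0.
by exists p; split=> //; exact: subset_trans eU.
Qed.

(** Measurability refers to the product sigma-algebra on [E * E], so continuity is combined with the
    countable base: the preimage of an open set is a countable union of open boxes. *)
Lemma measurable_addrv : measurable_fun setT (fun z : E * E => z.1 + z.2).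
Proof.
apply: measurable_fun_rV => U oU; rewrite setTI.
rewrite (_ : _ @^-1` U = \bigcup_(p : ('rV[rat]_d * nat) * ('rV[rat]_d * nat))
   [set z | (rball p.1 z.1 /\ rball p.2 z.2) /\
     rball p.1 `*` rball p.2 `<=` (fun z => z.1 + z.2) @^-1` U]); last first.
  apply/seteqP; split=> [[x y] /= Uxy|[x y] [p _ /= [xy sU]]]; last exact: (sU (x, y)).
  have /nbhs_ballP[e /= e0 eU] : nbhs (x + y) U by exact: open_nbhs_nbhs.
  have e20 : 0 < e / 2 by rewrite divr_gt0.
  have [p [px pe]] := rball_small x e20; have [q [qy qe]] := rball_small y e20.
  exists (p, q) => //=; split=> // -[x' y'] /= [/pe xx' /qe yy']; apply: eU.
  move: xx' yy'; rewrite -!ball_normE/= => xx' yy'.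
  by rewrite opprD addrACA (le_lt_trans (ler_normD _ _))// [ltRHS]splitr ltrD.
apply: countable_bigcupT_measurable => // p.
have [pU|pU] := pselect (rball p.1 `*` rball p.2 `<=` (fun z => z.1 + z.2) @^-1` U).
  rewrite (_ : [set _ | _] = rball p.1 `*` rball p.2).
    by apply: measurableX; apply: open_measurable_rV; exact: open_rball.
  by apply/seteqP; split=> z /= => [[]|].
by rewrite (_ : [set _ | _] = set0)// -subset0 => z [].
Qed.

End borel_vectors.

(** * Measurability on the path space *)

Section skorokhod_borel.
Context {R : realType} {d : nat}.
Local Notation E := 'rV[R]_d.
Local Notation W := (skorokhod R d).
Implicit Types (v : W) (U V : set E).

(** A time change moving times by less than the distance from [s] to both ends of the interval keeps
    the hit inside it. Evaluation at a fixed time is not J1 continuous; these open events give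
    access to the Borel sets of the path space instead. *)
Lemma J1_open_hits (a b : R) V : 0 <= a -> open V ->
  J1_open [set v : W | exists2 s, a < s < b & V (v s)].
Proof.
move=> a0 oV v [s /andP[as_ sb] Vs].
have /nbhs_ballP[e0 /= e00 eV] : nbhs (v s) V by exact: open_nbhs_nbhs.
pose e := Num.min e0 (Num.min (s - a) (b - s)).
have e_gt0 : 0 < e by rewrite !lt_min e00/= !subr_gt0 as_.
exists b, e; split=> // v' [l [linc lsurj] lv].
have [r r0 lrs] : (l @` [set t | 0 <= t]) s by rewrite lsurj /=; lra.
have eb : e <= b - s by rewrite !ge_min lexx !orbT.
have ea : e <= s - a by rewrite !ge_min lexx !orbT.
(* Closeness is known on [[0, b]] only. If [b < r], monotonicity gives [l b < l r = s <= b - e],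
   against [|l b - b| < e]. *)
have rb : r <= b.
  rewrite leNgt; apply/negP => br.
  have [|+ _] := lv b; first by rewrite lexx andbT; lra.
  have /linc/(_ br) : 0 <= b by lra.
  by rewrite ltr_norml lrs; lra.
have [|lr vr] := lv r; first by rewrite r0.
exists r.
  by move: lr; rewrite ltr_norml lrs; lra.
apply: eV; rewrite -ball_normE/= -lrs distrC (lt_le_trans vr)//.
by rewrite ge_min lexx.
Qed.

Lemma skorokhod_right_nbhs v (t : R) V : open V -> V (v t) ->
  exists2 e, 0 < e & forall s, t <= s < t + e -> V (v s).
Proof.
move=> oV Vt; have [vr _ _] := path_cadlag v.
have : nbhs (v t) V by exact: open_nbhs_nbhs.
move=> /(vr t) [e /= e0 eV]; exists e => // s /andP[].
rewrite le_eqVlt => /predU1P[<-//|ts ste]; apply: eV => //=.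
by rewrite distrC gtr0_norm; lra.
Qed.

Lemma rball_closure V x : open V -> V x ->
  exists p, @rball R d p x /\ closure (rball p) `<=` V.
Proof.
move=> oV Vx.
have /nbhs_ballP[e /= e0 eV] : nbhs x V by exact: open_nbhs_nbhs.
have e20 : 0 < e / 2 by rewrite divr_gt0.
have [p [px pe]] := rball_small x e20; exists p; split=> // y.
move=> /(_ (ball y (e / 2)) (nbhsx_ballx _ _ e20))[z [/pe xz yz]].
by apply: eV; rewrite (splitr e); apply: ball_triangle xz (ball_sym yz).
Qed.

(** Right continuity trades the value at [t] for the values on an open interval to its right. Closed
    balls are used so that staying in one of them is the complement of an event as in
    [J1_open_hits]. *)
Lemma skorokhod_closure_rball v (t : R) V : open V ->
  V (v t) <-> exists p n, closure (rball p) `<=` V /\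
    forall s, t < s < t + n.+1%:R^-1 -> closure (rball p) (v s).
Proof.
move=> oV; split=> [Vt|[p [n [pV h]]]].
  have [p [pv pV]] := rball_closure oV Vt; exists p.
  have [e e0 he] := skorokhod_right_nbhs (@open_rball R d p) pv.
  have [n] := ltr_add_invr e0; rewrite add0r => ne.
  exists n; split=> // s /andP[ts st]; apply/subset_closure/he.
  by rewrite (ltW ts)/= (lt_trans st)// ltrD2l.
apply: contrapT => nV; have nc : (~` closure (rball p)) (v t) by move=> /pV.
have [|e e0 he] := skorokhod_right_nbhs _ nc.
  by apply: closed_openC; exact: closed_closure.
have [s /andP[ts]] : exists s, t < s < Num.min (t + e) (t + n.+1%:R^-1).
  have tm : t < Num.min (t + e) (t + n.+1%:R^-1).
    by rewrite lt_min !ltrDl e0/= invr_gt0.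
  by eexists; apply/andP; split; [exact: (midf_lt tm).1|exact: (midf_lt tm).2].
rewrite lt_min => /andP[se sn].
have : (~` closure (rball p)) (v s) by apply: he; rewrite ltW.
by apply; apply: h; rewrite ts.
Qed.

Lemma measurable_coord (t : R) : measurable_fun setT (fun v : W => v t).
Proof.
wlog t0 : t / 0 <= t.
  move=> h; have [|t0] := leP 0 t; first exact: h.
  rewrite (_ : (fun v : W => v t) = (fun v : W => v 0)); first exact: h.
  by apply/funext => v; have [_ _ ->] := path_cadlag v.
apply: measurable_fun_rV => V oV; rewrite setTI.
rewrite (_ : _ @^-1` V = \bigcup_(pn : ('rV[rat]_d * nat) * nat)
  ([set _ | closure (rball pn.1) `<=` V] `&`
  ~` [set v : W | exists2 s, t < s < t + pn.2.+1%:R^-1 &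
                    (~` closure (@rball R d pn.1)) (v s)])); last first.
  apply/seteqP; split=> [v /(skorokhod_closure_rball v t oV)[p [n [pV h]]]|v [[p n] _]] /=.
    by exists (p, n) => //; split=> // -[s ts]; apply; exact: h.
  move=> [pV h]; apply/(skorokhod_closure_rball v t oV).
  exists p, n; split=> // s ts; apply: contrapT => nc; apply: h.
  by exists s.
apply: countable_bigcupT_measurable; first exact: countableP.
move=> [p n] /=; apply: measurableI; first exact: measurable_cst_set.
apply: measurableC; apply: sub_sigma_algebra.
suff : J1_open [set v : W | exists2 s, t < s < t + n.+1%:R^-1 &
                            (~` closure (@rball R d p)) (v s)] by [].
by apply: J1_open_hits => //; apply: closed_openC; exact: closed_closure.
Qed.

(** Joint measurability in path and time is what Fubini requires later. Rational times suffice: a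
    value outside a closed ball stays outside for a while to the right, and for a fixed rational
    time the constraint on [t] is Borel. *)
Lemma measurable_eval : measurable_fun setT (fun z : W * R => z.1 z.2).
Proof.
apply: measurable_fun_rV => V oV; rewrite setTI.
rewrite (_ : _ @^-1` V = \bigcup_(pn : ('rV[rat]_d * nat) * nat)
  ([set _ | closure (rball pn.1) `<=` V] `&`
  \bigcap_(q : rat) (([set: W] `*` ([set r | ratr q <= r] `|` [set r : R | r + pn.2.+1%:R^-1 <= ratr q]))
     `|` ([set v : W | closure (@rball R d pn.1) (v (ratr q))] `*` setT)))); last first.
  apply/seteqP; split=> [[v t] /= /(skorokhod_closure_rball v t oV)[p [n [pV h]]]|[v t] [[p n] _]] /=.
    exists (p, n) => //=; split=> // q _ /=.
    have [|tq] := leP (ratr q) t; first by left; split=> //; left.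
    have [|qt] := leP (t + n.+1%:R^-1) (ratr q); first by left; split=> //; right.
    by right; split=> //; apply: h; rewrite tq.
  move=> [pV h]; apply/(skorokhod_closure_rball v t oV).
  exists p, n; split=> // s /andP[ts st]; apply: contrapT => nc.
  have nc' : (~` closure (rball p)) (v s) by [].
  have [|e e0 he] := skorokhod_right_nbhs _ nc'.
    by apply: closed_openC; exact: closed_closure.
  have /rat_in_itvoo[q] : s < Num.min (s + e) (t + n.+1%:R^-1).
    by rewrite lt_min st andbT ltrDl.
  rewrite in_itv/= lt_min => /and3P[sq qse qt].
  have := h q Logic.I => /= -[[_ [hq|hq]]|[hq _]].
  - by have := lt_trans ts sq; rewrite ltNge hq.
  - by have := lt_le_trans qt hq; rewrite ltxx.
  - by apply: (he (ratr q)) hq; rewrite (ltW sq).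
apply: countable_bigcupT_measurable; first exact: countableP.
move=> [p n] /=; apply: measurableI; first exact: measurable_cst_set.
apply: countable_bigcapT_measurable => //= q.
apply: measurableU; apply: measurableX => //.
  by apply: measurableU; rewrite -[X in measurable X]setTI;
    [exact: measurable_fun_le|apply: measurable_fun_le => //; exact: measurable_funD].
rewrite -[X in measurable X]setTI.
by apply: measurable_coord => //; apply: closed_measurable_rV; exact: closed_closure.
Qed.

End skorokhod_borel.

(** * Filtration and entrance times *)

Section filtration.
Context {R : realType} {d : nat}.
Local Notation E := 'rV[R]_d.
Local Notation W := (skorokhod R d).

Definition cylinders (t : R) : set (set W) :=
  [set C | exists (r : R) (B : set E),
     [/\ 0 <= r <= t, measurable B & C = [set v : W | B (v r)]]].

(** With the past up to [t] as the sigma-algebra of a measurable type, its closure properties are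
    instances of the general ones. *)
Let FT t := g_sigma_algebraType (cylinders t).

Lemma natural_filtrationE t : natural_filtration t = @measurable _ (FT t).
Proof. by []. Qed.

Lemma natural_filtrationC t (C : set W) :
  natural_filtration t C -> natural_filtration t (~` C).
Proof. by rewrite natural_filtrationE => mC; exact: (@measurableC _ (FT t)). Qed.

Lemma natural_filtrationI t (B C : set W) : natural_filtration t B ->
  natural_filtration t C -> natural_filtration t (B `&` C).
Proof. by rewrite natural_filtrationE => mB mC; exact: (@measurableI _ (FT t)). Qed.

Lemma natural_filtration_bigcup t (U : countType) (F : U -> set W) :
  (forall i, natural_filtration t (F i)) -> natural_filtration t (\bigcup_i F i).
Proof.
rewrite natural_filtrationE => mF.
by apply: (@countable_bigcupT_measurable _ (FT t)).
Qed.

Lemma natural_filtration_bigcap t (U : countType) (F : U -> set W) :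
  (forall i, natural_filtration t (F i)) -> natural_filtration t (\bigcap_i F i).
Proof.
rewrite natural_filtrationE => mF.
by apply: (@countable_bigcapT_measurable _ (FT t)).
Qed.

Lemma natural_filtration_coord t r (B : set E) : 0 <= r <= t -> measurable B ->
  natural_filtration t [set v : W | B (v r)].
Proof. by move=> rt mB; apply: sub_sigma_algebra; exists r, B. Qed.

Lemma natural_filtrationT t : natural_filtration t [set: W].
Proof. by rewrite natural_filtrationE; exact: (@measurableT _ (FT t)). Qed.

Lemma natural_filtration_le s t : s <= t ->
  natural_filtration s `<=` @natural_filtration R d t.
Proof.
move=> st; apply: smallest_sub; first exact: smallest_sigma_algebra.
move=> _ [r [B [/andP[r0 rs] mB ->]]]; apply: natural_filtration_coord => //.
by rewrite r0 (le_trans rs).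
Qed.

Lemma natural_filtration_measurable t :
  natural_filtration t `<=` (measurable : set (set W)).
Proof.
apply: smallest_sub; first exact: sigma_algebra_measurable.
move=> _ [r [B [_ mB ->]]]; rewrite -[X in measurable X]setTI.
exact: measurable_coord.
Qed.

End filtration.

(** * The approach to the complement of the domain *)

Section exit.
Context {R : realType} {d : nat}.
Local Notation E := 'rV[R]_d.
Local Notation W := (skorokhod R d).
Variable D : set E.
Hypothesis oD : open D.
Implicit Types (v : W) (n : nat) (r s t : R).

Definition nbhd n : set E := \bigcup_(z in ~` D) ball z n.+1%:R^-1.

Lemma open_nbhd n : open (nbhd n).
Proof. by apply: bigcup_open => z _; exact: ball_open. Qed.

Lemma nbhdS m n : (n <= m)%N -> nbhd m `<=` nbhd n.
Proof.
move=> nm y [z Dz zy]; exists z => //; apply: le_ball zy.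
by rewrite lef_pV2 ?posrE// ler_nat.
Qed.

Lemma nbhdN n y : ~ nbhd n y -> D y.
Proof.
by move=> nV; apply: contrapT => Dy; apply: nV; exists y => //; exact: ballxx.
Qed.

Lemma nbhd_sep y : D y -> exists n, ~ nbhd n y.
Proof.
move=> Dy; have /nbhs_ballP[e /= e0 eD] : nbhs y D by exact: open_nbhs_nbhs.
have [n] := ltr_add_invr e0; rewrite add0r => ne; exists n => -[z Dz zy].
by apply/Dz/eD/ball_sym; apply: le_ball zy; exact: ltW.
Qed.

Lemma nbhd_right v n r : ~ nbhd n (v r) ->
  exists2 e, 0 < e & forall s, r <= s < r + e -> ~ nbhd n.+1 (v s).
Proof.
move=> nV.
(* The gap between consecutive radii: a displacement smaller than [e] cannot lead from outside
   [nbhd n] into [nbhd n.+1]. *)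
pose e : R := n.+1%:R^-1 - n.+2%:R^-1.
have e0 : 0 < e by rewrite subr_gt0 ltf_pV2 ?posrE// ltr_nat.
have [|e' e'0 he] := @skorokhod_right_nbhs R d v r (ball (v r) e) (ball_open _ _).
  exact: ballxx.
exists e' => // s /he vrs [z Dz zs]; apply: nV; exists z => //.
have := ball_triangle zs (ball_sym vrs); rewrite /e.
by rewrite addrC subrK.
Qed.

Local Open Scope ereal_scope.

Definition entrance_time n v : \bar R :=
  ereal_inf [set t%:E | t in [set t : R | (0 <= t)%R /\ nbhd n (v t)]].

(* The limit of the entrance times into shrinking neighborhoods of the
   complement of D: unlike exit_time it is Borel, and it is bounded above by
   exit_time. *)
Definition approach_time v : \bar R := ereal_sup (range (entrance_time ^~ v)).

Lemma le_entrance_time n v (t : R) : t%:E <= entrance_time n v <->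
  forall s, (0 <= s)%R -> (s < t)%R -> ~ nbhd n (v s).
Proof.
split=> [h s s0 st Vs|h].
  have : t%:E <= s%:E by apply: le_trans h _; apply: ereal_inf_lbound; exists s.
  by rewrite lee_fin leNgt st.
apply: le_ereal_inf_tmp => _ [s [s0 Vs] <-]; rewrite lee_fin leNgt.
by apply/negP => st; exact: h Vs.
Qed.

Lemma entrance_time_ge0 n v : 0 <= entrance_time n v.
Proof. by apply: le_ereal_inf_tmp => _ [s [s0 _] <-]; rewrite lee_fin. Qed.

Lemma entrance_time_le m n v : (n <= m)%N -> entrance_time n v <= entrance_time m v.
Proof.
move=> nm; apply: ereal_inf_le_tmp => _ [s [s0 Vs] <-]; exists s => //.
by split=> //; exact: nbhdS nm _ Vs.
Qed.

Lemma entrance_le_approach n v : entrance_time n v <= approach_time v.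
Proof. by apply: ereal_sup_ubound; exists n. Qed.

Lemma approach_time_ge0 v : 0 <= approach_time v.
Proof. exact: le_trans (entrance_time_ge0 0 v) (entrance_le_approach 0 v). Qed.

(** The strict inequality is gained by passing from [n] to [n.+1]: right continuity keeps the path
    off the smaller neighbourhood for some time beyond [r]. *)
Lemma lt_approach_time v r : (0 <= r)%R -> r%:E < approach_time v <->
  exists n, forall s, (0 <= s)%R -> (s <= r)%R -> ~ nbhd n (v s).
Proof.
move=> r0; split=> [|[n h]].
  move=> /ereal_sup_gt[_ [n _ <-] rn]; exists n => s s0 sr Vs.
  have : r%:E < s%:E by apply: lt_le_trans rn _; apply: ereal_inf_lbound; exists s.
  by rewrite lte_fin ltNge sr.
have [e e0 he] := nbhd_right (h r r0 (lexx _)).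
have : (r + e)%:E <= entrance_time n.+1 v.
  apply/le_entrance_time => s s0 sre; have [sr|rs] := leP s r.
    by move=> /(nbhdS (leqnSn n)); exact: h.
  by apply: he; rewrite (ltW rs).
move=> /le_trans/(_ (entrance_le_approach _ _)); apply: lt_le_trans.
by rewrite lte_fin ltrDl.
Qed.

Lemma before_approach_time v r : (0 <= r)%R -> r%:E < approach_time v -> D (v r).
Proof. by move=> r0 /(lt_approach_time _ r0)[n h]; apply: (@nbhdN n); exact: h. Qed.

Lemma approach_time_gt0 v : D (v 0%R) -> 0 < approach_time v.
Proof.
move=> /nbhd_sep[n nV]; apply/lt_approach_time => //; exists n => s s0 s0'.
by rewrite (_ : s = 0%R)//; apply: le_anti; rewrite s0 s0'.
Qed.

Lemma approach_le_exit v : approach_time v <= exit_time D v.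
Proof.
apply: ge_ereal_sup => _ [n _ <-]; apply: le_ereal_inf_tmp => _ [t [t0 Dt] <-].
apply: ereal_inf_lbound; exists t => //; split; first exact: ltW.
by exists (v t) => //; exact: ballxx.
Qed.

(** What separates the two times is the position at $T$. The start in [D] matters because
    [exit_time] ignores time 0: it makes $T$ positive, so that $T$ itself is admissible in the
    infimum. *)
Lemma approach_eq_exit v : D (v 0%R) ->
  (forall t, approach_time v = t%:E -> ~ D (v t)) -> exit_time D v = approach_time v.
Proof.
move=> D0 h; apply/eqP; rewrite eq_le approach_le_exit andbT.
have := approach_time_gt0 D0; case Et: (approach_time v) => [t| |]//; rewrite ?leey//.
by rewrite lte_fin => t0; apply: ereal_inf_lbound; exists t => //; split=> //; exact: h.
Qed.

(** The path up to [r] and the shifted path each avoid some neighbourhood; the larger index serves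
    the whole path. *)
Lemma approach_time_shift v r a : (0 <= r)%R -> (0 <= a)%R -> r%:E < approach_time v ->
  a%:E < approach_time (Defs.shift r v) <-> (r + a)%:E < approach_time v.
Proof.
move=> r0 a0 /(lt_approach_time _ r0)[m hm].
split=> [/(lt_approach_time _ a0)[n hn]|].
  apply/lt_approach_time; first exact: addr_ge0.
  exists (maxn n m) => s s0 sra; have [sr|/ltW rs] := leP s r.
    by move=> /(nbhdS (leq_maxr _ _)); exact: hm.
  move=> /(nbhdS (leq_maxl n m)); have /= := hn (s - r)%R.
  by rewrite max_l ?subr_ge0// subrKC lerBlDl; apply.
move=> /(lt_approach_time _ (addr_ge0 r0 a0))[n hn]; apply/lt_approach_time => //.
exists n => s s0 sa /=; rewrite max_l//; apply: hn; first exact: addr_ge0.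
by rewrite lerD2l.
Qed.

(** Only times strictly before [s] are involved, so the event lies in the raw filtration, without
    right-continuous augmentation. Since [nbhd n] is open, rational times decide. *)
Lemma entrance_time_filtration n s : (0 <= s)%R ->
  natural_filtration s [set v | s%:E <= entrance_time n v].
Proof.
move=> s0; rewrite (_ : [set v | _] = \bigcap_(q : rat)
   [set v : W | (0 <= ratr q :> R)%R -> (ratr q < s)%R -> (~` nbhd n) (v (ratr q))]).
  apply: natural_filtration_bigcap => q.
  have [q0|q0] := leP 0%R (ratr q : R); last first.
    by rewrite (_ : [set _ | _] = setT); [exact: natural_filtrationT|exact/seteqP].
  have [sq|qs] := leP s (ratr q : R).
    by rewrite (_ : [set _ | _] = setT); [exact: natural_filtrationT|exact/seteqP].
  rewrite (_ : [set _ | _] = [set v : W | (~` nbhd n) (v (ratr q))]).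
    apply: natural_filtration_coord; first by rewrite q0 ltW.
    by apply: measurableC; apply: open_measurable_rV; exact: open_nbhd.
  by apply/seteqP; split=> v /=; [exact|move=> + _ _].
apply/seteqP; split=> [v /le_entrance_time h q _ /= q0 qs|v h]; first exact: h.
apply/le_entrance_time => t t0 ts Vt.
have [e e0 he] := skorokhod_right_nbhs (@open_nbhd n) Vt.
have /rat_in_itvoo[q] : (t < Num.min (t + e) s)%R by rewrite lt_min ts andbT ltrDl.
rewrite in_itv/= lt_min => /and3P[tq qte qs].
have /= := h q Logic.I; apply => //; first by rewrite ltW// (le_lt_trans t0).
by apply: he; rewrite (ltW tq).
Qed.

Lemma approach_time_filtration s : (0 <= s)%R ->
  natural_filtration s [set v | s%:E <= approach_time v].
Proof.
move=> s0; rewrite (_ : [set v | _] = \bigcap_(q : rat) \bigcup_(n : nat)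
   [set v : W | (0 <= ratr q :> R)%R -> (ratr q < s)%R -> (ratr q)%:E <= entrance_time n v]).
  apply: natural_filtration_bigcap => q; apply: natural_filtration_bigcup => n.
  have [q0|q0] := leP 0%R (ratr q : R); last first.
    by rewrite (_ : [set _ | _] = setT); [exact: natural_filtrationT|exact/seteqP].
  have [sq|qs] := leP s (ratr q : R).
    by rewrite (_ : [set _ | _] = setT); [exact: natural_filtrationT|exact/seteqP].
  rewrite (_ : [set _ | _] = [set v : W | (ratr q)%:E <= entrance_time n v]).
    by apply: (natural_filtration_le (ltW qs)); exact: entrance_time_filtration.
  by apply/seteqP; split=> v /=; [exact|move=> + _ _].
apply/seteqP; split=> [v /= h q _ /=|v h /=].
  have [qs|sq] := ltP (ratr q) s; last by exists 0%N => //= _; rewrite ltNge sq.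
  have : (ratr q)%:E < approach_time v by apply: lt_le_trans h; rewrite lte_fin.
  by move=> /ereal_sup_gt[_ [n _ <-] rn]; exists n => //= _ _; exact: ltW.
rewrite leNgt; apply/negP => Ts; have T0 := approach_time_ge0 v.
have Tf : approach_time v \is a fin_num by rewrite ge0_fin_numE// (lt_trans Ts) ?ltry.
move: T0 Ts h; rewrite -(fineK Tf) lte_fin lee_fin; set T := fine _ => T0 Ts h.
have /rat_in_itvoo[q] := Ts; rewrite in_itv/= => /andP[Tq qs].
have [n _ /=] := h q Logic.I; rewrite qs (le_trans T0 (ltW Tq)) => /(_ erefl erefl).
move=> /le_trans/(_ (entrance_le_approach n v)); rewrite -(fineK Tf) lee_fin.
by rewrite leNgt Tq.
Qed.

(** To survive [s] strictly is to avoid some neighbourhood before [s] and at [s], with no look into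
    the future. The Markov property at time [s] can thus be applied on this event. *)
Lemma lt_approach_time_filtration s : (0 <= s)%R ->
  natural_filtration s [set v | s%:E < approach_time v].
Proof.
move=> s0; rewrite (_ : [set v | _] = \bigcup_(n : nat)
   ([set v : W | s%:E <= entrance_time n v] `&` [set v : W | (~` nbhd n) (v s)])).
  apply: natural_filtration_bigcup => n; apply: natural_filtrationI.
    exact: entrance_time_filtration.
  apply: natural_filtration_coord; first by rewrite s0 lexx.
  by apply: measurableC; apply: open_measurable_rV; exact: open_nbhd.
apply/seteqP; split=> [v /(lt_approach_time _ s0)[n h]|v [n _ [/= /le_entrance_time h1 h2]]].
  exists n => //; split=> /=; last exact: h.
  by apply/le_entrance_time => r r0 rs; exact: h r0 (ltW rs).
apply/lt_approach_time => //; exists n => r r0.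
by rewrite le_eqVlt => /predU1P[->//|]; exact: h1.
Qed.

Lemma measurable_fun_time (T : W -> \bar R) : (forall v, 0 <= T v) ->
  (forall s, (0 <= s)%R -> measurable [set v | s%:E <= T v]) -> measurable_fun setT T.
Proof.
move=> T0 mT; apply: (measurability _ (@ErealGenCInfty.measurableE R)).
move=> _ [_ [r ->] <-]; rewrite setTI.
rewrite (_ : _ @^-1` _ = [set v | r%:E <= T v]); last first.
  by apply/seteqP; split=> v /=; rewrite in_itv/= andbT.
have [r0|r0] := leP 0%R r; first exact: mT.
rewrite (_ : [set _ | _] = setT); first exact: measurableT.
by apply/seteqP; split=> v //= _; rewrite (le_trans _ (T0 v))// lee_fin ltW.
Qed.

Lemma measurable_approach_time : measurable_fun setT approach_time.
Proof.
apply: measurable_fun_time => [v|s s0]; first exact: approach_time_ge0.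
by apply: (@natural_filtration_measurable _ _ s); exact: approach_time_filtration.
Qed.

Lemma measurable_entrance_time n : measurable_fun setT (entrance_time n).
Proof.
apply: measurable_fun_time => [v|s s0]; first exact: entrance_time_ge0.
by apply: (@natural_filtration_measurable _ _ s); exact: entrance_time_filtration.
Qed.

End exit.

(** * Test functions *)

Lemma bounded_onP {R : realType} (T : Type) (f : T -> R) (A : set T) :
  [bounded f x | x in A] <-> exists2 K, 0 <= K & forall x, A x -> `|f x| <= K.
Proof.
split=> [[M [_ h]]|[K K0 h]].
  exists (Num.max 0 (M + 1)); first by rewrite le_max lexx.
  by move=> x Ax; apply: h => //; rewrite lt_max ltrDl ltr01 orbT.
by exists K; split; [exact: num_real|move=> M /ltW KM x Ax; exact: le_trans (h x Ax) KM].
Qed.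

Section Cb2.
Context {R : realType} {d : nat}.
Local Notation E := 'rV[R]_d.
Implicit Types (f g : E -> R) (i : 'I_d).
Local Notation e_ i := (delta_mx 0 i : E).

Lemma is_derive_line f (p v : E) (s : R) :
  derivable f (p + s *: v) v ->
  is_derive s 1 (fun s => f (p + s *: v)) ('D_v f (p + s *: v)).
Proof.
move=> df.
have e : (fun h : R => h^-1 *: (((fun s => f (p + s *: v)) \o shift s) (h *: 1) - f (p + s *: v)))
     = (fun h : R => h^-1 *: ((f \o shift (p + s *: v)) (h *: v) - f (p + s *: v))).
  apply/funext => h /=; congr (_ *: (f _ - _)).
  by rewrite [h *: 1]mulr1 scalerDl addrCA.
by split; rewrite /derivable/derive e.
Qed.

Lemma partial_MVT f i (p : E) (h : R) : (forall x, derivable f x (e_ i)) ->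
  exists2 s, `|s| <= `|h| &
    f (p + h *: e_ i) - f p = partial i f (p + s *: e_ i) * h.
Proof.
move=> df.
have dphi (s : R) : is_derive s 1 (fun s : R => f (p + s *: e_ i)) (partial i f (p + s *: e_ i)).
  exact: is_derive_line.
have cphi : continuous (fun s : R => f (p + s *: e_ i)).
  by move=> s; apply: differentiable_continuous; apply/derivable1_diffP; have [] := dphi s.
have h0 : f p = f (p + 0 *: e_ i) by rewrite scale0r addr0.
have [hge|hlt] := leP 0 h.
  have [|c] := MVT_segment hge (fun s _ => dphi s).
    exact: continuous_subspaceT.
  rewrite in_itv/= => /andP[c0 ch] e; exists c; first by rewrite !ger0_norm.
  by rewrite {1}h0 e subr0.
have [|c] := MVT_segment (ltW hlt) (fun s _ => dphi s).
  exact: continuous_subspaceT.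
rewrite in_itv/= => /andP[hc c0] e; exists c; first by rewrite !ler0_norm ?lerN2 ?(ltW hlt).
by rewrite {1}h0 -opprB e sub0r mulrN opprK.
Qed.

Lemma coord_le_norm (y : E) i : `|y 0 i| <= `|y|.
Proof.
by rewrite [leRHS]/Num.Def.normr/= mx_normrE; apply/bigmax_geP; right; exists (0, i).
Qed.

Lemma norm_le_coord (y : E) (B : R) : 0 <= B -> (forall i, `|y 0 i| <= B) -> `|y| <= B.
Proof.
move=> B0 h; rewrite [leLHS]/Num.Def.normr/= mx_normrE; apply/bigmax_leP; split=> // -[a i] _.
by rewrite (ord1 a).
Qed.

Lemma dot_ge0 (y : E) : 0 <= dot y y.
Proof. by apply: sumr_ge0 => i _; rewrite -expr2 sqr_ge0. Qed.

Lemma sqr_norm_le_dot (y : E) : `|y| ^+ 2 <= dot y y.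
Proof.
rewrite -[leRHS]sqr_sqrtr ?dot_ge0// lerXn2r ?nnegrE// ?sqrtr_ge0//.
apply: norm_le_coord => [|i]; first exact: sqrtr_ge0.
rewrite -sqrtr_sqr ler_wsqrtr// /dot (bigD1 i)//= -expr2 lerDl.
by apply: sumr_ge0 => j _; rewrite -expr2 sqr_ge0.
Qed.

(** The segment from [x] to [x + y] is replaced by a walk changing one coordinate at a time, as
    [Cb2] speaks of partial derivatives only; the walk stays in the box of radius [|y|] for the
    maximum norm. With [c = 0] this is a Lipschitz bound, with [c] the gradient a Taylor
    estimate. *)
Lemma partial_increment f (c : E) (B : R) (x y : E) :
  (forall i z, derivable f z (e_ i)) ->
  (forall i z, `|z| <= `|y| -> `|partial i f (x + z) - c 0 i| <= B) ->
  `|f (x + y) - f x - dot y c| <= d%:R * (B * `|y|).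
Proof.
move=> df hB.
pose P (k : nat) : E := \row_j (if (j < k)%N then y 0 j else 0).
have Py k : `|P k| <= `|y|.
  apply: norm_le_coord => // j; rewrite mxE; case: ifP => _.
    exact: coord_le_norm.
  by rewrite normr0.
suff H k : (k <= d)%N ->
    `|f (x + P k) - f x - \sum_(j < d | (j < k)%N) y 0 j * c 0 j| <= k%:R * (B * `|y|).
  have -> : y = P d by apply/rowP => j; rewrite mxE ltn_ord.
  have := H d (leqnn d); rewrite (_ : P d = y); last by apply/rowP => j; rewrite mxE ltn_ord.
  by rewrite /dot; under eq_bigl do rewrite ltn_ord.
elim: k => [_|k IH kd].
  rewrite big_pred0// mul0r (_ : P 0%N = 0) ?addr0 ?subrr ?subr0 ?normr0//.
  by apply/rowP => j; rewrite !mxE.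
pose i := Ordinal kd.
have PS : P k.+1 = P k + y 0 i *: e_ i.
  apply/rowP => j; rewrite !mxE eqxx/= ltnS leq_eqVlt.
  have [ji|ji] := eqVneq (j : nat) k.
    by rewrite (_ : j = i) ?eqxx ?ltnn/= ?add0r ?mulr1//; exact/val_inj.
  by rewrite (_ : (j == i) = false) ?mulr0 ?addr0//; apply/negbTE; apply: contraNN ji => /eqP->.
have [s sy es] := partial_MVT (x + P k) (y 0 i) (df i).
rewrite PS addrA (bigD1 i)//=.
rewrite (eq_bigl (fun j : 'I_d => (j < k)%N)); last first.
  move=> j; rewrite ltnS leq_eqVlt -(inj_eq val_inj)/=.
  by case: eqVneq => [->|_]; rewrite ?ltnn ?andbF ?andbT.
have := IH (ltnW kd); set S := \sum_(j < d | _) _ => {}IH.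
rewrite (_ : _ - _ = (f (x + P k) - f x - S) +
   (partial i f (x + P k + s *: e_ i) - c 0 i) * y 0 i); last first.
  by rewrite mulrBl -es; ring.
rewrite (le_trans (ler_normD _ _))// [leRHS](_ : _ = k%:R * (B * `|y|) + B * `|y|); last first.
  by rewrite -natr1 mulrDl mul1r.
rewrite lerD// normrM.
rewrite ler_pM ?coord_le_norm//.
rewrite -addrA; apply: hB; apply: norm_le_coord => // j; rewrite !mxE eqxx/=.
have [ji|ji] := eqVneq j i.
  by rewrite ji ltnn add0r mulr1 (le_trans sy)// coord_le_norm.
by rewrite mulr0 addr0; case: ifP => _; rewrite ?coord_le_norm// normr0.
Qed.

(** [Cb2] amounts to [Cb1] for the function and for each partial derivative, so that stability under
    sums and products needs a proof at first order only. *)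
Definition Cb1 f := Cb f /\ forall i, (forall x, derivable f x (e_ i)) /\ Cb (partial i f).

Lemma Cb2P f : Cb2 f <-> Cb1 f /\ forall i, Cb1 (partial i f).
Proof.
split=> [[cf h]|[[cf h] h2]].
  by split=> [|i]; split=> [//|]; [move=> i|case: (h i)|move=> j]; have [] := h i.
split=> // i; have [h1 h1'] := h i; have [_ h2'] := h2 i.
by split=> // j; case: (h2' j).
Qed.

Lemma CbP f : Cb f <-> continuous f /\ exists2 K, 0 <= K & forall x, `|f x| <= K.
Proof.
split=> -[cf]; first by move=> /bounded_onP[K K0 h]; split=> //; exists K => // x; exact: h.
by move=> [K K0 h]; split=> //; apply/bounded_onP; exists K.
Qed.

Lemma CbD f g : Cb f -> Cb g -> Cb (f + g).
Proof.
move=> /CbP[cf [K K0 hf]] /CbP[cg [L L0 hg]]; apply/CbP; split=> [x|].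
  by apply: continuousD; [exact: cf|exact: cg].
exists (K + L); first exact: addr_ge0.
by move=> x; rewrite (le_trans (ler_normD _ _))// lerD.
Qed.

Lemma CbM f g : Cb f -> Cb g -> Cb (f * g).
Proof.
move=> /CbP[cf [K K0 hf]] /CbP[cg [L L0 hg]]; apply/CbP; split=> [x|].
  by apply: continuousM; [exact: cf|exact: cg].
by exists (K * L); [exact: mulr_ge0|move=> x; rewrite normrM ler_pM].
Qed.

Lemma Cb_cst (a : R) : Cb (cst a : E -> R).
Proof.
apply/CbP; split=> [|]; last by exists `|a|.
by move=> x; apply: cst_continuous.
Qed.

Lemma partialD f g i : (forall x, derivable f x (e_ i)) ->
  (forall x, derivable g x (e_ i)) -> partial i (f + g) = partial i f + partial i g.
Proof. by move=> df dg; apply/funext => x; rewrite /partial deriveD. Qed.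

Lemma partialM f g i : (forall x, derivable f x (e_ i)) ->
  (forall x, derivable g x (e_ i)) -> partial i (f * g) = f * partial i g + g * partial i f.
Proof. by move=> df dg; apply/funext => x; rewrite /partial deriveM. Qed.

Lemma partial_cst (a : R) i : partial i (cst a) = cst 0.
Proof. by apply/funext => x; rewrite /partial derive_cst. Qed.

Lemma Cb1D f g : Cb1 f -> Cb1 g -> Cb1 (f + g).
Proof.
move=> [cf hf] [cg hg]; split; first exact: CbD.
move=> i; have [df pf] := hf i; have [dg pg] := hg i; split=> [x|].
  exact: derivableD.
by rewrite partialD//; exact: CbD.
Qed.

Lemma Cb1M f g : Cb1 f -> Cb1 g -> Cb1 (f * g).
Proof.
move=> [cf hf] [cg hg]; split; first exact: CbM.
move=> i; have [df pf] := hf i; have [dg pg] := hg i; split=> [x|].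
  exact: derivableM.
by rewrite partialM//; apply: CbD; exact: CbM.
Qed.

Lemma Cb1_cst (a : R) : Cb1 (cst a : E -> R).
Proof.
split; first exact: Cb_cst.
move=> i; rewrite partial_cst; split; last exact: Cb_cst.
by move=> x; exact: derivable_cst.
Qed.

Lemma Cb2D f g : Cb2 f -> Cb2 g -> Cb2 (f + g).
Proof.
move=> /Cb2P[cf hf] /Cb2P[cg hg]; apply/Cb2P; split; first exact: Cb1D.
move=> i; rewrite partialD; [exact: Cb1D|by case: cf => _ /(_ i)[]|by case: cg => _ /(_ i)[]].
Qed.

Lemma Cb2M f g : Cb2 f -> Cb2 g -> Cb2 (f * g).
Proof.
move=> /Cb2P[cf hf] /Cb2P[cg hg]; apply/Cb2P; split; first exact: Cb1M.
move=> i; rewrite partialM; [|by case: cf => _ /(_ i)[]|by case: cg => _ /(_ i)[]].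
by apply: Cb1D; exact: Cb1M.
Qed.

Lemma Cb2_cst (a : R) : Cb2 (cst a : E -> R).
Proof.
by apply/Cb2P; split=> [|i]; rewrite ?partial_cst; exact: Cb1_cst.
Qed.

Lemma Cb2X f n : Cb2 f -> Cb2 (f ^+ n).
Proof.
move=> cf; elim: n => [|n IH]; first exact: Cb2_cst.
by rewrite exprS; exact: Cb2M.
Qed.

Lemma Cb2_coord (h h1 h2 : R -> R) (i : 'I_d) (K : R) :
  (forall s : R, is_derive s 1 h (h1 s)) -> (forall s : R, is_derive s 1 h1 (h2 s)) ->
  continuous h2 -> (forall s, [/\ `|h s| <= K, `|h1 s| <= K & `|h2 s| <= K]) ->
  Cb2 (fun x : E => h (x 0 i)).
Proof.
move=> dh dh1 ch2 hK.
have cts (k k1 : R -> R) : (forall s : R, is_derive s 1 k (k1 s)) -> continuous k.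
  by move=> dk s; apply: differentiable_continuous; apply/derivable1_diffP; have [] := dk s.
have Cbk (k : R -> R) : continuous k -> (forall s, `|k s| <= K) -> Cb (fun x : E => k (x 0 i)).
  move=> ck bk; apply/CbP; split; last by exists K => //; exact: le_trans (bk 0).
  by move=> x; apply: (@continuous_comp _ _ _ (fun x : E => x 0 i)); [exact: coord_continuous|exact: ck].
have dk (k k1 : R -> R) j x : (forall s : R, is_derive s 1 k (k1 s)) ->
    is_derive x (e_ j) (fun x : E => k (x 0 i)) ((j == i)%:R * k1 (x 0 i)).
  move=> hk.
  have ex (t : R) : (t *: e_ j + x : E) 0 i = t * (j == i)%:R + x 0 i.
    by rewrite !mxE eqxx/= eq_sym.
  have [ji|ji] := eqVneq j i.
    have [dk1 dk2] := hk (x 0 i); rewrite mul1r.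
    have e : (fun t : R => t^-1 *: (((fun x : E => k (x 0 i)) \o shift x) (t *: e_ j) - k (x 0 i))) =
         (fun t : R => t^-1 *: ((k \o shift (x 0 i)) (t *: 1) - k (x 0 i))).
      by apply/funext => t /=; rewrite /shift/= ex ji eqxx.
    by split; rewrite /derivable /derive e.
  rewrite mul0r.
  have e : (fun t : R => t^-1 *: (((fun x : E => k (x 0 i)) \o shift x) (t *: e_ j) - k (x 0 i))) =
       cst 0.
    by apply/funext => t /=; rewrite /shift/= ex (negbTE ji) mulr0 add0r subrr scaler0.
  split; rewrite /derivable /derive e; first exact: is_cvg_cst.
  exact: lim_cst.
have pk (k k1 : R -> R) j : (forall s : R, is_derive s 1 k (k1 s)) ->
    partial j (fun x : E => k (x 0 i)) = cst (j == i)%:R * (fun x : E => k1 (x 0 i)).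
  by move=> hk; apply/funext => x; rewrite /partial; have [_ ->] := dk k k1 j x hk.
have b0 s : `|h s| <= K by case: (hK s).
have b1 s : `|h1 s| <= K by case: (hK s).
have b2 s : `|h2 s| <= K by case: (hK s).
have C2 : Cb1 (fun x : E => h1 (x 0 i)).
  split; first exact: Cbk (cts _ _ dh1) b1.
  move=> j; split; first by move=> x; have [] := dk _ _ j x dh1.
  by rewrite (pk _ _ _ dh1); apply: CbM; [exact: Cb_cst|exact: Cbk].
apply/Cb2P; split; last by move=> j; rewrite (pk _ _ _ dh); apply: Cb1M => //; exact: Cb1_cst.
split; first exact: Cbk (cts _ _ dh) b0.
move=> j; split; first by move=> x; have [] := dk _ _ j x dh.
by rewrite (pk _ _ _ dh); apply: CbM; [exact: Cb_cst|exact: Cbk (cts _ _ dh1) b1].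
Qed.

End Cb2.

(** * A $C^2$ bump on the line *)

Section bump.
Context {R : realType}.

(** A quadratic remainder yields the derivative without one-sided limits, which settles the kink of
    the positive part [pp]. *)
Lemma is_derive_quadratic (f : R -> R) (t c C : R) : 0 <= C ->
  (forall u, `|f (u + t) - f t - c * u| <= C * u ^+ 2) -> is_derive t 1 f c.
Proof.
move=> C0 hf.
have h : h^-1 *: ((f \o shift t) (h *: 1) - f t) @[h --> 0^'] --> c.
  apply/cvgrPdist_le => e e0; near=> u.
  have u0 : u != 0 by near: u; exact: nbhs_dnbhs_neq.
  have ue : `|u| <= e / (C + 1).
    by near: u; apply: dnbhs0_le; rewrite divr_gt0// ltr_wpDl.
  rewrite /= [u *: 1]mulr1 distrC -[X in _ - X](mulKf u0) -[_ *: _]/(_ * _) -mulrBr.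
  rewrite normrM normfV ler_pdivrMl ?normr_gt0// [u * c]mulrC.
  rewrite (le_trans (hf u))// -(real_normK (num_real u)) expr2 mulrCA ler_wpM2l//.
  rewrite ler_pdivlMr ?ltr_wpDl// in ue; rewrite (le_trans _ ue)//.
  by rewrite mulrC ler_wpM2l// lerDl.
by split; [exact: (cvgP c)|exact: cvg_lim].
Unshelve. all: by end_near. Qed.

Definition pp (t : R) := Num.max 0 t.

Lemma pp_ge0 t : 0 <= pp t. Proof. by rewrite /pp le_max lexx. Qed.

Lemma pp_ge (t : R) : t <= pp t. Proof. by rewrite /pp le_max lexx orbT. Qed.

Lemma ppE (t : R) : pp t = 0 \/ pp t = t.
Proof. by rewrite /pp; case: leP; [right|left]. Qed.

Lemma continuous_pp : continuous pp.
Proof.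
move=> t; apply: (@continuous_max _ _ (cst 0) id); [exact: cst_continuous|exact: cvg_id].
Qed.

Lemma is_derive_pp2 (t : R) : is_derive t 1 (fun t => pp t ^+ 2) (2 * pp t).
Proof.
apply: (@is_derive_quadratic _ _ _ 1) => // u; rewrite mul1r.
have := pp_ge0 t; have := pp_ge t; have := pp_ge0 (u + t); have := pp_ge (u + t).
rewrite ler_norml.
by case: (ppE t) => ->; case: (ppE (u + t)) => -> *; apply/andP; split; nra.
Qed.

Lemma is_derive_pp3 (t : R) : is_derive t 1 (fun t => pp t ^+ 3) (3 * pp t ^+ 2).
Proof.
have -> : (fun t => pp t ^+ 3) = id * (fun t => pp t ^+ 2).
  apply/funext => s; rewrite exprS -[RHS]/(s * pp s ^+ 2).
  by case: (ppE s) => [->|->//]; rewrite mul0r expr0n/= mulr0.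
apply: (is_derive_eq (is_deriveM (is_derive_id t (1:R)) (is_derive_pp2 t))); rewrite -[_ *: _]/(_ * _) -[X in _ + X]/(_ * _) mulr1 /=.
by case: (ppE t) => ->; ring.
Qed.

(** The cube is the least integer power of the positive part that is twice continuously
    differentiable. *)
Definition bump1 (s : R) := pp (1 - s ^+ 2) ^+ 3.

Definition bump1' (s : R) := -6 * s * pp (1 - s ^+ 2) ^+ 2.

Definition bump1'' (s : R) :=
  -6 * pp (1 - s ^+ 2) ^+ 2 + 24 * s ^+ 2 * pp (1 - s ^+ 2).

Lemma is_derive_1Bsqr (s : R) : is_derive s 1 (fun s : R => 1 - s ^+ 2) (- (2 * s)).
Proof.
apply: (@is_derive_quadratic _ _ _ 1) => // u; rewrite mul1r.
by rewrite (_ : _ - _ = - u ^+ 2) ?normrN ?ger0_norm ?sqr_ge0//; ring.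
Qed.

Lemma is_derive_bump1 (s : R) : is_derive s 1 bump1 (bump1' s).
Proof.
by apply: (is_derive_eq (@is_derive1_comp _ (fun t => pp t ^+ 3) _ _ _ _ (is_derive_pp3 _) (is_derive_1Bsqr s))); rewrite /bump1'; ring.
Qed.

Lemma is_derive_bump1' (s : R) : is_derive s 1 bump1' (bump1'' s).
Proof.
have h1 : is_derive s 1 (fun s : R => -6 * s) (-6).
  by apply: (@is_derive_quadratic _ _ _ 1) => // u; rewrite mul1r
    (_ : _ - _ = 0) ?normr0 ?sqr_ge0//; ring.
have h2 := @is_derive1_comp _ (fun t => pp t ^+ 2) _ _ _ _ (is_derive_pp2 _) (is_derive_1Bsqr s).
by apply: (is_derive_eq (is_deriveM h1 h2)); rewrite /bump1'' /GRing.scale/=; ring.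
Qed.

Lemma continuous_bump1'' : continuous bump1''.
Proof.
move=> s.
have c1 : (t ^+ 2 : R) @[t --> s] --> s ^+ 2 by exact: exprn_continuous.
have c2 : (pp (1 - t ^+ 2) : R) @[t --> s] --> pp (1 - s ^+ 2).
  by apply: continuous_cvg; [exact: continuous_pp|apply: cvgB => //; exact: cvg_cst].
apply: cvgD; last by apply: cvgM => //; apply: cvgM => //; exact: cvg_cst.
apply: cvgM; first exact: cvg_cst.
by rewrite expr2; under eq_fun do rewrite expr2; exact: cvgM.
Qed.

(** Where the positive part is nonzero, it and $s^2$ are at most 1; then $30 = 6 + 24$ adds the
    coefficients of the second derivative. *)
Lemma bump1_bounds (s : R) : [/\ `|bump1 s| <= 30, `|bump1' s| <= 30 & `|bump1'' s| <= 30].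
Proof.
rewrite /bump1 /bump1' /bump1''; have := pp_ge0 (1 - s ^+ 2); have := pp_ge (1 - s ^+ 2).
have s2 := sqr_ge0 s.
case: (ppE (1 - s ^+ 2)) => [->|]; first by rewrite !expr0n/= !mulr0 addr0 normr0.
move=> -> _; set p := 1 - s ^+ 2 => p0.
have p1 : p <= 1 by rewrite /p; lra.
have p2 : p ^+ 2 <= 1 by rewrite exprn_ile1.
have p3 : p ^+ 3 <= 1 by rewrite exprn_ile1.
have p20 : 0 <= p ^+ 2 by rewrite exprn_ge0.
have p30 : 0 <= p ^+ 3 by rewrite exprn_ge0.
have s1 : `|s| <= 1 by rewrite -ler_sqr ?nnegrE// ?real_normK ?num_real ?expr1n ?normr1 ?expr1n; rewrite /p in p0; lra.
have s21 : s ^+ 2 <= 1 by rewrite /p in p0; lra.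
split.
- by rewrite ger0_norm//; lra.
- rewrite ler_norml; have : `|s * p ^+ 2| <= 1.
    by rewrite normrM (ger0_norm p20); exact: mulr_ile1.
  by rewrite ler_norml => /andP[? ?]; apply/andP; split; lra.
- have s2p : s ^+ 2 * p <= 1 by apply: mulr_ile1.
  have s2p0 : 0 <= s ^+ 2 * p by apply: mulr_ge0.
  by rewrite ler_norml; apply/andP; split; lra.
Qed.

Lemma bump1_itv (s : R) : 0 <= bump1 s <= 1.
Proof.
rewrite /bump1 exprn_ge0 ?pp_ge0//= exprn_ile1 ?pp_ge0//.
by case: (ppE (1 - s ^+ 2)) => ->; rewrite ?ler01//; have := sqr_ge0 s; lra.
Qed.

Lemma bump1_gt0 (s : R) : `|s| < 1 -> 0 < bump1 s.
Proof.
move=> s1; rewrite /bump1 exprn_gt0// (lt_le_trans _ (pp_ge _))// subr_gt0.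
by rewrite -(real_normK (num_real s)) expr_lt1.
Qed.

Lemma bump1_eq0 (s : R) : 1 <= `|s| -> bump1 s = 0.
Proof.
move=> s1; rewrite /bump1 /pp max_l ?expr0n// subr_le0.
by rewrite -(real_normK (num_real s)) exprn_ege1.
Qed.

End bump.

(** * Monotone $C_b^2$ approximation of open sets *)

Section open_approximation.
Context {R : realType} {d : nat}.
Local Notation E := 'rV[R]_d.

(** For the maximum norm a ball is a cube, so the product of one-dimensional bumps is positive
    exactly on [rball p]. *)
Definition bump (p : 'rV[rat]_d * nat) : E -> R :=
  \prod_(i < d) (fun y : E => bump1 (p.2.+1%:R * (y 0 i - ratr (p.1 0 i)))).

Lemma bumpE p y :
  bump p y = \prod_(i < d) bump1 (p.2.+1%:R * (y 0 i - ratr (p.1 0 i))).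
Proof. by rewrite /bump fct_prodE. Qed.

Lemma bump_itv p y : 0 <= bump p y <= 1.
Proof.
rewrite bumpE; apply/andP; split.
  by apply: prodr_ge0 => i _; case/andP: (bump1_itv (p.2.+1%:R * (y 0 i - ratr (p.1 0 i)))).
by apply: prodr_ile1 => i _; exact: bump1_itv.
Qed.

Lemma rball_coord (p : 'rV[rat]_d * nat) (y : E) :
  rball p y <-> forall i, `|p.2.+1%:R * (y 0 i - ratr (p.1 0 i))| < 1.
Proof.
have m0 : 0 < p.2.+1%:R :> R by [].
have H i : (`|p.2.+1%:R * (y 0 i - ratr (p.1 0 i))| < 1) =
           (`|ratv p.1 0 i - y 0 i| < p.2.+1%:R^-1).
  by rewrite normrM gtr0_norm// mulrC -ltr_pdivlMr// mul1r distrC mxE.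
split=> [[_ h] i|h].
  by rewrite H; exact: (h 0 i).
by split=> [|a i]; [rewrite invr_gt0|rewrite (ord1 a) -ball_normE /ball_/= -H].
Qed.

Lemma bump_gt0 p y : rball p y -> 0 < bump p y.
Proof.
move=> /rball_coord h; rewrite bumpE; apply: prodr_gt0 => i _; exact: bump1_gt0.
Qed.

Lemma bump_eq0 p y : ~ rball p y -> bump p y = 0.
Proof.
move=> nb; rewrite bumpE.
have [i hi] : exists i, 1 <= `|p.2.+1%:R * (y 0 i - ratr (p.1 0 i))|.
  apply: contrapT => h; apply: nb; apply/rball_coord => i.
  by rewrite ltNge; apply/negP => ?; apply: h; exists i.
by rewrite (bigD1 i)//= bump1_eq0// mul0r.
Qed.

Lemma Cb2_bump p : Cb2 (bump p).
Proof.
rewrite /bump; elim/big_ind : _ => [||i _]; [exact: Cb2_cst|exact: Cb2M|].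
pose m : R := p.2.+1%:R; pose a : R := ratr (p.1 0 i).
have m1 : 1 <= m by rewrite /m ler1n.
have m0 : 0 <= m by rewrite (le_trans ler01).
have dl (s : R) : is_derive s 1 (fun s => m * (s - a)) m.
  by apply: (@is_derive_quadratic _ _ _ _ 1) => // u; rewrite mul1r
    (_ : _ - _ = 0) ?normr0 ?sqr_ge0//; ring.
apply: (@Cb2_coord _ _ (fun s => bump1 (m * (s - a))) (fun s => m * bump1' (m * (s - a)))
  (fun s => m ^+ 2 * bump1'' (m * (s - a))) i (30 * m ^+ 2)) => [s|s||s].
- by apply: (is_derive_eq (@is_derive1_comp _ bump1 (fun s => m * (s - a)) _ _ _ (is_derive_bump1 _) (dl s))); rewrite mulrC.
- have h1 := is_deriveZ m (@is_derive1_comp _ bump1' (fun s => m * (s - a)) _ _ _ (is_derive_bump1' _) (dl s)).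
  by apply: (is_derive_eq h1); rewrite /GRing.scale/= expr2; ring.
- move=> s; apply: cvgM; first exact: cvg_cst.
  apply: continuous_cvg; first exact: continuous_bump1''.
  by apply: cvgM; [exact: cvg_cst|apply: cvgB; [exact: cvg_id|exact: cvg_cst]].
- have [h0 h1 h2] := bump1_bounds (m * (s - a)).
  have m2 : 1 <= m ^+ 2 by rewrite exprn_ege1.
  have mm2 : m <= m ^+ 2 by rewrite expr2 ler_peMr.
  split.
  + by rewrite (le_trans h0)// ler_peMr.
  + by rewrite normrM (ger0_norm m0) mulrC ler_pM.
  + by rewrite normrM (ger0_norm (exprn_ge0 2 m0)) mulrC ler_wpM2r// exprn_ge0.
Qed.

(** With $\varphi_i$ enumerating the bumps on basis balls inside $U$, take $f_k = 1 -
    \prod_{i<k}(1-\varphi_i)^k$. Letting both the number of factors and the exponent grow makes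
    $f_k$ increase; at a point of $U$ some $\varphi_n$ is positive, and $(1-\varphi_n)^k$ tends to
    0. *)
Lemma open_Cb2_approx (U : set E) : open U -> exists f : nat -> E -> R,
  [/\ forall k, Cb2 (f k), forall k y, 0 <= f k y <= 1,
      forall k y, ~ U y -> f k y = 0,
      forall y, nondecreasing_seq (f ^~ y) &
      forall y, U y -> f ^~ y @ \oo --> (1 : R)].
Proof.
move=> oU.
(* An index that codes no ball, or a ball not contained in [U], contributes the zero function. *)
pose phi n : E -> R := if @unpickle ('rV[rat]_d * nat)%type n is Some p then
  (if `[< rball p `<=` U >] then bump p else cst 0) else cst 0.
have phi_itv n y : 0 <= phi n y <= 1.
  rewrite /phi; case: unpickle => [p|]; last by rewrite lexx ler01.
  by case: asboolP => _; [exact: bump_itv|rewrite lexx ler01].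
have phi0 n y : ~ U y -> phi n y = 0.
  rewrite /phi => Uy; case: unpickle => [p|]//.
  by case: asboolP => // pU; apply: bump_eq0 => /pU.
have Cphi n : Cb2 (phi n).
  rewrite /phi; case: unpickle => [p|]; last exact: Cb2_cst.
  by case: asboolP => _; [exact: Cb2_bump|exact: Cb2_cst].
have phi_gt0 y : U y -> exists n, 0 < phi n y.
  move=> /(rball_basis oU)[p [py pU]]; exists (pickle p).
  by rewrite /phi pickleK; case: asboolP => // _; exact: bump_gt0.
pose psi n : E -> R := cst 1 + cst (-1) * phi n.
have psiE n y : psi n y = 1 - phi n y by rewrite /psi -[LHS]/(1 + -1 * phi n y) mulN1r.
have psi_itv n y : 0 <= psi n y <= 1.
  by rewrite psiE; have /andP[? ?] := phi_itv n y; apply/andP; split; lra.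
have Cpsi n : Cb2 (psi n).
  by apply: Cb2D; [exact: Cb2_cst|apply: Cb2M; [exact: Cb2_cst|exact: Cphi]].
clearbody psi; pose g k y := \prod_(i < k) psi i y ^+ k.
have g_itv k y : 0 <= g k y <= 1.
  apply/andP; split.
    by apply: prodr_ge0 => i _; rewrite exprn_ge0//; case/andP: (psi_itv i y).
  apply: prodr_ile1 => i _; have /andP[? ?] := psi_itv i y.
  by rewrite exprn_ge0//= exprn_ile1.
exists (fun k y => 1 - g k y); split.
- move=> k; rewrite (_ : (fun y => _) = cst 1 + cst (-1) * \prod_(i < k) psi i ^+ k).
    apply: Cb2D; first exact: Cb2_cst.
    apply: Cb2M; first exact: Cb2_cst.
    elim/big_ind : _ => [||i _]; [exact: Cb2_cst|exact: Cb2M|].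
    exact: Cb2X.
  apply/funext => y; rewrite -[RHS]/(1 + -1 * (\prod_(i < k) psi i ^+ k) y) mulN1r.
  by rewrite /g fct_prodE; congr (1 - _); apply: eq_bigr => i _; rewrite fctE.
- by move=> k y; have /andP[? ?] := g_itv k y; apply/andP; split; lra.
- move=> k y Uy; rewrite /g big1 ?subrr// => i _.
  by rewrite psiE phi0// subr0 expr1n.
- move=> y; apply/nondecreasing_seqP => k; rewrite lerD2l lerN2 /g big_ord_recr/=.
  rewrite -[leRHS]mulr1; apply: ler_pM.
  + by apply: prodr_ge0 => i _; rewrite exprn_ge0//; case/andP: (psi_itv i y).
  + by rewrite exprn_ge0//; case/andP: (psi_itv k y).
  + apply: ler_prod => i _; have /andP[? ?] := psi_itv i y.
    by rewrite exprn_ge0//= exprS ler_piMl// exprn_ge0.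
  + by have /andP[? ?] := psi_itv k y; rewrite exprn_ile1.
- move=> y /phi_gt0[n n0].
  have /andP[p0 p1] := psi_itv n y.
  have plt : psi n y < 1 by rewrite psiE gtrBl.
  rewrite -[X in _ --> X]subr0; apply: cvgB; first exact: cvg_cst.
  apply: (@squeeze_cvgr _ _ _ _ (cst 0) (fun k => psi n y ^+ k)).
  + near=> k; have nk : (n < k)%N by near: k; exists n.+1.
    have /andP[-> _] := g_itv k y; rewrite /= /g (bigD1 (Ordinal nk))//=.
    rewrite ler_piMr ?exprn_ge0//; apply: prodr_ile1 => i _.
    have /andP[? ?] := psi_itv i y.
    by rewrite exprn_ge0//= exprn_ile1.
  + exact: cvg_cst.
  + by apply: cvg_expr; rewrite ger0_norm.
Unshelve. all: by end_near. Qed.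

End open_approximation.

(** * The Levy operator *)

Section levy.
Context {R : realType} {d : nat}.
Local Notation E := 'rV[R]_d.
Variables (Q : E -> 'M[R]_d) (b : E -> E) (N : R.-sigmafker E ~> E).
Hypothesis hQb : diffusion_drift_assumption Q b.
Hypothesis hN : levy_kernel_assumption N.
Implicit Types f : E -> R.

Definition jump_increment f (x y : E) : R :=
  f (x + y) - f x - dot y (gradient f x) / (1 + dot y y).

Lemma dot_bound (x y : E) (K : R) : 0 <= K -> (forall i, `|y 0 i| <= K) ->
  `|dot x y| <= d%:R * (K * `|x|).
Proof.
move=> K0 hy; rewrite /dot (le_trans (ler_norm_sum _ _ _))//.
rewrite (_ : d%:R = \sum_(i < d) 1); last by rewrite sumr_const card_ord.
rewrite big_distrl/=; apply: ler_sum => i _.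
by rewrite mul1r normrM mulrC ler_pM// coord_le_norm.
Qed.

Lemma Cb2_common_bound f : Cb2 f -> exists2 K, 0 <= K &
  [/\ forall x, `|f x| <= K, forall i x, `|partial i f x| <= K &
      forall i j x, `|partial j (partial i f) x| <= K].
Proof.
move=> [/CbP[_ [K0 K00 h0]] h].
have /choice[K1 hK1] : forall i, exists K, 0 <= K /\ forall x, `|partial i f x| <= K.
  by move=> i; have [_ /CbP[_ [K ? ?]] _] := h i; exists K.
have /choice[K2 hK2] : forall ij : 'I_d * 'I_d, exists K, 0 <= K /\
    forall x, `|partial ij.2 (partial ij.1 f) x| <= K.
  by move=> [i j]; have [_ _ /(_ j)[_ /CbP[_ [K ? ?]]]] := h i; exists K.
have S1 : 0 <= \sum_i K1 i by apply: sumr_ge0 => i _; case: (hK1 i).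
have S2 : 0 <= \sum_ij K2 ij by apply: sumr_ge0 => i _; case: (hK2 i).
exists (K0 + \sum_i K1 i + \sum_ij K2 ij); first by rewrite !addr_ge0.
split=> [x|i x|i j x].
- by rewrite (le_trans (h0 x))// -addrA lerDl addr_ge0.
- rewrite (le_trans ((hK1 i).2 x))// (bigD1 i)//= -addrA addrCA -addrA lerDl !addr_ge0//.
  by apply: sumr_ge0 => k _; case: (hK1 k).
- rewrite (le_trans ((hK2 (i, j)).2 x))// [in leRHS](bigD1 (i, j))//= addrCA lerDl !addr_ge0//.
  by apply: sumr_ge0 => k _; case: (hK2 k).
Qed.

(** Small jumps use the Taylor estimate, large ones boundedness. The three summands of [C] come from
    the Taylor remainder, the compensator and the plain increment of [f]. *)
Lemma jump_increment_bound f : Cb2 f -> exists2 C, 0 <= C &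
  forall x y, `|jump_increment f x y| <= C * Num.min 1 (dot y y).
Proof.
move=> cf; have [K K0 [h0 h1 h2]] := Cb2_common_bound cf.
have df i z : derivable f z (delta_mx 0 i) by have [_ /(_ i)[h _ _]] := cf; exact: h.
have df2 i j z : derivable (partial i f) z (delta_mx 0 j).
  by have [_ /(_ i)[_ _ /(_ j)[h _]]] := cf; exact: h.
have n0 : 0 <= d%:R :> R by [].
exists (d%:R * (d%:R * K) + d%:R * K + 2 * K); first by rewrite !addr_ge0// !mulr_ge0.
move=> x y; set q := dot y y; have q0 : 0 <= q := dot_ge0 y.
have yq : `|y| ^+ 2 <= q := sqr_norm_le_dot y.
have y0 : 0 <= `|y| by [].
have lip i z : `|z| <= `|y| -> `|partial i f (x + z) - gradient f x 0 i| <= d%:R * (K * `|y|).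
  move=> zy; rewrite mxE.
  have := @partial_increment R d (partial i f) 0 K x z (df2 i).
  rewrite /dot big1 ?subr0 => [|j _]; last by rewrite mxE mulr0.
  move=> /(_ _)/le_trans; apply; first by move=> j w _; rewrite mxE subr0.
  by rewrite ler_wpM2l// ler_wpM2l.
have T1 := partial_increment df lip.
have T2 : `|dot y (gradient f x)| <= d%:R * (K * `|y|).
  by apply: dot_bound => // i; rewrite mxE.
rewrite /jump_increment -/q; set D := dot y (gradient f x) in T1 T2 *.
have q1 : 0 < 1 + q by rewrite ltr_wpDr.
have Kq := mulr_ge0 K0 q0.
have dK : 0 <= d%:R * K by rewrite mulr_ge0.
have ddK : 0 <= d%:R * (d%:R * K) by rewrite mulr_ge0.
have [qle|qgt] := leP q 1.
  have y1 : `|y| <= 1.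
    by rewrite -(@ler_pXn2r _ 2%N)// ?nnegrE// expr1n (le_trans yq).
  (* The damped compensator [D / (1 + q)] differs from the true linear term [D] by
     [D * (q / (1 + q))], which is again of order [q]. *)
  rewrite (_ : _ - _ = (f (x + y) - f x - D) + D * (q / (1 + q))); last by field; exact: lt0r_neq0.
  rewrite (le_trans (ler_normD _ _))// normrM (ger0_norm (divr_ge0 q0 (ltW q1))).
  have A1 : d%:R * (d%:R * (K * `|y|) * `|y|) <= d%:R * (d%:R * K) * q.
    rewrite [leLHS](_ : _ = d%:R * (d%:R * K) * `|y| ^+ 2); last by ring.
    by rewrite ler_wpM2l.
  have A2 : `|D| * (q / (1 + q)) <= d%:R * K * q.
    apply: ler_pM => //; first by rewrite divr_ge0// ltW.
      by rewrite (le_trans T2)// mulrA ler_piMr.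
    by rewrite ler_pdivrMr// ler_peMr// lerDl.
  rewrite (le_trans (lerD (le_trans T1 A1) A2))// -mulrDl ler_wpM2r// lerDl.
  by rewrite mulr_ge0.
rewrite mulr1 (le_trans (ler_normB _ _))//.
have A2 : `|D / (1 + q)| <= d%:R * K.
  rewrite normrM normfV (gtr0_norm q1) ler_pdivrMr// (le_trans T2)// mulrA ler_wpM2l//.
  have [y1|/ltW y1] := leP `|y| 1; first by rewrite (le_trans y1)// lerDl.
  by rewrite (le_trans (ler_peMl _ y1))// -expr2 (le_trans yq)// lerDr.
have A3 : `|f (x + y) - f x| <= 2 * K.
  by rewrite (le_trans (ler_normB _ _))// mulr_natl mulr2n lerD.
by rewrite (le_trans (lerD A3 A2))//; lra.
Qed.

Lemma continuous_dot_self : continuous (fun y : E => dot y y).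
Proof.
rewrite /dot; apply: continuous_big => [|i _ y]; first exact: add_continuous.
have c : continuous (fun y : E => y 0 i) := @coord_continuous _ _ _ 0 i.
exact: (@cvgM _ _ _ (nbhs_filter y) _ _ _ _ (c y) (c y)).
Qed.

Lemma measurable_partial f i : Cb2 f -> measurable_fun setT (partial i f).
Proof.
by move=> cf; apply: continuous_measurable_rV; have [_ /(_ i)[_ [h _] _]] := cf.
Qed.

Lemma measurable_jump_increment f : Cb2 f ->
  measurable_fun setT (fun z : E * E => jump_increment f z.1 z.2).
Proof.
move=> cf; have mf : measurable_fun setT f.
  by apply: continuous_measurable_rV; have [[]] := cf.
rewrite /jump_increment; apply: measurable_funB; first apply: measurable_funB.
- exact: (measurableT_comp mf measurable_addrv).
- exact: (measurableT_comp mf measurable_fst).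
apply: measurable_funM.
  rewrite /dot; apply: measurable_sum => i; apply: measurable_funM.
    apply: (measurableT_comp (f := fun y : E => y 0 i)); last exact: measurable_snd.
    by apply: continuous_measurable_rV; exact: coord_continuous.
  under eq_fun do rewrite mxE.
  by apply: (measurableT_comp (f := partial i f)); [exact: measurable_partial|exact: measurable_fst].
apply: (measurableT_comp (f := fun y : E => (1 + dot y y)^-1)); last exact: measurable_snd.
apply: continuous_measurable_rV => y.
apply: (continuous_comp (f := fun y : E => dot y y) (g := fun t : R => (1 + t)^-1)).
  exact: continuous_dot_self.
have q0 : 1 + dot y y != 0 by apply: lt0r_neq0; rewrite ltr_wpDr// dot_ge0.
by apply: cvgV => //; apply: cvgD; [exact: cvg_cst|exact: cvg_id].
Qed.

Local Open Scope ereal_scope.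

Definition small_jump_mass : \bar R :=
  ereal_sup [set \int[N x]_y (Num.min 1%R (dot y y))%:E | x in [set: E]].

Lemma le_small_jump_mass x : \int[N x]_y (Num.min 1%R (dot y y))%:E <= small_jump_mass.
Proof. by apply: ereal_sup_ubound; exists x. Qed.

Lemma min_dot_ge0 (y : E) : (0 <= Num.min 1%R (dot y y))%R.
Proof. by rewrite le_min ler01 dot_ge0. Qed.

Lemma small_jump_mass_ge0 : 0 <= small_jump_mass.
Proof.
apply: le_trans (le_small_jump_mass 0%R).
by apply: integral_ge0 => y _; rewrite lee_fin min_dot_ge0.
Qed.

Lemma small_jump_mass_fin : small_jump_mass \is a fin_num.
Proof. by have [_ h] := hN; rewrite ge0_fin_numE// small_jump_mass_ge0. Qed.

Lemma measurable_min_dot : measurable_fun setT (fun y : E => Num.min 1%R (dot y y)).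
Proof.
by apply: measurable_minr => //; apply: continuous_measurable_rV; exact: continuous_dot_self.
Qed.

(** Away from the origin the jump kernel has finite mass, uniformly in the starting point, by
    Chebyshev's inequality and the Levy condition. These sets exhaust everything but 0, which
    carries no mass. *)
Let ann (n : nat) : set E := [set y | (n.+1%:R^-1 < Num.min 1%R (dot y y))%R].

Let mann n : measurable (ann n).
Proof.
rewrite (_ : ann n = setT `&` (fun y : E => Num.min 1%R (dot y y)) @^-1` `]n.+1%:R^-1%R, +oo[%classic).
  by apply: measurable_min_dot => //; exact: measurable_itv.
by apply/seteqP; split=> y /=; rewrite in_itv/= andbT => // -[].
Qed.

Let Nann n (x : E) : {measure set E -> \bar R} := mrestr (N x) (mann n).

Let mNann n : forall U, measurable U -> measurable_fun [set: E] (Nann n ^~ U).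
Proof.
by move=> U mU; apply: measurable_kernel; apply: measurableI => //; exact: mann.
Qed.

HB.instance Definition _ n := isKernel.Build _ _ _ _ _ (Nann n) (mNann n).

Let Nann_uub n : measure_fam_uub (Nann n).
Proof.
(* The [+ 1] turns the Chebyshev bound into the strict inequality required of a uniform bound. *)
exists (n.+1%:R * fine small_jump_mass + 1)%R => x.
rewrite /Nann/= /mrestr setTI EFinD.
apply: (@le_lt_trans _ _ (n.+1%:R * fine small_jump_mass)%:E); last first.
  by rewrite lteDl// lte_fin.
rewrite EFinM fineK ?small_jump_mass_fin//.
have h0 (y : E) : 0 <= (Num.min 1%R (dot y y))%:E by rewrite lee_fin min_dot_ge0.
apply: (@le_trans _ _ (n.+1%:R%:E * \int[N x]_y (Num.min 1%R (dot y y))%:E)); last first.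
  by rewrite lee_pmul2l// le_small_jump_mass.
rewrite -ge0_integralZl//; last first.
  by apply/measurable_EFinP; exact: measurable_min_dot.
rewrite -[X in N x X]setIT -integral_indic//.
apply: ge0_ae_le_lower_integral => [y|y|]; [by rewrite lee_fin|by rewrite mule_ge0|].
apply: aeW => y; rewrite -EFinM lee_fin indicE; case: (boolP (y \in ann n)) => [|_].
  rewrite inE /ann/= => h; apply/ltW; rewrite mulr1n.
  by rewrite -ltr_pdivrMl// mulr1.
by rewrite mulr_ge0// min_dot_ge0.
Qed.

HB.instance Definition _ n := Kernel_isFinite.Build _ _ _ _ _ (Nann n) (Nann_uub n).

(** Sections are measurable in the parameter for each finite kernel [Nann n], and the masses
    increase to that of the full kernel; the limit is taken as an upper limit to inherit
    measurability. *)
Lemma measurable_jump_xsection (A : set (E * E)) : measurable A ->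
  measurable_fun setT (fun x => N x (xsection A x)).
Proof.
move=> mA; have h n : measurable_fun setT (fun x => Nann n x (xsection A x)).
  by apply: (measurable_fun_xsection_finite_kernel (Nann n)); rewrite inE.
rewrite (_ : (fun x => _) = fun x => limn_esup (fun n => Nann n x (xsection A x))).
  by apply: measurable_fun_limn_esup => n; exact: h.
apply/funext => x.
suff : Nann n x (xsection A x) @[n --> \oo] --> N x (xsection A x).
  by move=> hc; rewrite is_cvg_limn_esupE; [exact/esym/cvg_lim|apply/cvg_ex; eexists; exact: hc].
have mx := measurable_xsection x mA.
have -> : N x (xsection A x) = N x (\bigcup_n (xsection A x `&` ann n)).
  rewrite -setI_bigcupr; apply/eqP; rewrite eq_le; apply/andP; split; last first.
    by rewrite le_measure ?inE//; apply: measurableI => //; exact: bigcupT_measurable.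
  have m0 : measurable ([set 0%R] : set E).
    exact: measurable_set1_rV.
  have N0 : N x [set 0%R] = 0 by have [h0 _] := hN; exact: h0.
  apply: (@le_trans _ _ (N x ((xsection A x `&` \bigcup_n ann n) `|` [set 0%R]))).
    apply: le_measure; rewrite ?inE//.
      by apply: measurableU => //; apply: measurableI => //; exact: bigcupT_measurable.
    move=> y Ay; have [->|y0] := eqVneq y 0%R; first by right.
    left; split=> //.
    have q0 : (0 < Num.min 1%R (dot y y))%R.
      rewrite lt_min ltr01/= (lt_le_trans _ (sqr_norm_le_dot y))// exprn_gt0//.
      by rewrite normr_gt0.
    by have [n] := ltr_add_invr q0; rewrite add0r => hn; exists n.
  rewrite (le_trans (measureU2 _ _ _))//; last by rewrite [X in _ + X](_ : _ = 0) ?adde0//; exact: N0.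
  by apply: measurableI => //; exact: bigcupT_measurable.
apply: nondecreasing_cvg_mu => [n||m n mn].
- exact: measurableI.
- by apply: bigcupT_measurable => n; exact: measurableI.
- apply/subsetPset; apply: setIS => y; rewrite /ann/=; apply: le_lt_trans.
  by rewrite lef_pV2 ?posrE// ler_nat.
Qed.

Import HBSimple HBNNSimple.

Lemma measurable_jump_integral (k : E * E -> \bar R) : (forall z, 0 <= k z) ->
  measurable_fun setT k -> measurable_fun setT (fun x => \int[N x]_y k (x, y)).
Proof.
move=> k0 mk; pose k_ := nnsfun_approx measurableT mk.
apply: (@measurable_fun_xsection_integral _ _ _ _ _ k N k_).
- by move=> m n mn; exact/nd_nnsfun_approx.
- by move=> z; exact/cvg_nnsfun_approx.
- by move=> n r; apply: measurable_jump_xsection.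
Qed.

Lemma integrable_jump_increment f x : Cb2 f ->
  (N x).-integrable setT (fun y => (jump_increment f x y)%:E).
Proof.
move=> cf; have [C C0 hC] := jump_increment_bound cf.
apply: (@le_integrable _ _ _ _ _ _ _ (fun y => C%:E * (Num.min 1%R (dot y y))%:E)) => //.
- apply/measurable_EFinP.
  exact: (measurableT_comp (measurable_jump_increment cf) (pair1_measurable x)).
- by move=> y _; rewrite -EFinM/= lee_fin (le_trans (hC x y))// ler_norm.
apply: integrableZl => //; apply/integrableP; split.
  by apply/measurable_EFinP; exact: measurable_min_dot.
rewrite (eq_integral (fun y => (Num.min 1%R (dot y y))%:E)); last first.
  by move=> y _; rewrite gee0_abs// lee_fin min_dot_ge0.
rewrite (le_lt_trans (le_small_jump_mass x))//.
by have [_ h] := hN.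
Qed.

Lemma jump_part_bound f : Cb2 f -> exists2 C, (0 <= C)%R &
  forall x, (`|\int[N x]_y jump_increment f x y| <= C)%R.
Proof.
move=> cf; have [C C0 hC] := jump_increment_bound cf.
exists (C * fine small_jump_mass)%R.
  by rewrite mulr_ge0// fine_ge0// small_jump_mass_ge0.
move=> x; rewrite -lee_fin EFin_normr_Rintegral//; last exact: integrable_jump_increment.
have mi : measurable_fun setT (fun y => (jump_increment f x y)%:E).
  by case/integrableP: (integrable_jump_increment x cf).
rewrite (le_trans (le_abse_integral _ _ _))// EFinM fineK ?small_jump_mass_fin//.
apply: (@le_trans _ _ (C%:E * \int[N x]_y (Num.min 1%R (dot y y))%:E)); last first.
  by rewrite lee_wpmul2l// le_small_jump_mass.
rewrite -ge0_integralZl//.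
- apply: ge0_ae_le_lower_integral => [y|y|]; [by []| |].
    by rewrite -EFinM lee_fin mulr_ge0// min_dot_ge0.
  by apply: aeW => y; rewrite -EFinM lee_fin.
- by apply/measurable_EFinP; exact: measurable_min_dot.
- by move=> y _; rewrite lee_fin min_dot_ge0.
Qed.

Lemma measurable_jump_part f : Cb2 f ->
  measurable_fun setT (fun x => (\int[N x]_y jump_increment f x y)%R).
Proof.
move=> cf; have mk : measurable_fun setT (fun z : E * E => (jump_increment f z.1 z.2)%:E).
  by apply/measurable_EFinP; exact: measurable_jump_increment.
rewrite /Rintegral; apply: measurableT_comp => //.
rewrite (_ : (fun x => _) = (fun x => \int[N x]_y
     ((fun z : E * E => (jump_increment f z.1 z.2)%:E)^\+ (x, y)) -
   \int[N x]_y ((fun z : E * E => (jump_increment f z.1 z.2)%:E)^\- (x, y)))).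
  apply: emeasurable_funB; apply: measurable_jump_integral => //.
    exact: measurable_funepos.
  exact: measurable_funeneg.
apply/funext => x; rewrite integralE; congr (_ - _); apply: eq_integral => y _.
  by rewrite !funeposE.
by rewrite !funenegE.
Qed.

(** The bound makes the time integral of [A f] along a path Lipschitz in time, which drives optional
    stopping and the comparison of $T_n$ with $T$. *)
Lemma borel_levy_operator f : Cb2 f ->
  measurable_fun setT (levy_operator Q b N f) /\
  exists2 C, (0 <= C)%R & forall x, (`|levy_operator Q b N f x| <= C)%R.
Proof.
move=> cf; have [_ _ bQ bb] := hQb.
have mpp i j : measurable_fun setT (partial i (partial j f)).
  by apply: continuous_measurable_rV; have [_ /(_ j)[_ _ /(_ i)[_ [h _]]]] := cf.
split.
  rewrite /levy_operator; apply: measurable_funD; last exact: measurable_jump_part.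
  apply: measurable_funD.
    apply: measurable_funM; first exact: measurable_cst.
    rewrite /mxtrace.
    apply: measurable_sum => i; under eq_fun do rewrite mxE.
    apply: measurable_sum => j; apply: measurable_funM; first by case: (bQ i j).
    by under eq_fun do rewrite mxE; exact: mpp.
  rewrite /dot; apply: measurable_sum => i; apply: measurable_funM; first by case: (bb i).
  by under eq_fun do rewrite mxE; exact: measurable_partial.
have [K K0 [_ h1 h2]] := Cb2_common_bound cf.
have [CJ CJ0 hCJ] := jump_part_bound cf.
have /choice[KQ hKQ] : forall ij : 'I_d * 'I_d, exists K, (0 <= K /\ forall x, `|Q x ij.1 ij.2| <= K)%R.
  by move=> [i j]; have [_ /bounded_onP[L L0 hL]] := bQ i j; exists L; split=> // x; exact: hL.
have /choice[Kb hKb] : forall i : 'I_d, exists K, (0 <= K /\ forall x, `|b x 0%R i| <= K)%R.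
  by move=> i; have [_ /bounded_onP[L L0 hL]] := bb i; exists L; split=> // x; exact: hL.
exists (2^-1 * \sum_i \sum_j KQ (i, j) * K + \sum_i Kb i * K + CJ)%R.
  rewrite !addr_ge0// ?mulr_ge0//; apply: sumr_ge0 => i _.
    by apply: sumr_ge0 => j _; rewrite mulr_ge0//; case: (hKQ (i, j)).
  by rewrite mulr_ge0//; case: (hKb i).
move=> x; rewrite /levy_operator (le_trans (ler_normD _ _))// lerD//.
rewrite (le_trans (ler_normD _ _))// lerD//.
  rewrite normrM ger0_norm ?invr_ge0// ler_wpM2l ?invr_ge0// /mxtrace.
  rewrite (le_trans (ler_norm_sum _ _ _))//; apply: ler_sum => i _.
  rewrite mxE (le_trans (ler_norm_sum _ _ _))//; apply: ler_sum => j _.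
  by rewrite normrM mxE ler_pM//; case: (hKQ (i, j)).
rewrite /dot (le_trans (ler_norm_sum _ _ _))//; apply: ler_sum => i _.
by rewrite normrM mxE ler_pM//; case: (hKb i).
Qed.

Lemma partial_off_support (g : E -> R) (U : set E) i z : open U -> U z ->
  (forall y, U y -> g y = 0%R) -> partial i g z = 0%R.
Proof.
move=> oU Uz gU; rewrite /partial -(derive_cst (0%R : R) z (delta_mx 0%R i)).
apply: near_eq_derive.
have : nbhs z U by exact: open_nbhs_nbhs.
by apply: filterS => y /gU.
Qed.

Lemma jump_increment_off_support f (U : set E) x y : open U -> U x ->
  (forall y, U y -> f y = 0%R) -> jump_increment f x y = f (x + y)%R.
Proof.
move=> oU Ux fU; rewrite /jump_increment (fU x Ux) subr0 /dot big1 ?mul0r ?subr0// => i _.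
by rewrite mxE (partial_off_support i oU)// mulr0.
Qed.

(** Diffusion, drift and compensator are local and vanish where [f] does on an open set; only the
    jumps remain. *)
Lemma levy_operator_off_support f (U : set E) x : open U -> U x ->
  (forall y, U y -> f y = 0%R) ->
  levy_operator Q b N f x = (\int[N x]_y f (x + y)%R)%R.
Proof.
move=> oU Ux fU.
have g0 : gradient f x = 0%R.
  by apply/rowP => i; rewrite !mxE (partial_off_support i oU).
have h0 : hessian f x = 0%R.
  apply/matrixP => i j; rewrite !mxE (partial_off_support i oU)// => y Uy.
  exact: (partial_off_support j oU).
rewrite /levy_operator h0 mulmx0 mxtrace0 mulr0 add0r.
have d0 (z : E) : dot z 0%R = 0%R by rewrite /dot big1// => i _; rewrite mxE mulr0.
rewrite {1}g0 d0 add0r; congr (fine _); apply: eq_integral => y _; congr EFin.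
exact: (jump_increment_off_support y oU).
Qed.

End levy.

(** * Optional stopping and the exit position *)

Section optional_stopping.
Context {R : realType} {d : nat}.
Local Notation W := (skorokhod R d).
Variable P : probability W R.
Implicit Types (v : W) (M : R -> W -> R) (S : W -> \bar R).

Definition stop S (t : R) v : R := fine (Order.min (S v) t%:E).

Lemma stop_le S t v : 0 <= t -> (0 <= S v)%E -> 0 <= stop S t v <= t.
Proof.
move=> t0 S0; rewrite /stop; case: (S v) S0 => [s| |]//=; last by rewrite t0 lexx.
by rewrite lee_fin => s0; rewrite -EFin_min/= le_min s0 t0/= ge_min lexx orbT.
Qed.

Lemma lt_stop S t v (r : R) : 0 <= t -> (0 <= S v)%E ->
  (r < stop S t v) = (r%:E < S v)%E && (r < t).
Proof.
move=> t0; rewrite /stop; case: (S v) => [s| |]//= _; last by rewrite ltry.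
by rewrite -EFin_min/= lt_min lte_fin.
Qed.

Lemma stop_lt S t v : (0 <= S v)%E -> (S v < t%:E)%E -> (stop S t v)%:E = S v.
Proof.
move=> S0 St; rewrite /stop (min_idPl (ltW St)) fineK// ge0_fin_numE//.
by rewrite (lt_trans St) ?ltry.
Qed.

Lemma stop_ge S t v : (t%:E <= S v)%E -> stop S t v = t.
Proof. by move=> tS; rewrite /stop (min_idPr tS). Qed.

Lemma le_stop S1 S2 t v : 0 <= t -> (0 <= S1 v)%E -> (S1 v <= S2 v)%E ->
  stop S1 t v <= stop S2 t v.
Proof.
move=> t0 S10 S12; rewrite leNgt lt_stop//; apply/negP => /andP[h1 h2].
have := lt_stop (stop S2 t v) t0 (le_trans S10 S12).
by rewrite ltxx h2 (lt_le_trans h1).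
Qed.

Lemma martingale_increment M (s t : R) (C : set W) : martingale P M ->
  0 <= s <= t -> natural_filtration s C ->
  P.-integrable setT (fun v => (\1_C v * (M t v - M s v))%:E) /\
  (\int[P]_v (\1_C v * (M t v - M s v))%:E = 0)%E.
Proof.
move=> [_ iM hM] st FC; have /andP[s0 st'] := st.
have mC : measurable C by exact: natural_filtration_measurable FC.
have iMt := iM _ (le_trans s0 st'); have iMs := iM _ s0.
have iB := integrableB measurableT iMt iMs.
have e : (fun v => (\1_C v * (M t v - M s v))%:E) =
    (fun v => (M t v)%:E - (M s v)%:E)%E \_ C.
  apply/funext => v; rewrite /patch indicE; case: (boolP (v \in C)) => _.
    by rewrite mul1r EFinB.
  by rewrite mul0r.
rewrite e; split.
  by apply/(integrable_mkcond _ mC); apply: integrableS iB.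
have iMtC : P.-integrable C (EFin \o M t) by apply: integrableS iMt.
have iMsC : P.-integrable C (EFin \o M s) by apply: integrableS iMs.
rewrite -integral_mkcond integralB_EFin//.
rewrite (hM _ _ st _ FC) subee//.
exact: integrable_fin_num.
Qed.

(* On a finite partition, the value at the first partition point beyond S is a
   sum of increments over the events [s_j <= S], which belong to the past. *)
Lemma sum_increments (a : nat -> R) (s : nat -> R) (S : \bar R) n :
  {homo s : i j / (i <= j)%N >-> i <= j} ->
  exists2 k, (k <= n)%N &
    [/\ \sum_(j < n) (if ((s j)%:E <= S)%E then 1 else 0) * (a j.+1 - a j) = a k - a 0%N,
        forall j, (j < k)%N -> ((s j)%:E <= S)%E & (k < n)%N -> (S < (s k)%:E)%E].
Proof.
move=> hs; elim: n => [|n [k kn [IH lek gtk]]].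
  by exists 0%N => //; split=> //; rewrite big_ord0 subrr.
rewrite big_ord_recr/= IH; have [sn|sn] := leP (s n)%:E S; last first.
  exists k; first exact: leqW.
  split=> // [|kn1]; first by rewrite mul0r addr0.
  have [/gtk//|nk] := ltnP k n.
  by rewrite (_ : k = n)//; apply/eqP; rewrite eqn_leq kn.
have kE : k = n.
  apply/eqP; rewrite eqn_leq kn leqNgt; apply/negP => /[dup] kn' /gtk.
  by rewrite ltNge (le_trans _ sn)// lee_fin hs// ltnW.
exists n.+1 => //; split=> [|j|]; last by rewrite ltnn.
  by rewrite mul1r kE; ring.
by rewrite ltnS => jn; rewrite (le_trans _ sn)// lee_fin hs.
Qed.

(** The value of [M] at the first grid time beyond [S], capped at [t], is a sum of increments over
    events of the past, hence has mean zero. Right continuity and the bound [K] carry this to the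
    limit of vanishing mesh. The condition on [S] is imposed on the events [s <= S], the ones
    controlled for entrance times. *)
Lemma optional_stopping M S (t K : R) : 0 < t -> martingale P M ->
  (forall v (s : R), 0 <= s < t -> M r v @[r --> s^'+] --> M s v) ->
  (forall v (s : R), 0 <= s <= t -> `|M s v| <= K) ->
  (forall v, M 0 v = 0) -> (forall v, 0 <= S v)%E ->
  (forall s, 0 <= s -> natural_filtration s [set v | s%:E <= S v]%E) ->
  P.-integrable setT (fun v => (M (stop S t v) v)%:E) /\
  (\int[P]_v (M (stop S t v) v)%:E = 0)%E.
Proof.
move=> t0 mM Mr Mb M0 S0 FS.
pose s (N j : nat) : R := t * j%:R / N.+1%:R.
have s_ge0 N j : 0 <= s N j by rewrite /s !mulr_ge0// ltW.
have hs N : {homo s N : i j / (i <= j)%N >-> i <= j}.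
  by move=> i j ij; rewrite /s ler_wpM2r ?invr_ge0// ler_wpM2l ?ler_nat// ltW.
have sS N j : s N j.+1 = s N j + t / N.+1%:R.
  by rewrite /s -natr1 mulrDr mulr1 mulrDl.
have sN N : s N N.+1 = t by rewrite /s mulfK.
pose C N j : set W := [set v | (s N j)%:E <= S v]%E.
pose Xi N v := \sum_(j < N.+1) \1_(C N j) v * (M (s N j.+1) v - M (s N j) v).
have s_itv N (j : nat) : 0 <= s N j <= s N j.+1 by rewrite s_ge0 hs.
have incr N j := martingale_increment mM (s_itv N j) (FS _ (s_ge0 N j)).
have iXi N : P.-integrable setT (EFin \o Xi N).
  rewrite (_ : _ \o _ = (fun v => \sum_(j < N.+1)
     (\1_(C N j) v * (M (s N j.+1) v - M (s N j) v))%:E)%E).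
    by apply: integrable_sum => // j _; case: (incr N j).
  by apply/funext => v /=; rewrite sumEFin.
have intXi N : (\int[P]_v (Xi N v)%:E = 0)%E.
  under eq_integral do rewrite -sumEFin.
  rewrite integral_sum//.
    by rewrite big1// => j _; case: (incr N j).
  by move=> j; case: (incr N j).
have Xi_at N v : exists2 r, stop S t v <= r <= t & r <= stop S t v + t / N.+1%:R /\ Xi N v = M r v.
  have [k kN [e lek gtk]] := sum_increments (fun j => M (s N j) v) (S v) N.+1 (hs N).
  have /andP[st0 stt] := stop_le (ltW t0) (S0 v).
  exists (s N k).
    apply/andP; split; last by rewrite -(sN N) hs.
    rewrite leNgt lt_stop// ?(ltW t0)//; apply/negP => /andP[kS kt].
    have [/gtk|] := ltnP k N.+1; first by rewrite ltNge (ltW kS).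
    by move=> Nk; move: kt; rewrite (_ : k = N.+1) ?sN ?ltxx//; apply/eqP; rewrite eqn_leq kN.
  split.
    case: k kN e lek gtk => [|k] kN e lek gtk.
      by rewrite /s mulr0 mul0r addr_ge0// divr_ge0// ltW.
    rewrite sS lerD2r /stop.
    have sk : s N k <= t by rewrite -(sN N) hs// ltnW.
    have := lek k (ltnSn k); case: (S v) => [r| |]//=.
    by rewrite lee_fin -EFin_min/= le_min sk => ->.
  have {}e : \sum_(j < N.+1) (if ((s N j)%:E <= S v)%E then 1 else 0) *
      (M (s N j.+1) v - M (s N j) v) = M (s N k) v.
    by rewrite e/= (_ : s N 0%N = 0) ?M0 ?subr0// /s mulr0 mul0r.
  rewrite -e /Xi; apply: eq_bigr => j _; rewrite indicE.
  by rewrite (_ : (v \in C N j) = ((s N j)%:E <= S v)%E); [case: ifP|apply/idP/idP => [/set_mem//|?]; exact/mem_set].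
have cvXi v : Xi ^~ v @ \oo --> M (stop S t v) v.
  have /andP[st0 stt] := stop_le (ltW t0) (S0 v).
  (* Right continuity is assumed before [t] only; when the stopped time is [t], every approximation
     already equals [M t v]. *)
  have [tst|stt'] := leP t (stop S t v).
    apply: cvg_near_cst; near=> N.
    have [r /andP[r1 r2] [_ ->]] := Xi_at N v.
    by congr M; apply/le_anti; rewrite r1 (le_trans r2).
  have st : 0 <= stop S t v < t by rewrite st0.
  apply/cvgrPdist_lt => e e0.
  have /cvgrPdist_lt/(_ e e0)[eta /= eta0 heta] := Mr v _ st.
  near=> N; have [r /andP[r1 r2] [r3 ->]] := Xi_at N v.
  have [<-|rne] := eqVneq (stop S t v) r; first by rewrite subrr normr0.
  apply: heta; last by rewrite lt_neqAle rne.
  rewrite /= distrC ger0_norm ?subr_ge0// ltrBlDl (le_lt_trans r3)// ltrD2l.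
  rewrite ltr_pdivrMr// mulrC -ltr_pdivrMr//.
  near: N; exists `|Num.ceil (t / eta)|%N => // N /= hN.
  rewrite (le_lt_trans (ceil_ge _))// (le_lt_trans (ler_norm _))//.
  by rewrite -intr_norm -natr_absz ltr_nat ltnS.
have mlim : measurable_fun setT (fun v => M (stop S t v) v).
  apply: (measurable_fun_cvg (h := Xi)) => [N|v _]; last exact: cvXi.
  by apply/measurable_EFinP; case/integrableP: (iXi N).
have [] := @dominated_convergence _ _ _ P setT measurableT (fun N v => (Xi N v)%:E)
  (fun v => (M (stop S t v) v)%:E) (cst K%:E).
- by move=> N; case/integrableP: (iXi N).
- exact/measurable_EFinP.
- by apply: aeW => v _; apply/cvg_EFin; [exact: nearW|exact: cvXi].
- exact: finite_measure_integrable_cst.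
- apply: aeW => v N _; have [r /andP[r1 r2] [_ ->]] := Xi_at N v.
  have /andP[st0 stt] := stop_le (ltW t0) (S0 v).
  by rewrite lee_fin Mb// r2 andbT (le_trans st0).
move=> iM _ /=; under eq_fun do rewrite intXi.
move=> cM; split=> //; move: cM.
by move=> /(cvg_lim (@ereal_hausdorff R)) <-; rewrite lim_cst.
Unshelve. all: by end_near. Qed.

Lemma measurable_stop S t : measurable_fun setT S -> measurable_fun setT (stop S t).
Proof.
by move=> mS; apply: measurableT_comp => //; exact: measurable_mine.
Qed.

End optional_stopping.

(** * Time integrals of bounded functions *)

Section time_integral.
Context {R : realType}.
Local Notation leb := (@lebesgue_measure R).
Variables (h : R -> R) (C : R).
Hypothesis mh : measurable_fun setT h.
Hypothesis hC : forall r, `|h r| <= C.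

Lemma integrable_bounded_itv (a b : R) (x y : bool) :
  leb.-integrable [set` Interval (BSide x a) (BSide y b)] (EFin \o h).
Proof.
apply: measurable_bounded_integrable => //.
- by rewrite /= lebesgue_measure_itv; case: ifP => _; rewrite ltry.
- exact: measurable_funS mh.
- by apply/bounded_onP; exists C => // ; exact: le_trans (hC 0).
Qed.

Lemma time_integral_lipschitz (a b : R) : 0 <= a -> a <= b ->
  `|\int[leb]_(r in `[0, b]) h r - \int[leb]_(r in `[0, a]) h r| <= C * (b - a).
Proof.
move=> a0 ab; rewrite Rintegral_itvB ?bnd_simp//; last exact: integrable_bounded_itv.
have ihn : leb.-integrable `]a, b] (EFin \o (fun r => `|h r|)).
  have := integrable_bounded_itv a b false false; exact: integrable_norm.
rewrite (le_trans (le_normr_Rintegral _ (integrable_bounded_itv _ _ _ _)))//.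
apply: (@le_trans _ _ (\int[leb]_(r in `]a, b]) C)).
  apply: le_Rintegral => //.
  apply: measurable_bounded_integrable => //.
  - by rewrite /= lebesgue_measure_itv; case: ifP => _; rewrite ltry.
  - by apply/bounded_onP; exists `|C|.
rewrite Rintegral_cst//= lebesgue_measure_itv/= lte_fin.
case: ltP => [_|ba] /=; first by rewrite lexx.
by rewrite (_ : b = a) ?subrr//; apply/le_anti; rewrite ab ba.
Qed.

End time_integral.

(** * Dynkin's formula and the limit of the entrance times *)

Section dynkin.
Context {R : realType} {d : nat}.
Local Notation E := 'rV[R]_d.
Local Notation W := (skorokhod R d).
Local Notation leb := (@lebesgue_measure R).
Variables (Q : E -> 'M[R]_d) (b : E -> E) (N : R.-sigmafker E ~> E).
Hypothesis hQb : diffusion_drift_assumption Q b.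
Hypothesis hN : levy_kernel_assumption N.
Variable P : probability W R.
Hypothesis hP : solves_martingale_problem (levy_operator Q b N) P.
Implicit Types (f : E -> R) (v : W) (S : W -> \bar R).
Local Notation A := (levy_operator Q b N).

Lemma measurable_path v : measurable_fun setT (fun r : R => v r).
Proof. exact: (measurableT_comp (measurable_eval (d := d)) (pair1_measurable v)). Qed.

Lemma dynkin_formula f S (t : R) : Cb2 f -> 0 < t -> (forall v, 0 <= S v)%E ->
  (forall s, 0 <= s -> natural_filtration s [set v | s%:E <= S v]%E) ->
  let M v := f (v (stop S t v)) - f (v 0) - \int[leb]_(r in `[0, stop S t v]) A f (v r) in
  P.-integrable setT (EFin \o M) /\ (\int[P]_v (M v)%:E = 0)%E.
Proof.
move=> cf t0 S0 FS.
have [mA [C C0 hC]] := borel_levy_operator hQb hN cf.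
have [/CbP[cof [K K0 hK]] _] := cf.
have mh v : measurable_fun setT (fun r => A f (v r)).
  exact: (measurableT_comp mA (measurable_path v)).
pose M (s : R) v := f (v s) - f (v 0) - \int[leb]_(r in `[0, s]) A f (v r).
have mM : martingale P M by exact: hP.
(* Two values of [f] and a time integral over at most [[0, t]] give the bound. *)
apply: (@optional_stopping _ _ P M S t (2 * K + C * t) t0 mM _ _ _ S0 FS).
- move=> v s /andP[s0 st]; rewrite /M; apply: cvgB; first apply: cvgB; last 2 first.
  + exact: cvg_cst.
  + apply/cvgrPdist_le => e e0; near=> r.
    have sr : s <= r by near: r; exact: nbhs_right_ge.
    rewrite distrC (le_trans (time_integral_lipschitz (mh v) (fun r => hC _) s0 sr))//.
    have : r <= s + e / (C + 1).
      by near: r; apply: nbhs_right_le; rewrite ltrDl divr_gt0// ltr_wpDl.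
    rewrite -lerBlDl ler_pdivlMr ?ltr_wpDl// => /(le_trans _); apply.
    by rewrite mulrC ler_wpM2l ?subr_ge0// lerDl.
  + have [vr _ _] := path_cadlag v.
    by apply: (@cvg_comp _ _ _ (fun r => v r) f) (vr s) _; exact: cof.
- move=> v s /andP[s0 st]; rewrite /M.
  have := time_integral_lipschitz (mh v) (fun r => hC _) (lexx 0) s0.
  rewrite set_itv1 Rintegral_set1 !subr0 => hI.
  rewrite (le_trans (ler_normB _ _))// lerD//.
    by rewrite (le_trans (ler_normB _ _))// mulr_natl mulr2n lerD.
  by rewrite (le_trans hI)// ler_wpM2l.
- by move=> v; rewrite /M set_itv1 Rintegral_set1 subrr subr0.
Unshelve. all: by end_near. Qed.

Variable D : set E.
Hypothesis oD : open D.
Local Notation T := (approach_time D).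

Lemma measurable_eval_stop S (t : R) : measurable_fun setT S ->
  measurable_fun setT (fun v => v (stop S t v)).
Proof.
move=> mS; exact: (measurableT_comp (measurable_eval (d := d)) (measurable_fun_pair (@measurable_id _ W setT) (measurable_stop t mS))).
Qed.

Lemma cvg_stop_entrance (t : R) v : 0 <= t ->
  stop (entrance_time D n) t v @[n --> \oo] --> stop T t v.
Proof.
move=> t0; apply/cvgrPdist_lt => e e0.
have st n : stop (entrance_time D n) t v <= stop T t v.
  by apply: le_stop => //; [exact: entrance_time_ge0|exact: entrance_le_approach].
have : stop T t v - e < stop T t v by rewrite ltrBlDr ltrDl.
rewrite lt_stop ?approach_time_ge0// => /andP[/ereal_sup_gt[_ [n _ <-] rn] rt].
exists n => // m /= nm; rewrite ger0_norm ?subr_ge0// ltrBlDr -ltrBlDl.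
by rewrite lt_stop ?entrance_time_ge0// rt andbT (lt_le_trans rn)// entrance_time_le.
Qed.

(** At the entrance time the path cannot be in the open set where [f] may be nonzero: by right
    continuity it would stay there, hence off [nbhd n], a little longer. *)
Lemma vanish_at_entrance f m n v (s : R) : (m <= n)%N ->
  (forall y, ~ (~` nbhd D m)° y -> f y = 0) ->
  entrance_time D n v = s%:E -> f (v s) = 0.
Proof.
move=> mn f0 Es; apply: contrapT => fs.
have Us : (~` nbhd D m)° (v s) by apply: contrapT => /f0.
have [e e0 he] := skorokhod_right_nbhs (open_interior _) Us.
have : ((s + e)%:E <= entrance_time D n v)%E.
  apply/le_entrance_time => r r0 re Vr; have [rs|sr] := ltP r s.
    have : (s%:E <= entrance_time D n v)%E by rewrite Es.
    by move=> /le_entrance_time/(_ r r0 rs); apply.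
  have /interior_subset : (~` nbhd D m)° (v r) by apply: he; rewrite sr.
  by apply; exact: nbhdS mn _ Vr.
by rewrite Es lee_fin leNgt ltrDl e0.
Qed.

(** Subtract Dynkin's formulas at the entrance time $T_n$ and at $T$, both capped at [t]. As [f]
    vanishes at $T_n$ when $T_n < t$, the expectation of [f] at $T$ on $T < t$ is at most [C] times
    the expected gap between the capped times, which tends to 0. *)
Lemma ae_vanish_at_approach f m (t : R) : 0 < t -> Cb2 f -> (forall y, 0 <= f y) ->
  (forall y, ~ (~` nbhd D m)° y -> f y = 0) ->
  {ae P, forall v, (T v < t%:E)%E -> f (v (stop T t v)) = 0}.
Proof.
move=> t0 cf fge0 f0; have t0' := ltW t0.
have [_ [C C0 hC]] := borel_levy_operator hQb hN cf.
have mA : measurable_fun setT (A f) by case: (borel_levy_operator hQb hN cf).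
have mf : measurable_fun setT f by apply: continuous_measurable_rV; case: cf => -[].
have FT := approach_time_filtration D.
have T0 : forall v, (0 <= T v)%E := approach_time_ge0 D.
have mT : measurable_fun setT T := measurable_approach_time D.
have [iM2 M20] := dynkin_formula cf t0 T0 FT.
pose g v : R := f (v (stop T t v)) * \1_[set v | (T v < t%:E)%E] v.
have mg : measurable_fun setT g.
  apply: measurable_funM; first exact: (measurableT_comp mf (measurable_eval_stop _ mT)).
  apply: measurable_indic; rewrite -[X in measurable X]setTI.
  exact: measurable_lte.
have g0 v : 0 <= g v by rewrite mulr_ge0.
pose del n v : R := stop T t v - stop (entrance_time D n) t v.
have mdel n : measurable_fun setT (del n).
  by apply: measurable_funB; apply: measurable_stop => //; exact: measurable_entrance_time.
have mS n : measurable_fun setT (entrance_time D n) by exact: measurable_entrance_time.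
have S0 n v : (0 <= entrance_time D n v)%E by exact: entrance_time_ge0.
have st n v : stop (entrance_time D n) t v <= stop T t v.
  by apply: le_stop => //; exact: entrance_le_approach.
have del_itv n v : 0 <= del n v <= t.
  have /andP[a1 a2] := stop_le t0' (T0 v); have /andP[a3 a4] := stop_le t0' (S0 n v).
  by rewrite /del subr_ge0 st/= lerBlDr (le_trans a2)// lerDl.
have idel n : P.-integrable setT (EFin \o del n).
  apply: measurable_bounded_integrable => //.
    by rewrite -ge0_fin_numE ?fin_num_measure.
  apply/bounded_onP; exists t => // v _; have /andP[a1 a2] := del_itv n v.
  by rewrite ger0_norm.
have key n : (m <= n)%N -> (\int[P]_v (g v)%:E <= C%:E * \int[P]_v (del n v)%:E)%E.
  move=> mn.
  have [iM1 M10] := dynkin_formula cf t0 (S0 n) (entrance_time_filtration D n).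
  have iB := integrableB measurableT iM2 iM1.
  have iC : P.-integrable setT (fun v => C%:E * (del n v)%:E)%E.
    by apply: integrableZl => //; exact: idel.
  have E0 : (\int[P]_v ((f (v (stop T t v)) - f (v 0) - \int[leb]_(r in `[0, stop T t v]) A f (v r))%:E -
     (f (v (stop (entrance_time D n) t v)) - f (v 0) -
        \int[leb]_(r in `[0, stop (entrance_time D n) t v]) A f (v r))%:E) = 0)%E.
    by rewrite integralB_EFin// M20 M10 subee.
  rewrite -(integralZl measurableT (idel n)) -[leRHS]add0e -{1}E0 -integralD//.
  apply: le_integral => //.
  - apply: measurable_bounded_integrable => //; first by rewrite -ge0_fin_numE ?fin_num_measure.
    have [/CbP[_ [K K0 hK]] _] := cf.
    apply/bounded_onP; exists K => // v _; rewrite /g indicE.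
    by case: (_ \in _); rewrite ?mulr1// mulr0 normr0.
  - exact: integrableD.
  move=> v _; rewrite -EFinB -EFinM -EFinD lee_fin.
  have /andP[s1 s1t] := stop_le t0' (S0 n v).
  have mh : measurable_fun setT (fun r => A f (v r)) := measurableT_comp mA (measurable_path v).
  have := time_integral_lipschitz mh (fun r => hC _) s1 (st n v).
  rewrite -/(del n v) ler_norml => /andP[_ hI].
  suff : g v <= f (v (stop T t v)) - f (v (stop (entrance_time D n) t v)) by lra.
  (* If the entrance time is at least [t], so is $T$: both capped times are [t] and [g] is zero. *)
  have [nt|tn] := ltP (entrance_time D n v) t%:E; last first.
    rewrite !stop_ge//; last exact: le_trans tn (entrance_le_approach _ _ _).
    rewrite subrr /g indicE memNset ?mulr0//= => /lt_geF.
    by rewrite (le_trans tn) ?entrance_le_approach.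
  rewrite (vanish_at_entrance mn f0 (esym (stop_lt (S0 n v) nt))) subr0 /g indicE.
  by case: (_ \in _); rewrite ?mulr1// mulr0.
have int0 : (\int[P]_v (g v)%:E = 0)%E.
  apply/eqP; rewrite eq_le; apply/andP; split; last first.
    by apply: integral_ge0 => v _; rewrite lee_fin.
  have dc : (\int[P]_v (del n v)%:E)%E @[n --> \oo] --> (\int[P]_v (cst 0 v))%E.
    have [] // := @dominated_convergence _ _ _ P setT measurableT (fun n v => (del n v)%:E)
      (cst 0%E) (cst t%:E).
    - by move=> n; exact/measurable_EFinP.
    - apply: aeW => v _; apply/cvg_EFin; first exact: nearW.
      rewrite /= -(subrr (stop T t v)); apply: cvgB; first exact: cvg_cst.
      exact: cvg_stop_entrance.
    - exact: finite_measure_integrable_cst.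
    - apply: aeW => v n _; have /andP[a1 a2] := del_itv n v.
      by rewrite lee_fin ger0_norm.
  rewrite integral0 in dc.
  have dc' : (C%:E * \int[P]_v (del n v)%:E)%E @[n --> \oo] --> (C%:E * 0)%E.
    by apply: cvgeZl.
  rewrite mule0 in dc'; rewrite -(cvg_lim _ dc')//.
  apply: lime_ge; first by apply/cvg_ex; exists 0%E.
  by exists m => // n /= mn; exact: key.
have : ae_eq P setT (EFin \o g) (cst 0%E).
  apply/(ae_eq_integral_abs _ measurableT); first exact/measurable_EFinP.
  rewrite -[RHS]int0; apply: eq_integral => v _ /=.
  by rewrite ger0_norm.
apply: filterS => v /(_ Logic.I) /= [] gv Tt; move: gv.
by rewrite /g indicE mem_set// mulr1.
Qed.

(** A point of [D] has positive distance to the complement, hence lies in the interior of some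
    complement of [nbhd D m], where the approximants increase to 1. They vanish at $T$ outside one
    null set, since only countably many functions and horizons occur. *)
Lemma ae_approach_outside :
  {ae P, forall v (s : R), T v = s%:E -> ~ D (v s)}.
Proof.
have /choice[F hF] : forall m, exists f : nat -> E -> R,
  [/\ forall k, Cb2 (f k), forall k y, 0 <= f k y <= 1,
      forall k y, ~ (~` nbhd D m)° y -> f k y = 0,
      forall y, nondecreasing_seq (f ^~ y) &
      forall y, (~` nbhd D m)° y -> f ^~ y @ \oo --> (1 : R)].
  by move=> m; apply: open_Cb2_approx; exact: open_interior.
have H : {ae P, forall v, forall m k n, (T v < n.+1%:R%:E)%E ->
    F m k (v (stop T n.+1%:R v)) = 0}.
  apply: ae_foralln => m; apply: ae_foralln => k; apply: ae_foralln => n.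
  have [h1 h2 h3 _ _] := hF m.
  apply: (@ae_vanish_at_approach (F m k) m) => //.
  - by move=> y; case/andP: (h2 k y).
  - exact: h3.
apply: filterS H => v H s Ts Ds.
have /nbhs_ballP[e /= e0 eD] : nbhs (v s) D by exact: open_nbhs_nbhs.
have e20 : 0 < e / 2 by rewrite divr_gt0.
have [m] := ltr_add_invr e20; rewrite add0r => me.
have Us : (~` nbhd D m)° (v s).
  apply/nbhs_ballP; exists (e / 2) => //= y vy [z Dz zy].
  apply/Dz/eD; rewrite [e]splitr; apply: ball_triangle vy _.
  by apply: ball_sym; apply: le_ball zy; exact: ltW.
have [_ _ _ _ /(_ _ Us) h5] := hF m.
have s0 : 0 <= s by have := approach_time_ge0 D v; rewrite Ts lee_fin.
have [n sn] : exists n : nat, s < n.+1%:R.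
  exists (Num.truncn s); exact: truncnS_gt.
have Tn : (T v < n.+1%:R%:E)%E by rewrite Ts lte_fin.
have stE : stop T n.+1%:R v = s.
  by apply: EFin_inj; rewrite stop_lt// approach_time_ge0.
have : F m ^~ (v s) @ \oo --> (0 : R).
  rewrite (_ : F m ^~ (v s) = cst 0); first exact: cvg_cst.
  by apply/funext => k; rewrite -(H m k n Tn) stE.
move=> /(cvg_lim (@Rhausdorff R)) h6; move: h5 => /(cvg_lim (@Rhausdorff R)).
by rewrite h6 => /eqP; rewrite eq_sym oner_eq0.
Qed.

Lemma ae_exit_time_approach :
  {ae P, forall v, D (v 0) -> exit_time D v = T v}.
Proof.
apply: filterS ae_approach_outside => v hv Dv0.
by apply: approach_eq_exit => // s; exact: hv.
Qed.

End dynkin.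

(** The complement of the support is a countable union of basis balls of measure zero. *)
Lemma supp_null {R : realType} {d : nat} (mu : {measure set 'rV[R]_d -> \bar R})
    (B : set 'rV[R]_d) : measurable B -> B `&` supp mu = set0 -> mu B = 0%E.
Proof.
move=> mB Bs; apply: measure_negligible => //.
pose G n : set 'rV[R]_d := if @unpickle ('rV[rat]_d * nat)%type n is Some p then
  (if mu (rball p) == 0%E then rball p else set0) else set0.
apply: (@negligibleS _ _ _ _ (\bigcup_n G n)); last first.
  apply: negligible_bigcup => n; rewrite /G; case: unpickle => [p|]; last exact: negligible_set0.
  case: eqP => [p0|_]; last exact: negligible_set0.
  by apply/negligibleP => //; apply: open_measurable_rV; exact: open_rball.
move=> z Bz; have : ~ supp mu z by move=> Sz; rewrite -[False]/(set0 z) -Bs.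
move=> /existsNP[U /not_implyP[oU /not_implyP[Uz /negP]]]; rewrite -leNgt => muU.
have [p [pz pU]] := rball_basis oU Uz.
exists (pickle p) => //; rewrite /G pickleK (_ : mu (rball p) == 0%E)//.
rewrite -measure_le0 (le_trans _ muU)// le_measure ?inE//; apply: open_measurable_rV => //.
exact: open_rball.
Qed.

(** * The law of the exit position *)

Section exit_law.
Context {R : realType} {d : nat}.
Local Notation E := 'rV[R]_d.
Local Notation W := (skorokhod R d).
Local Notation leb := (@lebesgue_measure R).
Variables (Q : E -> 'M[R]_d) (b : E -> E) (N : R.-sigmafker E ~> E).
Hypothesis hQb : diffusion_drift_assumption Q b.
Hypothesis hN : levy_kernel_assumption N.
Variable P : probability W R.
Hypothesis hP : solves_martingale_problem (levy_operator Q b N) P.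
Variable D : set E.
Hypothesis oD : open D.
Hypothesis startD : {ae P, forall v : W, D (v 0)}.
Implicit Types (f : E -> R) (v : W).
Local Notation A := (levy_operator Q b N).
Local Notation T := (approach_time D).
Local Open Scope ereal_scope.

Definition killed_times (t : R) : set (W * R) :=
  [set w | (0 <= w.2)%R /\ (w.2 < stop T t w.1)%R].

Lemma measurable_killed_times t : measurable (killed_times t).
Proof.
have mT : measurable_fun setT T := measurable_approach_time D.
rewrite (_ : killed_times t = (setT `&` [set w : W * R | (cst 0 w : \bar R) <= (w.2)%:E]) `&`
   (setT `&` [set w : W * R | (w.2)%:E < (stop T t w.1)%:E])); last first.
  apply/seteqP; split=> w /=; first by move=> [h1 h2]; rewrite lee_fin lte_fin.
  by rewrite lee_fin lte_fin => -[[_ h1] [_ h2]].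
have m2 : measurable_fun setT (fun w : W * R => (w.2)%:E).
  by apply/measurable_EFinP; exact: measurable_snd.
apply: measurableI; first exact: measurable_lee.
apply: measurable_lte => //; apply/measurable_EFinP.
exact: (measurableT_comp (measurable_stop t mT) measurable_fst).
Qed.

Local Notation alive t := (\1_(killed_times t) : W * R -> R).

(** This is $E\int_0^{T\wedge t} G(X_r)\,dr$, written on the product space so that limits and sums
    in [G] take a single integration theorem. *)
Definition occupation (t : R) (G : E -> \bar R) : \bar R :=
  \int[P \x leb]_w (G (w.1 w.2) * (alive t w)%:E).

Lemma measurable_occupation_integrand t G : measurable_fun setT G ->
  measurable_fun setT (fun w : W * R => G (w.1 w.2) * (alive t w)%:E).
Proof.
move=> mG; apply: emeasurable_funM.
  exact: (measurableT_comp mG (measurable_eval (d := d))).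
by apply/measurable_EFinP; apply: measurable_indic; exact: measurable_killed_times.
Qed.

Lemma occupationE t G : measurable_fun setT G -> (forall y, 0 <= G y) ->
  occupation t G = \int[P]_v \int[leb]_(r in `[0%R, stop T t v[) G (v r).
Proof.
move=> mG G0; rewrite /occupation fubini_tonelli1/=.
- apply: eq_integral => v _; rewrite /fubini_F/= [RHS]integral_mkcond.
  apply: eq_integral => r _; rewrite /patch indicE.
  rewrite (_ : (_ \in killed_times t) = (r \in `[0%R, stop T t v[%classic)).
    by case: (_ \in _); rewrite ?mule1 ?mule0.
  apply/idP/idP => /set_mem /=; rewrite ?in_itv/=.
    by move=> [r0 rs]; apply/mem_set; rewrite /= in_itv/= r0.
  by move=> /andP[r0 rs]; apply/mem_set.
- exact: measurable_occupation_integrand.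
- by move=> w; rewrite mule_ge0// lee_fin.
Qed.

Lemma exit_dynkin f (t : R) : (0 < t)%R -> Cb2 f -> (forall y, 0 <= f y)%R ->
  (forall y, D y -> f y = 0%R) ->
  \int[P]_v (f (v (stop T t v)))%:E = occupation t (fun y => \int[N y]_z (f (y + z)%R)%:E).
Proof.
move=> t0 cf f0 fD.
have mf : measurable_fun setT f by apply: continuous_measurable_rV; case: cf => -[].
have [mA [C C0 hC]] := borel_levy_operator hQb hN cf.
have [/CbP[_ [K K0 hK]] _] := cf.
have T0 : forall v, 0 <= T v := approach_time_ge0 D.
have mT : measurable_fun setT T := measurable_approach_time D.
have [iM M0] := dynkin_formula hQb hN hP cf t0 T0 (approach_time_filtration D).
have mfadd : measurable_fun setT (fun z : E * E => (f (z.1 + z.2)%R)%:E).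
  by apply/measurable_EFinP; exact: (measurableT_comp mf measurable_addrv).
rewrite occupationE; last 2 first.
- apply: (measurable_jump_integral hN (k := fun z => (f (z.1 + z.2)%R)%:E)) => //.
  by move=> z; rewrite lee_fin.
- by move=> y; apply: integral_ge0 => z _; rewrite lee_fin.
have Dv v r : (0 <= r)%R -> (r < stop T t v)%R -> D (v r).
  move=> r0; rewrite lt_stop ?(ltW t0)// => /andP[rT _].
  exact: (before_approach_time r0).
have Iv v : \int[leb]_(r in `[0%R, stop T t v[) \int[N (v r)]_z (f (v r + z)%R)%:E =
    (\int[leb]_(r in `[0%R, stop T t v]) A f (v r))%R%:E.
  have mh : measurable_fun setT (fun r => A f (v r)) := measurableT_comp mA (measurable_path v).
  have ih := integrable_bounded_itv mh (fun r => hC _).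
  rewrite /Rintegral fineK; last exact: integrable_fin_num (ih _ _ _ _).
  (* At the right end point the path may be outside [D], where the operator need not reduce to its
     jump part; a single time is negligible. *)
  rewrite -integral_itv_bndo_bndc; last by apply/measurable_EFinP; exact: measurable_funS mh.
  apply: eq_integral => r; rewrite inE/= in_itv/= => /andP[r0 rs].
  have Dr := Dv v r r0 rs.
  rewrite (levy_operator_off_support _ _ _ oD Dr fD) /Rintegral fineK//.
  have := integrable_fin_num measurableT (integrable_jump_increment hN (v r) cf).
  rewrite (eq_integral (fun z => (f (v r + z)%R)%:E))// => z _.
  by rewrite (jump_increment_off_support _ oD Dr).
under [RHS]eq_integral do rewrite Iv.
pose F v : R := (f (v (stop T t v)) - f (v 0))%R.
have mF : measurable_fun setT F.
  apply: measurable_funB; first exact: (measurableT_comp mf (measurable_eval_stop _ mT)).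
  exact: (measurableT_comp mf (measurable_coord 0)).
have iF : P.-integrable setT (EFin \o F).
  apply: measurable_bounded_integrable => //; first by rewrite -ge0_fin_numE ?fin_num_measure.
  apply/bounded_onP; exists (K + K)%R; first exact: addr_ge0.
  by move=> v _; rewrite (le_trans (ler_normB _ _))// lerD.
transitivity (\int[P]_v (F v)%:E).
  apply: ae_eq_lower_integral; apply: filterS startD => v Dv0.
  by rewrite /F (fD _ Dv0) subr0.
rewrite -[LHS]sube0 -{1}M0 -integralB_EFin//.
by apply: eq_integral => v _; rewrite -EFinB /F; congr EFin; ring.
Qed.

Definition jump_into (B : set E) (y : E) : \bar R := N y [set z | B (y + z)%R].

Lemma measurable_jump_set (B : set E) y : measurable B -> measurable [set z : E | B (y + z)%R].
Proof.
move=> mB; have := measurableT_comp (measurable_addrv (R := R) (d := d)) (pair1_measurable y).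
by move=> /(_ measurableT B mB); rewrite setTI.
Qed.

Lemma measurable_jump_into B : measurable B -> measurable_fun setT (jump_into B).
Proof.
move=> mB; have mA : measurable [set z : E * E | B (z.1 + z.2)%R].
  by have := measurable_addrv measurableT mB; rewrite setTI.
rewrite (_ : jump_into B = fun y => N y (xsection [set z : E * E | B (z.1 + z.2)%R] y)).
  exact: measurable_jump_xsection.
by apply/funext => y; congr (N y _); apply/seteqP; split=> z;
  rewrite /xsection/= inE.
Qed.

Lemma jump_into_ge0 B y : 0 <= jump_into B y. Proof. exact: measure_ge0. Qed.

Lemma indic_preim (X : Type) (g : X -> E) (U : set E) x :
  \1_[set x | U (g x)] x = \1_U (g x) :> R.
Proof. by rewrite !indicE; congr (_%:R); apply/idP/idP => /set_mem ?; exact/mem_set. Qed.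

(** Both sides of [exit_dynkin] pass to the indicator of [U] by monotone convergence along the
    increasing test functions. *)
Lemma exit_law_open (t : R) (U : set E) : (0 < t)%R -> open U -> U `<=` ~` D ->
  P [set v : W | U (v (stop T t v))] = occupation t (jump_into U).
Proof.
move=> t0 oU UD; have [F [h1 h2 h3 h4 h5]] := open_Cb2_approx oU.
have mT : measurable_fun setT T := measurable_approach_time D.
have mF k : measurable_fun setT (F k).
  by apply: continuous_measurable_rV; case: (h1 k) => -[].
have mU : measurable U := open_measurable_rV oU.
have F0 k y : (0 <= F k y)%R by case/andP: (h2 k y).
have cF y : (F k y)%:E @[k --> \oo] --> (\1_U y)%:E.
  apply/cvg_EFin; first exact: nearW.
  rewrite indicE; case: (boolP (y \in U)) => [/set_mem Uy|nUy]; first exact: h5.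
  rewrite (_ : fine \o _ = cst 0%R); first exact: cvg_cst.
  by apply/funext => k /=; rewrite h3// => Uy; rewrite mem_set in nUy.
have ndF y m n : (m <= n)%N -> (F m y)%:E <= (F n y)%:E.
  by move=> mn; rewrite lee_fin; exact: h4.
have mev := measurable_eval_stop t mT.
have L1 : \int[P]_v (F k (v (stop T t v)))%:E @[k --> \oo] --> P [set v : W | U (v (stop T t v))].
  have mUs : measurable [set v : W | U (v (stop T t v))].
    by have := mev measurableT _ mU; rewrite setTI.
  have -> : P [set v : W | U (v (stop T t v))] =
      \int[P]_v (\1_[set v : W | U (v (stop T t v))] v : R)%:E.
    by rewrite integral_indic// setIT.
  rewrite [X in _ --> X](eq_integral (fun v => limn (fun k => (F k (v (stop T t v)))%:E))); last first.
    by move=> v _; apply/esym/cvg_lim => //; have /= -> := @indic_preim W (fun v : W => v (stop T t v)) U v; exact: cF.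
  apply: cvg_monotone_convergence => //.
  - by move=> k; apply/measurable_EFinP; exact: (measurableT_comp (mF k) mev).
  - by move=> k v _; rewrite lee_fin.
  - by move=> v _ m n mn; exact: ndF.
have mNF k : measurable_fun setT (fun y => \int[N y]_z (F k (y + z)%R)%:E).
  apply: (measurable_jump_integral hN (k := fun z => (F k (z.1 + z.2)%R)%:E)).
    by move=> z; rewrite lee_fin.
  by apply/measurable_EFinP; exact: (measurableT_comp (mF k) measurable_addrv).
have NF0 k (y : E) : 0 <= \int[N y]_z (F k (y + z)%R)%:E.
  by apply: integral_ge0 => z _; rewrite lee_fin.
have mFy k (y : E) : measurable_fun setT (fun z => (F k (y + z)%R)%:E).
  apply/measurable_EFinP.
  exact: (measurableT_comp (measurableT_comp (mF k) measurable_addrv) (pair1_measurable y)).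
have L2 (y : E) : \int[N y]_z (F k (y + z)%R)%:E @[k --> \oo] --> jump_into U y.
  have mUy := measurable_jump_set y mU.
  have -> : jump_into U y = \int[N y]_z (\1_[set z : E | U (y + z)%R] z : R)%:E.
    by rewrite integral_indic// setIT.
  rewrite [X in _ --> X](eq_integral (fun z => limn (fun k => (F k (y + z)%R)%:E))); last first.
    by move=> z _; apply/esym/cvg_lim => //; have /= -> := @indic_preim E (fun z : E => y + z)%R U z; exact: cF.
  apply: cvg_monotone_convergence => //.
  - by move=> k z _; rewrite lee_fin.
  - by move=> z _ m n mn; exact: ndF.
have ndNF (y : E) m n : (m <= n)%N -> \int[N y]_z (F m (y + z)%R)%:E <= \int[N y]_z (F n (y + z)%R)%:E.
  by move=> mn; apply: ge0_le_integral => // [z _|z _]; [rewrite lee_fin|exact: ndF].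
have L3 : occupation t (fun y => \int[N y]_z (F k (y + z)%R)%:E) @[k --> \oo] -->
    occupation t (jump_into U).
  have -> : occupation t (jump_into U) = \int[P \x leb]_w limn (fun k =>
      (\int[N (w.1 w.2)]_z (F k (w.1 w.2 + z)%R)%:E) * (alive t w)%:E).
    apply: eq_integral => w _; apply/esym/cvg_lim => //; rewrite [X in _ --> X]muleC.
    by under eq_fun do rewrite muleC; apply: cvgeZl => //; exact: L2.
  apply: cvg_monotone_convergence => //.
  - by move=> k; apply: (measurable_occupation_integrand t (mNF k)).
  - by move=> k w _; rewrite mule_ge0// lee_fin.
  - by move=> w _ m n mn; rewrite lee_wpmul2r ?lee_fin//; exact: ndNF.
rewrite -(cvg_lim _ L1)// -(cvg_lim _ L3)//; congr (limn _); apply/funext => k.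
by apply: exit_dynkin => // y Dy; apply: h3 => /UD.
Qed.

(** A Dynkin-class induction from open sets. Working inside the complement of the closure, which is
    open, keeps the intersections with open sets open, and complements can then be taken relative to
    it. *)
Lemma exit_law (t : R) (B : set E) : (0 < t)%R -> measurable B ->
  P [set v : W | (B `&` ~` closure D) (v (stop T t v))] =
  occupation t (jump_into (B `&` ~` closure D)).
Proof.
move=> t0; move: B; set X := ~` closure D.
have oX : open X by apply: closed_openC; exact: closed_closure.
have mX : measurable X := open_measurable_rV oX.
have XD : X `<=` ~` D by move=> y Xy Dy; apply: Xy; exact: subset_closure.
have mT : measurable_fun setT T := measurable_approach_time D.
have mev := measurable_eval_stop t mT.
have mPB B : measurable B -> measurable [set v : W | (B `&` X) (v (stop T t v))].
  by move=> mB; have := mev measurableT _ (measurableI _ _ mB mX); rewrite setTI.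
have mocc B : measurable B -> measurable_fun setT (fun w : W * R =>
    jump_into (B `&` X) (w.1 w.2) * (alive t w)%:E).
  move=> mB; apply: measurable_occupation_integrand.
  by apply: measurable_jump_into; exact: measurableI.
apply: (@dynkin_induction _ E (@open E)) => //.
- exact: openI.
- by rewrite setTI; exact: exit_law_open.
- by move=> U oU; apply: exit_law_open => //; [exact: openI|move=> y [_ /XD]].
- move=> B mB PB.
  have PT : P [set v : W | X (v (stop T t v))] = occupation t (jump_into X).
    exact: exit_law_open.
  have splitP : P [set v : W | X (v (stop T t v))] =
      P [set v : W | (B `&` X) (v (stop T t v))] + P [set v : W | (~` B `&` X) (v (stop T t v))].
    rewrite -measureU//; [|exact: mPB|by apply: mPB; exact: measurableC|].
    + congr (P _); apply/seteqP; split=> v /=; last by move=> [[]|[]].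
      by move=> Xv; have [Bv|Bv] := pselect (B (v (stop T t v))); [left|right].
    + by apply/seteqP; split=> v //= [[Bv _] [nBv _]].
  have splitO : occupation t (jump_into X) =
      occupation t (jump_into (B `&` X)) + occupation t (jump_into (~` B `&` X)).
    rewrite /occupation -ge0_integralD//.
    + apply: eq_integral => w _; rewrite -ge0_muleDl ?jump_into_ge0//; congr (_ * _).
      rewrite /jump_into -measureU//.
      * congr (N _ _); apply/seteqP; split=> z /=; last by move=> [[]|[]].
        by move=> Xv; have [Bv|Bv] := pselect (B (w.1 w.2 + z)%R); [left|right].
      * by apply: measurable_jump_set; exact: measurableI.
      * by apply: measurable_jump_set; apply: measurableI => //; exact: measurableC.
      * by apply/seteqP; split=> z //= [[Bv _] [nBv _]].
    + by move=> w _; rewrite mule_ge0// ?jump_into_ge0// lee_fin.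
    + exact: mocc.
    + by move=> w _; rewrite mule_ge0// ?jump_into_ge0// lee_fin.
    + by apply: mocc; exact: measurableC.
  (* The term to be cancelled is finite on the occupation side because it equals a probability. *)
  have Pfin : P [set v : W | (B `&` X) (v (stop T t v))] \is a fin_num.
    by apply: fin_num_measure; exact: mPB.
  move: PT; rewrite splitP splitO PB => PT.
  rewrite PB in Pfin; set a := occupation t (jump_into (B `&` X)) in PT Pfin.
  by have := congr1 (fun z => z - a) PT; rewrite !(addeC a) !addeK.
- move=> G mG tG PG.
  transitivity (\sum_(n <oo) P [set v : W | (G n `&` X) (v (stop T t v))]).
    rewrite -measure_semi_bigcup//.
    + congr (P _); apply/seteqP; split=> v /=.
        by move=> [[n _ Gn] Xv]; exists n.
      by move=> [n _ [Gn Xv]]; split=> //; exists n.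
    + by move=> n; exact: mPB.
    + apply/trivIsetP => i j _ _ ij; apply/seteqP; split=> v //= [[Gi _] [Gj _]].
      by move/trivIsetP : tG => /(_ i j Logic.I Logic.I ij)/seteqP[h _]; exact: (h _ (conj Gi Gj)).
    + by apply: bigcupT_measurable => n; exact: mPB.
  transitivity (\sum_(n <oo) occupation t (jump_into (G n `&` X))).
    by apply: eq_eseriesr => n _; exact: PG.
  rewrite /occupation -integral_nneseries//.
  + apply: eq_integral => w _; under eq_eseriesr do rewrite muleC.
    rewrite nneseriesZl; last by move=> n _; exact: jump_into_ge0.
    rewrite muleC; congr (_ * _); rewrite /jump_into -measure_semi_bigcup//.
    * congr (N _ _); apply/seteqP; split=> z /=.
        by move=> [n _ [Gn Xv]]; split=> //; exists n.
      by move=> [[n _ Gn] Xv]; exists n.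
    * by move=> n; apply: measurable_jump_set; exact: measurableI.
    * apply/trivIsetP => i j _ _ ij; apply/seteqP; split=> z //= [[Gi _] [Gj _]].
      by move/trivIsetP : tG => /(_ i j Logic.I Logic.I ij)/seteqP[h _]; exact: (h _ (conj Gi Gj)).
    * by apply: bigcupT_measurable => n; apply: measurable_jump_set; exact: measurableI.
  + by move=> n; exact: mocc.
  + by move=> n w _; rewrite mule_ge0// ?jump_into_ge0// lee_fin.
Qed.

(** From a point [y] of [D] the jump measure does not charge the part off the closure where [u]
    exceeds [m], as such a point lies outside [y] plus the support. Hence that part has exit
    probability zero, whether or not the jump range is Borel. *)
Lemma ae_exit_position (u : E -> R) (m : R) : measurable_fun setT u ->
  (forall y, extended_closure N D y -> (u y <= m)%R) ->
  {ae P, forall v (s : R), T v = s%:E -> (u (v s) <= m)%R}.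
Proof.
move=> mu hu; pose H : set E := [set y | (m < u y)%R].
have mH : measurable H.
  rewrite (_ : H = setT `&` u @^-1` `]m, +oo[%classic); first exact: mu.
  by apply/seteqP; split=> y /=; rewrite in_itv/= andbT => // -[].
set X := ~` closure D.
have mX : measurable X.
  by apply: open_measurable_rV; apply: closed_openC; exact: closed_closure.
have J0 y : D y -> jump_into (H `&` X) y = 0.
  move=> Dy; apply: supp_null; first by apply: measurable_jump_set; exact: measurableI.
  apply/seteqP; split=> // z /= [[Hz Xz] Sz].
  move: Hz; rewrite /H/= ltNge => /negP; apply; apply: hu; right; right.
  split; first by exists y => //; exists z.
  by move=> Dz; apply: Xz; exact: subset_closure.
have O0 n : P [set v : W | (H `&` X) (v (stop T n.+1%:R v))] = 0.
  rewrite exit_law// /occupation; apply: integral0_eq => w _; rewrite indicE.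
  case: (boolP (w \in killed_times n.+1%:R)) => [/set_mem[w0 ws]|_]; last by rewrite mule0.
  rewrite mule1 J0//; move: ws; rewrite lt_stop// ?approach_time_ge0// => /andP[wT _].
  exact: (before_approach_time w0).
have H1 : {ae P, forall v : W, forall n, ~ (H `&` X) (v (stop T n.+1%:R v))}.
  apply: ae_foralln => n; exists [set v : W | (H `&` X) (v (stop T n.+1%:R v))].
  split; [|exact: O0|by move=> v /= /contrapT].
  have mT : measurable_fun setT T := measurable_approach_time D.
  by have := measurable_eval_stop n.+1%:R mT measurableT (measurableI _ _ mH mX); rewrite setTI.
apply: filterS2 H1 (ae_approach_outside hQb hN hP oD) => v h1 h2 s Ts.
have s0 : (0 <= s)%R by have := approach_time_ge0 D v; rewrite Ts lee_fin.
have [n sn] : exists n : nat, (s < n.+1%:R)%R by exists (Num.truncn s); exact: truncnS_gt.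
have stE : stop T n.+1%:R v = s.
  by apply: EFin_inj; rewrite stop_lt ?approach_time_ge0// Ts lte_fin.
(* In the closure but not in [D], the position is a boundary point and belongs to the extended
   closure directly. *)
have [cD|nD] := pselect (closure D (v s)).
  apply: hu; right; left; split=> // /interior_subset; exact: h2.
rewrite leNgt; apply/negP => Hs; apply: (h1 n); rewrite stE; split=> //.
Qed.

End exit_law.

(** * The killing functional and the Markov property *)

Section binary_digits.
Context {R : realType}.

(** The greedy binary expansion: a function with values in [[0, 1]] becomes a series of indicators
    of the events that its digits are 1, to which the Markov property for events applies. At [a = 1]
    all digits are 1. *)
Fixpoint remainder (n : nat) (a : R) : R :=
  if n is m.+1 then
    (if 2^-1 ^+ n <= remainder m a then remainder m a - 2^-1 ^+ n else remainder m a)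
  else a.

Definition digit (n : nat) : set R := [set a | 2^-1 ^+ n.+1 <= remainder n a].

Lemma measurable_remainder n : measurable_fun setT (remainder n).
Proof.
elim: n => [|n IH] /=; first exact: measurable_id.
apply: measurable_fun_ifT => //; last exact: measurable_funB.
exact: measurable_fun_ler.
Qed.

Lemma measurable_digit n : measurable (digit n).
Proof.
rewrite -[digit n]setTI; apply: measurable_fun_le => //.
exact: measurable_remainder.
Qed.

Lemma remainder_itv n a : 0 <= a <= 1 -> 0 <= remainder n a <= 2^-1 ^+ n.
Proof.
move=> ha; elim: n => [|n /andP[h0 h1]]; first by rewrite expr0.
rewrite /=; case: ifPn => [h|]; last by rewrite -ltNge => /ltW ->; rewrite h0.
rewrite subr_ge0 h/= lerBlDr (le_trans h1)// exprS.
have : 0 <= 2^-1 ^+ n :> R by rewrite exprn_ge0.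
by lra.
Qed.

Lemma remainderE n a :
  a = \sum_(0 <= j < n) 2^-1 ^+ j.+1 * \1_(digit j) a + remainder n a.
Proof.
elim: n => [|n IH]; first by rewrite big_geq// add0r.
rewrite big_nat_recr//= {1}IH -addrA; congr (_ + _); rewrite indicE.
case: ifPn => h; first by rewrite mem_set// mulr1 addrC subrK.
by rewrite memNset ?mulr0 ?add0r//; exact/negP.
Qed.

Lemma binary_expansion a : 0 <= a <= 1 ->
  (a%:E = \sum_(n <oo) (2^-1 ^+ n.+1 * \1_(digit n) a)%:E)%E.
Proof.
move=> ha; apply/esym/cvg_lim => //.
have -> : (fun n => (\sum_(0 <= i < n) (2^-1 ^+ i.+1 * \1_(digit i) a)%:E)%E) =
  (fun n => (a - remainder n a)%:E).
  by apply/funext => n; rewrite sumEFin {2}(remainderE n a) addrK.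
apply/cvg_EFin; first exact: nearW.
rewrite -[X in _ --> X]subr0; apply: cvgB; first exact: cvg_cst.
apply: (@squeeze_cvgr _ _ _ _ (cst 0) (fun n => 2^-1 ^+ n)).
- by near=> n; exact: remainder_itv.
- exact: cvg_cst.
- by apply: cvg_expr; rewrite ger0_norm// invf_lt1// ltr1n.
Unshelve. all: by end_near. Qed.

End binary_digits.

(** * An exponential integral inequality for measurable rates *)

Section exponential_functional.
Context {R : realType}.
Local Notation leb := (@lebesgue_measure R).
Variables (h : R -> R) (C : R).
Hypothesis mh : measurable_fun setT h.
Hypothesis h0 : forall r, 0 <= h r <= C.

Let hC r : `|h r| <= C.
Proof. by have /andP[? ?] := h0 r; rewrite ger0_norm. Qed.

Definition primitive (t : R) : R := \int[leb]_(r in `[0, t]) h r.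

Lemma primitive_le s t : s <= t -> primitive s <= primitive t.
Proof.
move=> st; have [s0|s0] := ltP s 0.
  rewrite /primitive set_itv_ge ?Rintegral_set0; last by rewrite bnd_simp -ltNge.
  by apply: Rintegral_ge0 => r _; case/andP: (h0 r).
rewrite -subr_ge0 Rintegral_itvB ?bnd_simp//; last exact: integrable_bounded_itv.
by apply: Rintegral_ge0 => r _; case/andP: (h0 r).
Qed.

Lemma measurable_primitive : measurable_fun setT primitive.
Proof. by apply: nondecreasing_measurable => // s t; exact: primitive_le. Qed.

Lemma primitive0 : primitive 0 = 0.
Proof. by rewrite /primitive set_itv1 Rintegral_set1. Qed.

Lemma primitive_lip s t : 0 <= s -> s <= t -> primitive t - primitive s <= C * (t - s).
Proof.
move=> s0 st; have := time_integral_lipschitz mh hC s0 st.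
by rewrite ler_norml => /andP[].
Qed.

Let g (tau r : R) := h r * expR (primitive r - primitive tau).

Let mg tau : measurable_fun setT (g tau).
Proof.
apply: measurable_funM => //; apply: measurableT_comp => //.
by apply: measurable_funB => //; exact: measurable_primitive.
Qed.

Let g_itv tau r : r <= tau -> 0 <= g tau r <= C.
Proof.
move=> rt; have /andP[? hrC] := h0 r; rewrite mulr_ge0 ?expR_ge0//=.
by rewrite (le_trans _ hrC)// ler_piMr// -expR0 ler_expR subr_le0 primitive_le.
Qed.

Let ig tau (a b : R) : a <= b -> b <= tau -> leb.-integrable `]a, b] (EFin \o g tau).
Proof.
move=> ab bt; apply: measurable_bounded_integrable => //.
- by rewrite /= lebesgue_measure_itv; case: ifP => _; rewrite ltry.
- exact: measurable_funS (mg tau).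
- apply/bounded_onP; exists C; first exact: le_trans (hC 0).
  move=> r; rewrite /= in_itv/= => /andP[_ rb].
  by have /andP[? ?] := g_itv (le_trans rb bt); rewrite ger0_norm.
Qed.

(** Freezing the exponential at its value at [b] costs at most the factor [expR (C * (b - a))],
    which tends to 1 with the mesh; the differences on the right telescope over a grid. *)
Lemma exponential_increment (tau a b : R) : 0 <= a -> a <= b -> b <= tau ->
  \int[leb]_(r in `]a, b]) g tau r <=
  expR (C * (b - a)) * (expR (primitive b - primitive tau) - expR (primitive a - primitive tau)).
Proof.
move=> a0 ab bt.
have ih : leb.-integrable `]a, b] (EFin \o h) by exact: (integrable_bounded_itv mh hC).
set p := expR (primitive b - primitive tau).
apply: (@le_trans _ _ (\int[leb]_(r in `]a, b]) (p * h r))).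
  apply: le_Rintegral => //; first exact: ig.
    rewrite (_ : _ \o _ = (fun r => p%:E * (h r)%:E)%E); last by apply/funext => r; rewrite /= EFinM.
    by apply: integrableZl.
  move=> r; rewrite /= in_itv/= => /andP[_ rb]; rewrite /g mulrC ler_wpM2r//.
    by case/andP: (h0 r).
  by rewrite ler_expR lerD2r primitive_le.
rewrite RintegralZl//.
have -> : \int[leb]_(r in `]a, b]) h r = primitive b - primitive a.
  by rewrite /primitive Rintegral_itvB ?bnd_simp//; exact: (integrable_bounded_itv mh hC).
have cC := primitive_lip a0 ab.
have c0 : 0 <= primitive b - primitive a by rewrite subr_ge0 primitive_le.
set c := primitive b - primitive a in cC c0 *.
have -> : expR (primitive a - primitive tau) = p * expR (- c).
  by rewrite /p -expRD; congr expR; rewrite /c; ring.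
have -> : p - p * expR (- c) = p * (1 - expR (- c)) by ring.
rewrite [leRHS]mulrCA; apply: ler_wpM2l; first exact: expR_ge0.
(* The right side is [expR c - 1]. *)
have e1 : c <= expR c * (1 - expR (- c)).
  by rewrite mulrBr mulr1 -expRD subrr expR0 lerBrDr addrC expR_ge1Dx.
rewrite (le_trans e1)// ler_wpM2r// ?ler_expR// subr_ge0 -[leRHS]expR0 ler_expR.
by rewrite oppr_le0.
Qed.

(* Riemann sums over N pieces replace the differentiation of the exponential,
   h being merely measurable. *)
Lemma exponential_primitive (tau : R) : 0 <= tau ->
  \int[leb]_(r in `[0, tau]) g tau r <= 1 - expR (- primitive tau).
Proof.
move=> t0.
have H N : \int[leb]_(r in `[0, tau]) g tau r <=
    expR (C * (tau / N.+1%:R)) * (1 - expR (- primitive tau)).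
  pose s (j : nat) : R := j%:R * (tau / N.+1%:R).
  have d0 : 0 <= tau / N.+1%:R by rewrite divr_ge0.
  have sS j : s j.+1 = s j + tau / N.+1%:R by rewrite /s -natr1 mulrDl mul1r.
  have s0 j : 0 <= s j by rewrite mulr_ge0.
  have sN : s N.+1 = tau by rewrite /s mulrCA divff ?mulr1.
  have sle j : (j <= N.+1)%N -> s j <= tau by move=> jN; rewrite -sN ler_wpM2r// ler_nat.
  suff K j : (j <= N.+1)%N -> \int[leb]_(r in `[0, s j]) g tau r <=
      expR (C * (tau / N.+1%:R)) * (expR (primitive (s j) - primitive tau) - expR (- primitive tau)).
    by have := K N.+1 (leqnn _); rewrite sN subrr expR0.
  elim: j => [_|j IH jN].
    by rewrite {1}/s mul0r set_itv1 Rintegral_set1 /s mul0r primitive0 sub0r subrr mulr0.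
  have ij : leb.-integrable `[0, s j.+1] (EFin \o g tau).
    apply: measurable_bounded_integrable => //.
    - by rewrite /= lebesgue_measure_itv; case: ifP => _; rewrite ltry.
    - exact: measurable_funS (mg tau).
    - apply/bounded_onP; exists C; first exact: le_trans (hC 0).
      move=> r; rewrite /= in_itv/= => /andP[_ rb].
      by have /andP[? ?] := g_itv (le_trans rb (sle _ jN)); rewrite ger0_norm.
  have sj : s j <= s j.+1 by rewrite sS lerDl.
  have := Rintegral_itvB (x := s j) ij; rewrite !bnd_simp => /(_ (s0 j) sj)/eqP.
  rewrite subr_eq => /eqP ->; rewrite addrC.
  rewrite (le_trans (lerD (IH (ltnW jN)) (exponential_increment (s0 j) sj (sle _ jN))))//.
  rewrite sS [s j + _ - s j]addrC addKr -mulrDr ler_wpM2l ?expR_ge0//.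
  by rewrite addrC -addrA lerD2l addrA addNr add0r.
have lim1 : expR (C * (tau / N.+1%:R)) * (1 - expR (- primitive tau)) @[N --> \oo] -->
    1 * (1 - expR (- primitive tau)).
  apply: cvgM; last exact: cvg_cst.
  have c1 : C * (tau / N.+1%:R) @[N --> \oo] --> C * (tau * 0).
    by apply: cvgM; [exact: cvg_cst|apply: cvgM; [exact: cvg_cst|exact: cvg_harmonic]].
  have := continuous_cvg _ (@continuous_expR R (C * (tau * 0))) c1.
  rewrite !mulr0 expR0; exact.
rewrite mul1r in lim1; rewrite -(cvg_lim (@Rhausdorff R) lim1).
apply: limr_ge; first by apply/cvg_ex; eexists; exact: lim1.
by near=> N; exact: H.
Unshelve. all: by end_near. Qed.

End exponential_functional.

Lemma measurable_expeR {R : realType} : measurable_fun setT (@expeR R).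
Proof.
rewrite (_ : @expeR R = fun x => if x == +oo%E then +oo%E else
    if x == -oo%E then 0%E else (expR (fine x))%:E); last first.
  by apply/funext => -[r| |].
apply: measurable_fun_ifT => //; first exact: measurable_fun_eqe.
apply: measurable_fun_ifT => //; first exact: measurable_fun_eqe.
by apply/measurable_EFinP; apply: measurableT_comp => //; exact: measurable_fine.
Qed.

Lemma ge0_integral_shift {R : realType} (f : R -> \bar R) (a : R) :
  measurable_fun setT f -> (forall r, 0 <= f r)%E ->
  (\int[@lebesgue_measure R]_r f (a + r)%R = \int[@lebesgue_measure R]_r f r)%E.
Proof.
move=> mf f0.
have mphi : @measurable_fun _ _ (measurableTypeR R) (measurableTypeR R) setT (+%R a).
  exact: measurable_funD.
pose phi : {mfun measurableTypeR R >-> measurableTypeR R} :=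
  @mfun_Sub _ _ (measurableTypeR R) (measurableTypeR R) _ (mem_set mphi).
(* Translation invariance: the image measure agrees with Lebesgue measure on half-open intervals,
   hence on all Borel sets. *)
have H (A : set R) : measurable A ->
    lebesgue_measure A = pushforward (@lebesgue_measure R) phi A.
  move=> mA; apply: (@lebesgue_measure_unique R
    (pushforward (@lebesgue_measure R) phi)) => // _ [[x y] _ <-].
  transitivity (@lebesgue_measure R `]x - a, y - a]); last first.
    congr lebesgue_measure.
    by apply/seteqP; split=> r /=; rewrite !in_itv/= ltrBlDl lerBrDl.
  rewrite !lebesgue_measure_itv/= !lte_fin ltrD2r.
  by case: ifP => // _; rewrite -!EFinB; congr EFin; lra.
rewrite [RHS](@eq_measure_integral _ _ _ _ (pushforward (@lebesgue_measure R) phi)); last first.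
  by move=> A mA _; exact: H.
by rewrite ge0_integral_pushforward.
Qed.

(** * Integrals over measurable sections *)

Section section_integral.
Context {R : realType} d' (X : measurableType d').
Variables (A : set (X * R)) (F : X * R -> \bar R).
Hypotheses (mA : measurable A) (mF : measurable_fun setT F) (F0 : forall z, (0 <= F z)%E).
Local Notation leb := (@lebesgue_measure R).
Local Open Scope ereal_scope.

Lemma measurable_restrict_indic : measurable_fun setT (fun z => F z * (\1_A z : R)%:E).
Proof. by apply: emeasurable_funM => //; apply/measurable_EFinP; exact: measurable_indic. Qed.

Lemma restrict_indic_ge0 z : 0 <= F z * (\1_A z : R)%:E.
Proof. by rewrite mule_ge0// lee_fin. Qed.

Lemma section_integralE x :
  \int[leb]_(r in [set r | A (x, r)]) F (x, r) = \int[leb]_r (F (x, r) * (\1_A (x, r) : R)%:E).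
Proof.
rewrite integral_mkcond; apply: eq_integral => r _.
rewrite /patch indicE (_ : (r \in _) = ((x, r) \in A)).
  by case: (_ \in _); rewrite ?mule1 ?mule0.
by apply/idP/idP => /set_mem ?; exact/mem_set.
Qed.

Lemma measurable_section_integral :
  measurable_fun setT (fun x => \int[leb]_(r in [set r | A (x, r)]) F (x, r)).
Proof.
rewrite (_ : (fun x => _) = fubini_F leb (fun z => F z * (\1_A z : R)%:E)).
  apply: measurable_fun_fubini_tonelli_F; first exact: measurable_restrict_indic.
  exact: restrict_indic_ge0.
by apply/funext => x; rewrite section_integralE.
Qed.

End section_integral.

(** * The Markov property applied to the remaining discount *)

Section markov.
Context {R : realType} {d : nat}.
Local Notation E := 'rV[R]_d.
Local Notation W := (skorokhod R d).
Local Notation leb := (@lebesgue_measure R).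
Variable P : R.-pker E ~> W.
Hypothesis hP : strong_markov P.
Variable D : set E.
Variables (k : E -> R) (C : R).
Hypothesis mk : measurable_fun setT k.
Hypothesis k0 : forall y, 0 <= k y <= C.
Implicit Types (v : W) (r s : R).
Local Notation T := (approach_time D).
Local Open Scope ereal_scope.

(** The integral runs from [r] up to $T$: the killing still to come is a functional of the path
    shifted by [r], which is what the Markov property handles. At [r = 0] it gives the discount at
    $T$. *)
Definition remaining_rate r v : \bar R :=
  \int[leb]_(s in [set s | (r <= s)%R /\ s%:E < T v]) (k (v s))%:E.

Definition remaining_discount r v : R := fine (expeR (- remaining_rate r v)).

Lemma remaining_rate_ge0 r v : 0 <= remaining_rate r v.
Proof. by apply: integral_ge0 => s _; rewrite lee_fin; case/andP: (k0 (v s)). Qed.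

Lemma expeRN_itv (x : \bar R) : 0 <= x -> 0 <= expeR (- x) <= 1.
Proof.
move=> x0; rewrite expeR_ge0/=; case: x x0 => [x| |]//= x0.
by rewrite lee_fin -[leRHS]expR0 ler_expR oppr_le0 -lee_fin.
Qed.

Lemma remaining_discountE r v : (remaining_discount r v)%:E = expeR (- remaining_rate r v).
Proof.
have /andP[h1 h2] := expeRN_itv (remaining_rate_ge0 r v).
by rewrite fineK// ge0_fin_numE// (le_lt_trans h2)// ltry.
Qed.

Lemma remaining_discount_itv r v : (0 <= remaining_discount r v <= 1)%R.
Proof. by rewrite -!lee_fin remaining_discountE expeRN_itv ?remaining_rate_ge0. Qed.

Lemma measurable_remaining_discount2 :
  measurable_fun setT (fun w : W * R => remaining_discount w.2 w.1).
Proof.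
apply: measurableT_comp => //; apply: (measurableT_comp measurable_expeR).
apply: measurableT_comp => //.
pose A : set ((W * R) * R) := [set z | (z.1.2 <= z.2)%R /\ z.2%:E < T z.1.1].
have m12 : measurable_fun setT (fun z : (W * R) * R => z.1.2).
  exact: (measurableT_comp measurable_snd measurable_fst).
have m11 : measurable_fun setT (fun z : (W * R) * R => z.1.1).
  exact: (measurableT_comp measurable_fst measurable_fst).
have mA : measurable A.
  rewrite (_ : A = (setT `&` [set z : (W * R) * R | z.1.2%:E <= z.2%:E]) `&`
     (setT `&` [set z : (W * R) * R | z.2%:E < T z.1.1])); last first.
    by apply/seteqP; split=> z /=; rewrite lee_fin; [move=> [? ?]|move=> [[_ ?] [_ ?]]].
  apply: measurableI.
    by apply: measurable_lee => //; apply/measurable_EFinP => //; exact: measurable_snd.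
  apply: measurable_lte => //; first by apply/measurable_EFinP; exact: measurable_snd.
  exact: (measurableT_comp (measurable_approach_time D) m11).
have mf : measurable_fun setT (fun z : (W * R) * R => (k (z.1.1 z.2))%:E).
  apply/measurable_EFinP; apply: (measurableT_comp mk).
  exact: (measurableT_comp (measurable_eval (d := d)) (measurable_fun_pair m11 measurable_snd)).
apply: (measurable_section_integral mA mf) => z.
by rewrite lee_fin; case/andP: (k0 (z.1.1 z.2)).
Qed.

Lemma measurable_remaining_discount r : measurable_fun setT (remaining_discount r).
Proof.
exact: (measurableT_comp measurable_remaining_discount2 (pair2_measurable r)).
Qed.

Lemma remaining_rateE r v : remaining_rate r v =
  \int[leb]_s (((fun s => (k (v s))%:E) \_ [set s | (r <= s)%R /\ s%:E < T v]) s).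
Proof. exact: integral_mkcond. Qed.

Lemma remaining_discount_shift v r : (0 <= r)%R -> r%:E < T v ->
  remaining_discount 0 (Defs.shift r v) = remaining_discount r v.
Proof.
move=> r0 rT; congr (fine (expeR (- _))); rewrite !remaining_rateE.
set f := (X in _ = \int[_]_s X s).
have mf : measurable_fun setT f.
  apply/(measurable_restrictT _ _).1; last first.
    apply/measurable_EFinP; apply: (measurable_funS measurableT) => //.
    exact: (measurableT_comp mk (measurable_path v)).
  apply: measurableI.
    by rewrite -[X in measurable X]setTI; exact: measurable_fun_le.
  by rewrite -[X in measurable X]setTI; apply: measurable_lte.
have f0 s : 0 <= f s.
  by rewrite /f /patch; case: ifP => // _; rewrite lee_fin; case/andP: (k0 (v s)).
rewrite -(ge0_integral_shift r mf f0).
apply: eq_integral => s _; rewrite /f /patch.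
have -> : (s \in [set s | (0 <= s)%R /\ s%:E < T (Defs.shift r v)]) =
    ((r + s)%R \in [set s | (r <= s)%R /\ s%:E < T v]).
  apply/idP/idP => /set_mem /= [s0 sT]; apply/mem_set => /=.
    split; first by rewrite lerDl.
    exact: (approach_time_shift r0 s0 rT).1.
  rewrite lerDl in s0; split; first exact: s0.
  exact: (approach_time_shift r0 s0 rT).2.
by case: ifPn => // /set_mem[/= rs _]; rewrite max_l//; rewrite lerDl in rs.
Qed.

Definition mean_discount (y : E) : \bar R := \int[P y]_v (remaining_discount 0 v)%:E.

Lemma measurable_mean_discount : measurable_fun setT mean_discount.
Proof.
apply: (@measurable_fun_integral_kernel _ _ _ _ _ P (measurable_kernel P) (fun v => (remaining_discount 0 v)%:E)).
  by move=> v; rewrite lee_fin; case/andP: (remaining_discount_itv 0 v).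
by apply/measurable_EFinP; exact: measurable_remaining_discount.
Qed.

Lemma mean_discount_itv y : 0 <= mean_discount y <= 1.
Proof.
apply/andP; split.
  by apply: integral_ge0 => v _; rewrite lee_fin; case/andP: (remaining_discount_itv 0 v).
have -> : 1 = \int[P y]_v (cst 1%E v).
  by rewrite integral_cst// mul1e [RHS]prob_kernel.
apply: ge0_le_integral => //.
- by move=> v _; rewrite lee_fin; case/andP: (remaining_discount_itv 0 v).
- by apply/measurable_EFinP; exact: measurable_remaining_discount.
- by move=> v _; rewrite lee_fin; case/andP: (remaining_discount_itv 0 v).
Qed.

Lemma simple_markov x r (F : set W) (H : set W) : (0 <= r)%R ->
  natural_filtration r F -> measurable H ->
  P x (F `&` [set v | H (Defs.shift r v)]) = \int[P x]_(v in F) P (v r) H.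
Proof.
move=> r0 FF mH.
have st : stopping_time (fun _ : W => r%:E).
  split=> [v|t t0]; first by rewrite lee_fin.
  have [rt|tr] := leP r t.
    rewrite (_ : [set _ | _] = setT); first exact: natural_filtrationT.
    by apply/seteqP; split=> v //= _; rewrite lee_fin.
  rewrite (_ : [set _ | _] = ~` setT).
    by apply: natural_filtrationC; exact: natural_filtrationT.
  by rewrite setCT; apply/seteqP; split=> v //=; rewrite lee_fin leNgt tr.
have se : stopping_events (fun _ : W => r%:E) F.
  split=> [|t t0]; first exact: natural_filtration_measurable FF.
  have [rt|tr] := leP r t.
    rewrite (_ : _ `&` _ = F); first exact: natural_filtration_le rt _ FF.
    by apply/seteqP; split=> v /=; [case|move=> ?; rewrite lee_fin].
  rewrite (_ : _ `&` _ = ~` setT).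
    by apply: natural_filtrationC; exact: natural_filtrationT.
  by rewrite setCT; apply/seteqP; split=> v //= [_]; rewrite lee_fin leNgt tr.
have := hP x st se mH => /=.
rewrite (_ : F `&` [set v | r%:E < +oo] = F)//.
by apply/seteqP; split=> v /=; [case|rewrite ltry].
Qed.

(** Both sides are expanded into binary digits and compared term by term. Inside $r < T$ the
    remaining discount is the full discount of the shifted path. *)
Lemma markov_discount x r (F : set W) : (0 <= r)%R ->
  natural_filtration r F -> F `<=` [set v | r%:E < T v] ->
  \int[P x]_(v in F) (remaining_discount r v)%:E = \int[P x]_(v in F) mean_discount (v r).
Proof.
move=> r0 FF FT; have mF := natural_filtration_measurable FF.
have mrd := measurable_remaining_discount.
have mdig n s : measurable (remaining_discount s @^-1` (digit n)).
  by rewrite -[X in measurable X]setTI; apply: mrd => //; exact: measurable_digit.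
have c0 n : 0 <= (2^-1 ^+ n.+1 : R)%:E by rewrite lee_fin exprn_ge0.
have expand s v : (remaining_discount s v)%:E =
    \sum_(n <oo) ((2^-1 ^+ n.+1)%:E * (\1_(remaining_discount s @^-1` digit n) v : R)%:E).
  by rewrite (binary_expansion (remaining_discount_itv s v)); apply: eq_eseriesr => n _.
have intsum (mu : {measure set W -> \bar R}) (G : set W) s : measurable G ->
    \int[mu]_(v in G) (remaining_discount s v)%:E =
    \sum_(n <oo) ((2^-1 ^+ n.+1)%:E * mu ((remaining_discount s @^-1` digit n) `&` G)).
  move=> mG; under eq_integral do rewrite expand.
  rewrite integral_nneseries//.
  - apply: eq_eseriesr => n _; rewrite ge0_integralZl//.
    + by rewrite integral_indic.
    + by apply/measurable_EFinP; exact: measurable_indic.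
  - move=> n; apply: emeasurable_funM => //.
    by apply/measurable_EFinP; exact: measurable_indic.
rewrite intsum//.
under [RHS]eq_integral do rewrite /mean_discount intsum//.
rewrite integral_nneseries//.
- apply: eq_eseriesr => n _; under [RHS]eq_integral do rewrite setIT.
  rewrite ge0_integralZl//.
  + congr (_ * _); rewrite -simple_markov//; congr (P x _).
    rewrite setIC; apply/seteqP; split=> v /= [Fv h]; split=> //=.
      by rewrite remaining_discount_shift//; exact: FT.
    by rewrite -remaining_discount_shift//; exact: FT.
  + apply: (measurable_funS measurableT) => //.
    exact: (measurableT_comp (measurable_kernel P _ (mdig n 0%R)) (measurable_coord r)).
- move=> n; apply: emeasurable_funM => //; apply: (measurable_funS measurableT) => //.
  under eq_fun do rewrite setIT.
  exact: (measurableT_comp (measurable_kernel P _ (mdig n 0%R)) (measurable_coord r)).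
Qed.

(** The factor $k(X_r)$ is known at time [r]: the digits of [k / C] give events of the past, with
    which [markov_discount] is localized. *)
Lemma markov_rate_discount x r : (0 <= r)%R -> (0 < C)%R ->
  \int[P x]_(v in [set v : W | r%:E < T v]) ((k (v r))%:E * (remaining_discount r v)%:E) =
  \int[P x]_(v in [set v : W | r%:E < T v]) ((k (v r))%:E * mean_discount (v r)).
Proof.
move=> r0 C0; set F := [set v : W | r%:E < T v].
have FF : natural_filtration r F := lt_approach_time_filtration D r0.
have mF := natural_filtration_measurable FF.
pose B n : set E := [set y | digit n (k y / C)%R].
have mB n : measurable (B n).
  have mkC : measurable_fun setT (fun y => k y / C)%R by exact: measurable_funM.
  by rewrite -[B n]setTI; apply: mkC => //; exact: measurable_digit.
have kC y : (0 <= k y / C <= 1)%R.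
  by have /andP[h1 h2] := k0 y; rewrite divr_ge0 ?(ltW C0)//= ler_pdivrMr// mul1r.
have expand y : (k y)%:E = \sum_(n <oo) ((C * 2^-1 ^+ n.+1)%:E * (\1_(B n) y : R)%:E).
  rewrite -{1}(divfK (lt0r_neq0 C0) (k y)) mulrC EFinM (binary_expansion (kC y)).
  rewrite -nneseriesZl; last by move=> n _; rewrite lee_fin mulr_ge0// exprn_ge0.
  by apply: eq_eseriesr => n _; rewrite -!EFinM mulrA.
have c0 n : 0 <= (C * 2^-1 ^+ n.+1 : R)%:E by rewrite lee_fin mulr_ge0 ?ltW// exprn_gt0.
have mBr n : measurable [set v : W | B n (v r)].
  by rewrite -[X in measurable X]setTI; apply: measurable_coord => //; exact: mB.
have main (g : W -> R) : (forall v, 0 <= g v)%R -> measurable_fun setT g ->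
  \int[P x]_(v in F) ((k (v r))%:E * (g v)%:E) =
  \sum_(n <oo) ((C * 2^-1 ^+ n.+1)%:E * \int[P x]_(v in F `&` [set v : W | B n (v r)]) (g v)%:E).
  move=> g0 mg.
  have mi n : measurable_fun F (fun v : W => (g v * \1_[set v : W | B n (v r)] v)%:E).
    apply/measurable_EFinP; apply: (measurable_funS measurableT) => //.
    by apply: measurable_funM => //; exact: measurable_indic.
  have i0 n v : 0 <= (g v * \1_[set v : W | B n (v r)] v)%:E by rewrite lee_fin mulr_ge0.
  transitivity (\int[P x]_(v in F) \sum_(n <oo)
      ((C * 2^-1 ^+ n.+1)%:E * (g v * \1_[set v : W | B n (v r)] v)%:E)).
    apply: eq_integral => v _; rewrite expand muleC -nneseriesZl; last first.
      by move=> n _; rewrite mule_ge0// ?lee_fin.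
    apply: eq_eseriesr => n _; rewrite -!EFinM !indicE mulrCA.
    suff -> : (v r \in B n) = (v \in [set v : W | B n (v r)]) by [].
    by apply/idP/idP => /set_mem ?; exact/mem_set.
  rewrite integral_nneseries//.
  - apply: eq_eseriesr => n _; rewrite ge0_integralZl//; congr (_ * _).
    rewrite integral_mkcondr; apply: eq_integral => v _; rewrite /patch indicE.
    by case: (_ \in _); rewrite ?mulr1 ?mulr0.
  - by move=> n; apply: emeasurable_funM.
  - by move=> n v _; rewrite mule_ge0.
have mdE y : mean_discount y = (fine (mean_discount y))%:E.
  have /andP[h1 h2] := mean_discount_itv y.
  by rewrite fineK// ge0_fin_numE// (le_lt_trans h2)// ltry.
rewrite main; last 2 first.
- by move=> v; case/andP: (remaining_discount_itv r v).
- exact: measurable_remaining_discount.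
under [RHS]eq_integral do rewrite mdE.
rewrite main; last 2 first.
- by move=> v; rewrite fine_ge0//; case/andP: (mean_discount_itv (v r)).
- apply: measurableT_comp => //.
  exact: (measurableT_comp measurable_mean_discount (measurable_coord r)).
apply: eq_eseriesr => n _; congr (_ * _).
under [RHS]eq_integral do rewrite -mdE.
apply: markov_discount => //.
apply: natural_filtrationI => //; apply: natural_filtration_coord => //.
by rewrite r0 lexx.
Qed.

End markov.

(** * Integrals over the lifetime of a path *)

Section killed_integral.
Context {R : realType} {d : nat}.
Local Notation E := 'rV[R]_d.
Local Notation W := (skorokhod R d).
Local Notation leb := (@lebesgue_measure R).
Implicit Types (v : W) (r s : R) (S : W -> \bar R) (F : W * R -> \bar R).
Local Open Scope ereal_scope.

Lemma ae_le_lower_integral d' (X : measurableType d') (mu : {measure set X -> \bar R})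
    (f g : X -> \bar R) :
  {ae mu, forall x, f x <= g x} -> \int[mu]_x f x <= \int[mu]_x g x.
Proof.
move=> fg; rewrite integralE [leRHS]integralE; apply: leeB;
  apply: ge0_ae_le_lower_integral => //; apply: filterS fg => x fgx.
- by rewrite !funeposE ge_max le_max fgx/= le_max lexx orbT.
- by rewrite !funenegE ge_max !le_max leeN2 fgx/= lexx orbT.
Qed.

Lemma le_lower_integral_set d' (X : measurableType d') (mu : {measure set X -> \bar R})
    (A : set X) (f g : X -> \bar R) :
  (forall x, A x -> f x <= g x) -> \int[mu]_(x in A) f x <= \int[mu]_(x in A) g x.
Proof.
move=> fg; rewrite integral_mkcond [leRHS]integral_mkcond.
apply: ae_le_lower_integral; apply: nearW => x; rewrite /patch.
by case: ifPn => // /set_mem; exact: fg.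
Qed.

Definition alive S : set (W * R) := [set z | (0 <= z.2)%R /\ z.2%:E < S z.1].

Lemma measurable_alive S : measurable_fun setT S -> measurable (alive S).
Proof.
move=> mS.
rewrite (_ : alive S = (setT `&` [set z : W * R | (0 : \bar R) <= z.2%:E]) `&`
    (setT `&` [set z : W * R | z.2%:E < S z.1])); last first.
  by apply/seteqP; split=> z /=; rewrite lee_fin; [move=> [? ?]|move=> [[_ ?] [_ ?]]].
have m2 : measurable_fun setT (fun z : W * R => z.2%:E).
  by apply/measurable_EFinP; exact: measurable_snd.
apply: measurableI; first exact: measurable_lee.
by apply: measurable_lte => //; exact: (measurableT_comp mS measurable_fst).
Qed.

Definition killed_integral S F v : \bar R := \int[leb]_(r in before (S v)) F (v, r).

Lemma killed_integral_ge0 S F v : (forall z, 0 <= F z) -> 0 <= killed_integral S F v.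
Proof. by move=> F0; exact: integral_ge0. Qed.

Lemma measurable_killed_integral S F : measurable_fun setT S -> measurable_fun setT F ->
  (forall z, 0 <= F z) -> measurable_fun setT (killed_integral S F).
Proof.
move=> mS mF F0; exact: measurable_section_integral (measurable_alive mS) mF F0.
Qed.

(** The right side has the shape of the resolvent, an outer integral over all times and an inner one
    over the surviving paths; the left side is where pathwise identities apply. *)
Lemma killed_fubini (P : probability W R) S F : measurable_fun setT S ->
  measurable_fun setT F -> (forall z, 0 <= F z) ->
  \int[P]_v killed_integral S F v =
  \int[leb]_(r in `[0%R, +oo[) \int[P]_(v in [set v | r%:E < S v]) F (v, r).
Proof.
move=> mS mF F0; have mA := measurable_alive mS.
pose G z := F z * (\1_(alive S) z : R)%:E.
transitivity (\int[P]_v \int[leb]_r G (v, r)).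
  by apply: eq_integral => v _; exact: section_integralE.
rewrite (fubini_tonelli (m1 := P) (m2 := leb)); last 2 first.
- exact: measurable_restrict_indic.
- exact: restrict_indic_ge0.
rewrite [RHS]integral_mkcond; apply: eq_integral => r _; rewrite /patch.
case: ifPn => [/set_mem|r0].
  rewrite /= in_itv/= andbT => r0; rewrite [RHS]integral_mkcond.
  apply: eq_integral => v _; rewrite /patch /G indicE.
  rewrite (_ : ((v, r) \in _) = (v \in [set v | r%:E < S v])).
    by case: (_ \in _); rewrite ?mule1 ?mule0.
  by apply/idP/idP => /set_mem; [move=> [_ h]|move=> h]; exact/mem_set.
apply: integral0_eq => v _; rewrite /G indicE memNset ?mule0// => -[/= r0' _].
by move/negP: r0; apply; rewrite inE/= in_itv/= r0'.
Qed.

End killed_integral.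

(** * Pathwise bounds for the discount *)

Section killing_rate.
Context {R : realType} {d : nat}.
Local Notation E := 'rV[R]_d.
Local Notation W := (skorokhod R d).
Local Notation leb := (@lebesgue_measure R).
Variable D : set E.
Variables (k : E -> R) (C : R).
Hypothesis mk : measurable_fun setT k.
Hypothesis k0 : forall y, 0 <= k y <= C.
Implicit Types (v : W) (r s : R).
Local Notation T := (approach_time D).
Local Notation remaining_discount := (remaining_discount D k).
Local Open Scope ereal_scope.

Lemma measurable_discount2 : measurable_fun setT (fun w : W * R => discount k w.2%:E w.1).
Proof.
apply: (measurableT_comp measurable_expeR); apply: measurableT_comp => //.
pose A : set ((W * R) * R) := [set z | (0 <= z.2)%R /\ z.2%:E < z.1.2%:E].
have m12 : measurable_fun setT (fun z : (W * R) * R => z.1.2).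
  exact: (measurableT_comp measurable_snd measurable_fst).
have m11 : measurable_fun setT (fun z : (W * R) * R => z.1.1).
  exact: (measurableT_comp measurable_fst measurable_fst).
have mA : measurable A.
  rewrite (_ : A = (setT `&` [set z : (W * R) * R | (0 : \bar R) <= z.2%:E]) `&`
     (setT `&` [set z : (W * R) * R | z.2%:E < z.1.2%:E])); last first.
    by apply/seteqP; split=> z /=; rewrite lee_fin; [move=> [? ?]|move=> [[_ ?] [_ ?]]].
  apply: measurableI.
    by apply: measurable_lee => //; apply/measurable_EFinP => //; exact: measurable_snd.
  by apply: measurable_lte => //; apply/measurable_EFinP => //; exact: measurable_snd.
have mf : measurable_fun setT (fun z : (W * R) * R => (k (z.1.1 z.2))%:E).
  apply/measurable_EFinP; apply: (measurableT_comp mk).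
  exact: (measurableT_comp (measurable_eval (d := d)) (measurable_fun_pair m11 measurable_snd)).
apply: (measurable_section_integral mA mf) => z.
by rewrite lee_fin; case/andP: (k0 (z.1.1 z.2)).
Qed.

Lemma discount_itv (t : \bar R) v : 0 <= discount k t v <= 1.
Proof.
by apply: expeRN_itv; apply: integral_ge0 => s _; rewrite lee_fin; case/andP: (k0 (v s)).
Qed.

Lemma exp_le_discount r v : (0 <= r)%R -> (expR (- (C * r)))%:E <= discount k r%:E v.
Proof.
move=> r0; rewrite (_ : (expR _)%:E = expeR (- (C * r)%:E))// /discount lee_expeR leeN2.
have -> : before r%:E = `[0%R, r[%classic.
  by apply/seteqP; split=> s; rewrite /= /before/= in_itv/= lte_fin; [move=> [-> ->]|move=> /andP[]].
have <- : \int[leb]_(s in `[0%R, r[) (cst C%:E) s = (C * r)%:E.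
  by rewrite integral_cst//= lebesgue_measure_itv/= lte_fin; case: ltgtP r0 => // [_|<-] _;
    rewrite ?subr0 ?mulr0 ?mule0// sube0.
apply: ge0_le_integral => //.
- by move=> s _; rewrite lee_fin; case/andP: (k0 (v s)).
- apply/measurable_EFinP; apply: (measurable_funS measurableT) => //.
  exact: (measurableT_comp mk (measurable_path v)).
- by move=> s _; rewrite lee_fin; have /andP[h1 h2] := k0 (v s); exact: le_trans h2.
Qed.

Lemma discount_approach_time v : discount k (T v) v = (remaining_discount 0 v)%:E.
Proof. by rewrite (remaining_discountE D k0). Qed.

(* For fixed v the integrand is the derivative of r |-> remaining_discount r v. *)
Lemma rate_discount_le v : T v < +oo ->
  \int[leb]_(r in before (T v)) ((k (v r))%:E * (remaining_discount r v)%:E) <=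
  (1 - remaining_discount 0 v)%:E.
Proof.
move=> Tfin; have T0 := approach_time_ge0 D v.
have [tau tauE] : exists tau, T v = tau%:E by case: (T v) Tfin T0 => // r; exists r.
have tau0 : (0 <= tau)%R by rewrite tauE lee_fin in T0.
pose h r := k (v r).
have mh : measurable_fun setT h := measurableT_comp mk (measurable_path v).
have h0 r : (0 <= h r <= C)%R := k0 (v r).
have hC r : (`|h r| <= C)%R by have /andP[? ?] := h0 r; rewrite ger0_norm.
have mhE (B : set R) : measurable B -> measurable_fun B (fun s => (h s)%:E).
  by move=> mB; apply/measurable_EFinP; exact: measurable_funS mh.
have rdE r : (0 <= r <= tau)%R ->
    remaining_discount r v = expR (primitive h r - primitive h tau).
  move=> /andP[r0 rt].
  apply: EFin_inj; rewrite (remaining_discountE D k0).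
  have -> : remaining_rate D k r v = (primitive h tau - primitive h r)%:E.
    rewrite /primitive Rintegral_itvB ?bnd_simp//; last exact: (integrable_bounded_itv mh hC).
    rewrite /Rintegral fineK; last first.
      by apply: integrable_fin_num => //; exact: (integrable_bounded_itv mh hC).
    rewrite integral_itv_obnd_cbnd; last exact: mhE.
    rewrite -integral_itv_bndo_bndc; last exact: mhE.
    rewrite /remaining_rate; congr (integral _ _ _).
    by apply/seteqP; split=> s; rewrite /= in_itv/= tauE lte_fin; [move=> [-> ->]|move=> /andP[]].
  by rewrite -EFinN opprB.
pose f r := (h r * expR (primitive h r - primitive h tau))%R.
have mf : measurable_fun setT f.
  apply: measurable_funM => //; apply: measurableT_comp => //.
  by apply: measurable_funB => //; exact: (measurable_primitive mh h0).
have -> : before (T v) = `[0%R, tau[%classic.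
  by rewrite tauE; apply/seteqP; split=> s; rewrite /= /before/= in_itv/= lte_fin;
    [move=> [-> ->]|move=> /andP[]].
have -> : \int[leb]_(r in `[0%R, tau[) ((k (v r))%:E * (remaining_discount r v)%:E) =
    \int[leb]_(r in `[0%R, tau[) (f r)%:E.
  apply: eq_integral => r; rewrite inE/= in_itv/= => /andP[r0 rt].
  by rewrite rdE ?r0 ?ltW// EFinM.
rewrite integral_itv_bndo_bndc; last by apply/measurable_EFinP; exact: measurable_funS mf.
rewrite rdE ?lexx// primitive0 sub0r.
apply: (@le_trans _ _ (\int[leb]_(r in `[0%R, tau]) f r)%R%:E); last first.
  by rewrite lee_fin; exact: (exponential_primitive mh h0 tau0).
rewrite /Rintegral fineK//; apply: integrable_fin_num => //.
apply: measurable_bounded_integrable => //.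
- by rewrite /= lebesgue_measure_itv; case: ifP => _; rewrite ltry.
- exact: measurable_funS mf.
- apply/bounded_onP; exists C; first exact: le_trans (hC 0%R).
  move=> r; rewrite /= in_itv/= => /andP[_ rb]; have /andP[hr1 hr2] := h0 r.
  rewrite /f ger0_norm ?mulr_ge0 ?expR_ge0// (le_trans _ hr2)// ler_piMr//.
  by rewrite -expR0 ler_expR subr_le0 (primitive_le mh h0).
Qed.

End killing_rate.

(** * The resolvent and subsolution bounds *)

Section law.
Context {R : realType} {d : nat}.
Local Notation E := 'rV[R]_d.
Local Notation W := (skorokhod R d).

(** An alias of the measure [P x] that carries the structure of a probability. *)
Definition law (P : R.-pker E ~> W) (x : E) : set W -> \bar R := P x.

HB.instance Definition _ P x := Measure.on (law P x).

HB.instance Definition _ P x :=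
  Measure_isProbability.Build _ _ _ (law P x) (prob_kernel x).

End law.

(** * The upper bound for the resolvent *)

Section killing_bounds.
Context {R : realType} {d : nat}.
Local Notation E := 'rV[R]_d.
Local Notation W := (skorokhod R d).
Local Notation leb := (@lebesgue_measure R).
Variable P : R.-pker E ~> W.
Hypothesis hP : strong_markov P.
Variable D : set E.
Variables (k : E -> R) (C : R).
Hypothesis mk : measurable_fun setT k.
Hypothesis k0 : forall y, 0 <= k y <= C.
Implicit Types (v : W) (r s : R).
Local Notation T := (approach_time D).
Local Notation remaining_discount := (remaining_discount D k).
Local Notation w := (mean_discount P D k).
Local Open Scope ereal_scope.

Variable x : E.
Hypothesis Tfin : {ae P x, forall v, T v < +oo}.

Lemma measurable_before (t : \bar R) : measurable (before t).
Proof.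
rewrite (_ : before t = (setT `&` [set r : R | (0 : \bar R) <= r%:E]) `&`
    (setT `&` [set r : R | r%:E < t])); last first.
  by apply/seteqP; split=> z /=; rewrite lee_fin; [move=> [? ?]|move=> [[_ ?] [_ ?]]].
apply: measurableI.
  by apply: measurable_lee => //; apply/measurable_EFinP.
by apply: measurable_lte => //; apply/measurable_EFinP.
Qed.

Lemma fin_mean_discount y : w y = (fine (w y))%:E.
Proof.
have /andP[h1 h2] := mean_discount_itv P D mk k0 y.
by rewrite fineK// ge0_fin_numE// (le_lt_trans h2)// ltry.
Qed.

Definition rate_mean_discount (z : W * R) : \bar R := (k (z.1 z.2))%:E * w (z.1 z.2).

Lemma measurable_rate_mean_discount : measurable_fun setT rate_mean_discount.
Proof.
apply: emeasurable_funM.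
  by apply/measurable_EFinP; exact: (measurableT_comp mk (@measurable_eval R d)).
exact: (measurableT_comp (measurable_mean_discount P D mk k0) (@measurable_eval R d)).
Qed.

Lemma rate_mean_discount_ge0 z : 0 <= rate_mean_discount z.
Proof.
rewrite mule_ge0// ?lee_fin; first by case/andP: (k0 (z.1 z.2)).
by case/andP: (mean_discount_itv P D mk k0 (z.1 z.2)).
Qed.

(** Fubini brings time outside, the Markov property at each [r] replaces the mean discount from
    $X_r$ by the remaining discount of the same path, and Fubini back leaves the pathwise bound
    [rate_discount_le]. *)
Lemma killed_rate_mean_discount : \int[P x]_v killed_integral T rate_mean_discount v <= 1 - w x.
Proof.
have C0 : (0 <= C)%R by have /andP[h1 h2] := k0 0%R; exact: le_trans h2.
(* [C] may be 0, whereas the expansion behind [markov_rate_discount] divides by the bound. *)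
have C1 : (0 < C + 1)%R by rewrite ltr_wpDl.
have k1 y : (0 <= k y <= C + 1)%R.
  by have /andP[-> h2] := k0 y; rewrite (le_trans h2)//= lerDl.
have mT : measurable_fun setT T := measurable_approach_time D.
have mrd := measurable_remaining_discount2 D mk k0.
pose G (z : W * R) : \bar R := (k (z.1 z.2))%:E * (remaining_discount z.2 z.1)%:E.
have mG : measurable_fun setT G.
  apply: emeasurable_funM; last by apply/measurable_EFinP.
  by apply/measurable_EFinP; exact: (measurableT_comp mk (@measurable_eval R d)).
have G0 z : 0 <= G z.
  rewrite mule_ge0// lee_fin; first by case/andP: (k0 (z.1 z.2)).
  by case/andP: (remaining_discount_itv D k0 z.2 z.1).
rewrite (killed_fubini (law P x) mT measurable_rate_mean_discount rate_mean_discount_ge0).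
have -> : \int[leb]_(r in `[0%R, +oo[)
      \int[law P x]_(v in [set v | r%:E < T v]) rate_mean_discount (v, r) =
    \int[law P x]_v killed_integral T G v.
  rewrite (killed_fubini (law P x) mT mG G0); apply: eq_integral => r.
  rewrite inE/= in_itv/= andbT => r0.
  exact/esym/(markov_rate_discount hP D mk k1 x r0 C1).
apply: (@le_trans _ _ (\int[law P x]_v (1 - remaining_discount 0 v)%:E)).
  apply: ae_le_lower_integral; apply: filterS Tfin => v Tv.
  exact: (rate_discount_le mk k0 Tv).
have mrd0 := measurable_remaining_discount D mk k0 0.
rewrite leeBrDr; last by rewrite fin_mean_discount.
rewrite /mean_discount -ge0_integralD//.
- rewrite (eq_integral (cst 1)) => [|v _]; last by rewrite -EFinD subrK.
  by rewrite integral_cst// mul1e -[leRHS](@prob_kernel _ _ _ _ _ P x).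
- by move=> v _; rewrite lee_fin subr_ge0; case/andP: (remaining_discount_itv D k0 0 v).
- by apply/measurable_EFinP; exact: measurable_funB.
- by move=> v _; rewrite lee_fin; case/andP: (remaining_discount_itv D k0 0 v).
- by apply/measurable_EFinP.
Qed.

Variable h : E -> R.
Hypothesis mh : measurable_fun setT h.
Hypothesis h0 : forall y, (0 <= h y)%R.

Definition discounted_cost (z : W * R) : \bar R :=
  discount k z.2%:E z.1 * (h (z.1 z.2))%:E.

Lemma measurable_discounted_cost : measurable_fun setT discounted_cost.
Proof.
apply: emeasurable_funM; first exact: (measurable_discount2 mk k0).
by apply/measurable_EFinP; exact: (measurableT_comp mh (@measurable_eval R d)).
Qed.

Lemma discounted_cost_ge0 z : 0 <= discounted_cost z.
Proof. by rewrite mule_ge0// ?lee_fin//; case/andP: (discount_itv k0 z.2%:E z.1). Qed.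

Hypothesis exitE : {ae P x, forall v, exit_time D v = T v}.

(** The cost is cut at [n] because the minorization condition concerns bounded functions; the bound
    on the right does not depend on [n]. *)
Lemma resolvent_le (a n : R) : (0 <= a)%R -> (0 <= n)%R ->
  resolvent P D C (fun y => a * (k y * fine (w y)) + Num.min (h y) n)%R x <=
  a%:E * (1 - w x) + \int[P x]_v killed_integral T discounted_cost v.
Proof.
move=> a0 n0; set f : E -> R := fun y => _.
have mT : measurable_fun setT T := measurable_approach_time D.
have mK := measurable_rate_mean_discount; have K0 := rate_mean_discount_ge0.
have mF := measurable_discounted_cost; have F0 := discounted_cost_ge0.
have w0 y : (0 <= fine (w y))%R by apply: fine_ge0; case/andP: (mean_discount_itv P D mk k0 y).
have A0 y : (0 <= a * (k y * fine (w y)))%R.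
  by rewrite !mulr_ge0//; case/andP: (k0 y).
have B0 y : (0 <= Num.min (h y) n)%R by rewrite le_min h0.
have mf : measurable_fun setT f.
  apply: measurable_funD; last exact: measurable_minr.
  apply: measurable_funM => //; apply: measurable_funM => //.
  by apply: measurableT_comp => //; exact: (measurable_mean_discount P D mk k0).
pose H z := a%:E * rate_mean_discount z + discounted_cost z.
have mH : measurable_fun setT H by apply: emeasurable_funD => //; exact: emeasurable_funM.
have aK0 z : 0 <= a%:E * rate_mean_discount z by rewrite mule_ge0.
have H0 z : 0 <= H z by exact: adde_ge0.
apply: (@le_trans _ _ (\int[leb]_(r in `[0%R, +oo[)
    \int[law P x]_(v in [set v | r%:E < T v]) H (v, r))).
  apply: le_lower_integral_set => r; rewrite /= in_itv/= andbT => r0.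
  have -> : killed_semigroup P D r f x = \int[law P x]_(v in [set v | r%:E < T v]) (f (v r))%:E.
    by apply: ae_eq_lower_integral_set; apply: filterS exitE => v /= ->.
  rewrite -ge0_integralZl_EFin ?expR_ge0//; last 3 first.
  - exact: natural_filtration_measurable (lt_approach_time_filtration D r0).
  - by move=> v _; rewrite lee_fin addr_ge0.
  - apply/measurable_EFinP; apply: (measurable_funS measurableT) => //.
    exact: (measurableT_comp mf (measurable_coord r)).
  apply: le_lower_integral_set => v _.
  rewrite /f EFinD ge0_muleDr ?lee_fin//; apply: leeD.
    rewrite /rate_mean_discount fin_mean_discount -!EFinM lee_fin ler_piMl//.
    rewrite -[leRHS]expR0 ler_expR oppr_le0 mulr_ge0//.
    by have /andP[h1 h2] := k0 0%R; exact: le_trans h2.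
  apply: lee_pmul; rewrite ?lee_fin ?expR_ge0//; first exact: exp_le_discount.
  by rewrite ge_min lexx.
rewrite -(killed_fubini (law P x) mT mH H0).
have -> : \int[law P x]_v killed_integral T H v =
    a%:E * \int[law P x]_v killed_integral T rate_mean_discount v +
    \int[law P x]_v killed_integral T discounted_cost v.
  have mkK := measurable_killed_integral mT mK K0.
  rewrite -ge0_integralZl_EFin//; last by move=> v _; exact: killed_integral_ge0.
  rewrite -ge0_integralD//; last 4 first.
  - by move=> v _; rewrite mule_ge0//; exact: killed_integral_ge0.
  - exact: emeasurable_funM.
  - by move=> v _; exact: killed_integral_ge0.
  - exact: measurable_killed_integral.
  apply: eq_integral => v _; have mB := measurable_before (T v).
  have mKv : measurable_fun (before (T v)) (fun r => rate_mean_discount (v, r)).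
    by apply: (measurable_funS measurableT) => //; exact: (measurableT_comp mK (pair1_measurable v)).
  have mFv : measurable_fun (before (T v)) (fun r => discounted_cost (v, r)).
    by apply: (measurable_funS measurableT) => //; exact: (measurableT_comp mF (pair1_measurable v)).
  rewrite /killed_integral ge0_integralD//; last exact: emeasurable_funM.
  by rewrite ge0_integralZl_EFin.
by apply: leeD => //; apply: lee_wpmul2l; [rewrite lee_fin|exact: killed_rate_mean_discount].
Qed.

End killing_bounds.

(** * The limit in the subsolution inequality *)

Section subsolution_bound.
Context {R : realType} {d : nat}.
Local Notation E := 'rV[R]_d.
Local Notation W := (skorokhod R d).
Local Notation leb := (@lebesgue_measure R).
Variable P : R.-pker E ~> W.
Variable D : set E.
Variables (c k : E -> R) (C : R).
Hypothesis mk : measurable_fun setT k.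
Hypothesis k0 : forall y, 0 <= k y <= C.
Hypothesis ck : forall y, D y -> c y = k y.
Implicit Types (v : W) (r s : R).
Local Notation T := (approach_time D).
Local Notation w := (mean_discount P D k).
Local Open Scope ereal_scope.

Variable x : E.
Hypothesis Tfin : {ae P x, forall v, T v < +oo}.
Hypothesis exitE : {ae P x, forall v, exit_time D v = T v}.
Variables (g h : E -> R).
Hypothesis mh : measurable_fun setT h.
Hypothesis h0 : forall y, (0 <= h y)%R.
Hypothesis gh : forall y, D y -> g y = (- h y)%R.
Local Notation cost := (discounted_cost k h).

Lemma discount_eq_on (t : \bar R) v : (forall s, before t s -> D (v s)) ->
  discount c t v = discount k t v.
Proof.
move=> tD; rewrite /discount; congr (expeR (- _)).
by apply: eq_integral => s /set_mem st; rewrite ck//; exact: tD.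
Qed.

Let stopped n v : \bar R := Order.min (T v) n%:R%:E.

Let mstopped n : measurable_fun setT (stopped n).
Proof. by apply: measurable_mine => //; exact: measurable_approach_time. Qed.

Let before_stopped n v s : before (stopped n v) s -> D (v s).
Proof. by move=> [s0]; rewrite lt_min => /andP[sT _]; exact: (before_approach_time s0). Qed.

Lemma cvg_killed_cost :
  \int[P x]_v killed_integral (stopped n) cost v @[n --> \oo] -->
  \int[P x]_v killed_integral T cost v.
Proof.
have mF := measurable_discounted_cost mk k0 mh.
have F0 := discounted_cost_ge0 k0 h0.
have -> : \int[P x]_v killed_integral T cost v =
    \int[P x]_v limn (fun n => killed_integral (stopped n) cost v).
  apply: ae_eq_lower_integral; apply: filterS Tfin => v Tv.
  apply/esym/lim_near_cst => //.
  have [tau tauE] : exists tau, T v = tau%:E.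
    by case: (T v) Tv (approach_time_ge0 D v) => // r; exists r.
  exists (Num.truncn tau).+1 => // n /= tn; rewrite /killed_integral /stopped min_l//.
  rewrite tauE lee_fin ltW// (lt_le_trans (truncnS_gt tau))// ler_nat.
  exact: tn.
apply: cvg_monotone_convergence => //.
- by move=> n; exact: measurable_killed_integral.
- by move=> n v _; exact: killed_integral_ge0.
- move=> v _ m n mn; rewrite /killed_integral.
  apply: ge0_subset_integral => //; [exact: measurable_before|exact: measurable_before| |].
  + apply: (measurable_funS measurableT) => //; exact: (measurableT_comp mF (pair1_measurable v)).
  + move=> s [s0]; rewrite !lt_min => /andP[sT sm]; split=> //.
    by rewrite lt_min sT (lt_le_trans sm)// lee_fin ler_nat.
Qed.

Variables (u : E -> R) (m K : R).
Hypothesis m0 : (0 <= m)%R.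
Hypothesis uK : forall y, (`|u y| <= K)%R.
Hypothesis exit_le : {ae P x, forall v s, T v = s%:E -> (u (v s) <= m)%R}.
Hypothesis usub : forall t : R, (0 <= t)%R ->
  let S v := Order.min (exit_time D v) t%:E in
  (u x)%:E <= \int[P x]_v (discount c (S v) v * (u (v (fine (S v))))%:E) +
    \int[P x]_v \int[leb]_(r in before (S v)) (discount c r%:E v * (g (v r))%:E).

Let late n : set W := [set v | n%:R%:E <= T v].

Let mlate n : measurable (late n).
Proof.
rewrite -[late n]setTI; apply: measurable_lee => //; exact: measurable_approach_time.
Qed.

Let K0 : (0 <= K)%R. Proof. exact: le_trans (uK 0%R). Qed.

(** If $T < n$, the stopped payoff is the discounted value at the exit position, where [u] is at
    most [m]. On the remaining event a crude bound is enough, as its probability tends to 0. *)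
Lemma stopped_payoff_le n :
  \int[P x]_v (discount c (Order.min (exit_time D v) n%:R%:E) v *
    (u (v (fine (Order.min (exit_time D v) n%:R%:E))))%:E) <=
  m%:E * w x + K%:E * P x (late n).
Proof.
have rd0 v := remaining_discount_itv D k0 0 v.
have mrd : measurable_fun setT (fun v : W => (remaining_discount D k 0 v)%:E).
  by apply/measurable_EFinP; exact: measurable_remaining_discount mk k0 0%R.
rewrite /mean_discount -ge0_integralZl_EFin//; last first.
  by move=> v _; rewrite lee_fin; case/andP: (rd0 v).
have -> : P x (late n) = \int[P x]_v (\1_(late n) v : R)%:E by rewrite integral_indic// setIT.
have mI : measurable_fun setT (fun v : W => (\1_(late n) v : R)%:E).
  by apply/measurable_EFinP; exact: measurable_indic.
rewrite -ge0_integralZl_EFin//.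
have mM (a : R) f : measurable_fun setT f -> measurable_fun setT (fun v : W => a%:E * f v).
  by move=> mf; exact: emeasurable_funM.
rewrite -(ge0_integralD _ measurableT _ (mM m _ mrd) _ (mM K _ mI)); last 2 first.
- by move=> v _; rewrite mule_ge0// lee_fin; case/andP: (rd0 v).
- by move=> v _; rewrite mule_ge0// lee_fin.
apply: ae_le_lower_integral; apply: filterS2 exitE exit_le => v -> hv.
rewrite discount_eq_on; last exact: before_stopped.
have /andP[r0 r1] := rd0 v.
rewrite -!EFinM -EFinD indicE.
have [Tn|nT] := ltP (T v) n%:R%:E.
  have [tau tauE] : exists tau, T v = tau%:E.
    by case: (T v) Tn (approach_time_ge0 D v) => // r; exists r.
  rewrite memNset ?mulr0 ?addr0; last by rewrite /late/= leNgt Tn.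
  rewrite (discount_approach_time D k0) tauE/= -EFinM lee_fin mulrC ler_wpM2r//.
  exact: hv.
(* For late paths the discount is at most 1 and [u] at most [K]; the other term on the right is
   dropped, being nonnegative because [m] is. *)
rewrite mem_set// mulr1.
have /andP[d0 d1] := discount_itv k0 n%:R%:E v.
have -> : discount k n%:R%:E v = (fine (discount k n%:R%:E v))%:E.
  by rewrite fineK// ge0_fin_numE// (le_lt_trans d1)// ltry.
set q := fine _; have q0 : (0 <= q)%R by apply: fine_ge0.
have q1 : (q <= 1)%R.
  by rewrite -lee_fin /q fineK// ge0_fin_numE// (le_lt_trans d1)// ltry.
rewrite -EFinM lee_fin; apply: (@le_trans _ _ K); last by rewrite lerDr mulr_ge0.
have /ler_normlP[_ uK'] := uK (v (fine n%:R%:E)).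
apply: (@le_trans _ _ (q * K)%R); first exact: ler_wpM2l.
exact: ler_piMl.
Qed.

Lemma stopped_cost n :
  \int[P x]_v \int[leb]_(r in before (Order.min (exit_time D v) n%:R%:E))
    (discount c r%:E v * (g (v r))%:E) =
  - \int[P x]_v killed_integral (stopped n) cost v.
Proof.
have F0 := discounted_cost_ge0 k0 h0.
rewrite -integral_ge0N; last by move=> v _; exact: killed_integral_ge0.
apply: ae_eq_lower_integral; apply: filterS exitE => v ->.
rewrite /killed_integral -integral_ge0N//.
apply: eq_integral => r /set_mem rS; rewrite gh; last exact: before_stopped rS.
rewrite EFinN muleN /discounted_cost /= discount_eq_on// => s [s0 sr].
apply: (before_stopped (n := n)); split=> //; apply: lt_trans sr _.
by case: rS.
Qed.

Lemma late_null : P x (late n) @[n --> \oo] --> 0.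
Proof.
have mL : measurable (\bigcap_n late n) by apply: bigcapT_measurable.
have <- : P x (\bigcap_n late n) = 0.
  apply: measure_negligible => //; apply: negligibleS Tfin => v /= Lv Tv.
  have [tau tauE] : exists tau, T v = tau%:E.
    by case: (T v) Tv (approach_time_ge0 D v) => // r; exists r.
  have := Lv (Num.truncn tau).+1 Logic.I; rewrite /late/= tauE lee_fin leNgt.
  by rewrite truncnS_gt.
apply: (nonincreasing_cvg_mu (mu := P x)) => //.
  by rewrite -ge0_fin_numE// (fin_num_measure (law P x)).
move=> i j ij; apply/subsetPset => v /=; rewrite /late/=.
by apply: le_trans; rewrite lee_fin ler_nat.
Qed.

Lemma subsolution_le :
  (u x)%:E + \int[P x]_v killed_integral T cost v <= m%:E * w x.
Proof.
have F0 := discounted_cost_ge0 k0 h0.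
have step n : (u x)%:E + \int[P x]_v killed_integral (stopped n) cost v <=
    m%:E * w x + K%:E * P x (late n).
  have := usub (ler0n R n); rewrite /= stopped_cost => usubn.
  have G0 : 0 <= \int[P x]_v killed_integral (stopped n) cost v.
    by apply: integral_ge0 => v _; exact: killed_integral_ge0.
  have := le_trans usubn (leeD (stopped_payoff_le n) (lexx _)).
  have Pn : P x (late n) = (fine (P x (late n)))%:E.
    by rewrite fineK// (fin_num_measure (law P x)).
  rewrite Pn (fin_mean_discount P D mk k0) -!EFinM -EFinD.
  (* With an infinite cost the subsolution inequality would read [u x <= -oo]. *)
  case: (\int[P x]_v _) G0 => [z| |]//= z0.
  by rewrite -?EFinN -?EFinD !lee_fin; lra.
have L1 : (u x)%:E + \int[P x]_v killed_integral (stopped n) cost v @[n --> \oo] -->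
    (u x)%:E + \int[P x]_v killed_integral T cost v.
  by apply: cvgeD; [exact: fin_num_adde_defr|exact: cvg_cst|exact: cvg_killed_cost].
have L2 : m%:E * w x + K%:E * P x (late n) @[n --> \oo] --> m%:E * w x.
  rewrite -[X in _ --> X]adde0 -(mule0 K%:E).
  apply: cvgeD; [by rewrite mule0 fin_num_adde_defl|exact: cvg_cst|].
  by apply: cvgeZl => //; exact: late_null.
by apply: (lee_cvg_to L1 L2); exact: nearW.
Qed.

End subsolution_bound.

Theorem theorem7p3 (R : realType) (d : nat) (D : set 'rV[R]_d)
  (Q : 'rV[R]_d -> 'M[R]_d) (b : 'rV[R]_d -> 'rV[R]_d)
  (N : R.-sigmafker 'rV[R]_d ~> 'rV[R]_d) (c : 'rV[R]_d -> R)
  (P : R.-pker 'rV[R]_d ~> skorokhod R d)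
  (hD : domain D)
  (hQb : diffusion_drift_assumption Q b)
  (hN : levy_kernel_assumption N)
  (hc : borel_bounded D c) (hc0 : forall x, D x -> 0 <= c x)
  (hP : strong_markov_solution (levy_operator Q b N) P)
  (hexit : exits_almost_surely P D)
  (g : 'rV[R]_d -> R)
  (hg : measurable_fun D g) (hg0 : forall x, D x -> g x <= 0)
  (psi : 'rV[R]_d -> R) (hpsi : forall x, D x -> 0 <= psi x)
  (nu : {measure set 'rV[R]_d -> \bar R}) (hnu : sigma_finite D nu)
  (hmin : minorization P D (sup (c @` D)) psi nu)
  (u : 'rV[R]_d -> R)
  (hu : nonneg_weak_subsolution P D N c g u)
  (x : 'rV[R]_d) (hx : D x) :
  let ubar := sup (u @` extended_closure N D) in
  ((psi x)%:E * (ubar%:E * \int[nu]_(y in D) ((c y)%:E * exit_discount P D c y)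
                 + \int[nu]_(y in D) (Num.max (- g y) 0)%:E)
   <= (ubar - u x)%:E)%E.
Proof.
cbv zeta; set ubar := sup (u @` _); have [oD _] := hD; have mD := open_measurable_rV oD.
have [mc bc] := hc; have [Kc Kc0 hKc] := (bounded_onP _ _).1 bc.
set cbar := sup (c @` D) in hmin.
(* [c] is controlled on [D] only; its extension by 0 is Borel and bounded everywhere, and agrees
   with [c] along paths before $T$. The same is done below for $g^-$. *)
pose k : 'rV[R]_d -> R := c \_ D.
have ck y : D y -> c y = k y by move=> Dy; rewrite /k patchE mem_set.
have k_out y : ~ D y -> k y = 0 by move=> Dy; rewrite /k patchE memNset.
(* Boundedness of [c] makes the real [sup] an actual supremum rather than a default value; likewise
   for [u] below. *)
have c_le y : D y -> c y <= cbar.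
  move=> Dy; apply: ub_le_sup; last by exists y.
  by exists Kc => _ [z Dz <-]; rewrite (le_trans (ler_norm _))// hKc.
have cbar0 : 0 <= cbar by rewrite (le_trans (hc0 _ hx))// c_le.
have mk : measurable_fun setT k by exact: (measurable_restrictT _ mD).1.
have k0 y : 0 <= k y <= cbar.
  by have [Dy|Dy] := pselect (D y); [rewrite -ck// hc0//= c_le|rewrite k_out// lexx].
pose h : 'rV[R]_d -> R := (fun y => Num.max (- g y) 0) \_ D.
have hD' y : D y -> h y = Num.max (- g y) 0 by move=> Dy; rewrite /h patchE mem_set.
have gh y : D y -> g y = - h y.
  by move=> Dy; rewrite hD'// max_l ?opprK// oppr_ge0 hg0.
have mh : measurable_fun setT h.
  apply: (measurable_restrictT _ mD).1; apply: measurable_maxr => //.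
  exact: measurableT_comp.
have h0 y : 0 <= h y by rewrite /h patchE; case: ifP => // _; rewrite le_max lexx orbT.
have [[[mu bu] usub] ubar0] := hu; have [Ku Ku0 hKu] := (bounded_onP _ _).1 bu.
have uK y : `|u y| <= Ku by exact: hKu.
have u_le y : extended_closure N D y -> u y <= ubar.
  move=> Sy; apply: ub_le_sup; last by exists y.
  by exists Ku => _ [z _ <-]; rewrite (le_trans (ler_norm _)).
have start y : D y -> {ae law P y, forall v : skorokhod R d, D (v 0)}.
  move=> Dy; have mS : measurable [set v : skorokhod R d | v 0 = y].
    by rewrite -[X in measurable X]setTI; exact: (measurable_coord 0 measurableT (measurable_set1_rV y)).
  exists (~` [set v : skorokhod R d | v 0 = y]); split; first exact: measurableC.
    rewrite [LHS](probability_setC (law P y) mS).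
    rewrite -[RHS](@subee _ 1%E)//; congr (1 - _)%E; exact: (sms_initial hP y).
  by move=> v /= nD vy; apply: nD; rewrite vy.
have martingale_law y : solves_martingale_problem (levy_operator Q b N) (law P y) :=
  sms_martingale hP y.
have exitE y : D y -> {ae P y, forall v, exit_time D v = approach_time D v}.
  move=> Dy; have := ae_exit_time_approach hQb hN (martingale_law y) oD.
  by apply: filterS2 (start y Dy) => v Dv; exact.
have Tfin : {ae P x, forall v, (approach_time D v < +oo)%E}.
  by apply: filterS2 (exitE x hx) (hexit x hx) => v ->.
have exit_le : {ae P x, forall v s, approach_time D v = s%:E -> u (v s) <= ubar}.
  exact: (ae_exit_position hQb hN (martingale_law x) oD (start x hx) mu u_le).
set w := mean_discount P D k.
have wE y : D y -> exit_discount P D c y = w y.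
  move=> Dy; apply: ae_eq_lower_integral; apply: filterS (exitE y Dy) => v ->.
  rewrite (@discount_eq_on _ _ D c k ck); first exact: (discount_approach_time D k0).
  by move=> s [s0 sT]; exact: (before_approach_time s0 sT).
have wfin y : w y = (fine (w y))%:E := fin_mean_discount P D mk k0 y.
have w_itv y : 0 <= fine (w y) <= 1.
  by rewrite -!lee_fin -wfin; exact: (mean_discount_itv P D mk k0 y).
have mw : measurable_fun setT (fun y => fine (w y)).
  by apply: measurableT_comp => //; exact: (measurable_mean_discount P D mk k0).
(* The cut at [n] makes the function bounded, as $g^-$ need not be, and [ubar >= 0] makes it
   nonnegative: both are required by the minorization condition. *)
pose f n y : R := ubar * (k y * fine (w y)) + Num.min (h y) n%:R.
have kw0 y : 0 <= k y * fine (w y).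
  by rewrite mulr_ge0//; [case/andP: (k0 y)|case/andP: (w_itv y)].
have f0 n y : 0 <= f n y.
  by apply: addr_ge0; [exact: mulr_ge0|rewrite le_min h0 ler0n].
have mkw : measurable_fun setT (fun y => k y * fine (w y)) by exact: measurable_funM.
have mf n : measurable_fun setT (f n).
  apply: measurable_funD; last exact: measurable_minr.
  exact: measurable_funM.
have bf n : borel_bounded D (f n).
  split; first exact: (measurable_funS measurableT).
  apply/bounded_onP; exists (ubar * cbar + n%:R); first by rewrite addr_ge0// mulr_ge0.
  move=> y _; rewrite ger0_norm// lerD//; last by rewrite ge_min lexx orbT.
  rewrite ler_wpM2l//; have /andP[? ?] := k0 y; have /andP[? ?] := w_itv y.
  by rewrite (@le_trans _ _ (k y))// ler_piMr.
have step n : ((psi x)%:E * \int[nu]_(y in D) (f n y)%:E <= (ubar - u x)%:E)%E.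
  apply: le_trans (hmin _ (bf n) (fun y _ => f0 n y) x hx) _.
  apply: le_trans (resolvent_le (sms_strong_markov hP) mk k0 Tfin mh h0 (exitE x hx) ubar0 (ler0n _ n)) _.
  have := subsolution_le mk k0 ck Tfin (exitE x hx) mh h0 gh ubar0 uK exit_le (usub x hx).
  have : (0 <= \int[P x]_v killed_integral (approach_time D) (discounted_cost k h) v)%E.
    apply: integral_ge0 => v _; apply: killed_integral_ge0 => z.
    exact: (discounted_cost_ge0 k0 h0).
  (* An infinite cost contradicts the subsolution bound, whose right side is finite. For a finite
     cost [z], the bound [u x + z <= ubar * w x] cancels the term [- ubar * w x] coming from the
     resolvent. *)
  rewrite -/w wfin; case: (integral _ _ _) => [z| |]//= _.
  by rewrite -?EFinM -?EFinD !lee_fin -/ubar; lra.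
pose F y : \bar R := (ubar%:E * ((k y)%:E * w y) + (h y)%:E)%E.
have cvgF : (\int[nu]_(y in D) (f n y)%:E @[n --> \oo] --> \int[nu]_(y in D) F y)%E.
  have -> : (\int[nu]_(y in D) F y = \int[nu]_(y in D) limn (fun n => (f n y)%:E))%E.
    (* At each fixed point the cut is inactive for large [n], so the limit is pointwise stationary;
       the integrals under [nu] may still be infinite. *)
    apply: eq_integral => y _; apply/esym/lim_near_cst => //.
    exists (Num.truncn (h y)).+1 => // n /= hn; rewrite /f min_l; last first.
      by rewrite ltW// (lt_le_trans (truncnS_gt _))// ler_nat.
    by rewrite /F wfin.
  apply: cvg_monotone_convergence => //.
  - by move=> n; apply/measurable_EFinP; exact: (measurable_funS measurableT).
  - by move=> n y _; rewrite lee_fin.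
  - move=> y _ i j ij; rewrite lee_fin lerD2l le_min ge_min lexx/=.
    by rewrite ge_min ler_nat ij orbT.
have FE : (\int[nu]_(y in D) F y = ubar%:E * \int[nu]_(y in D) ((c y)%:E * exit_discount P D c y)
    + \int[nu]_(y in D) (Num.max (- g y) 0)%:E)%E.
  have mkwD : measurable_fun D (fun y => ((k y)%:E * w y)%E).
    apply: (measurable_funS measurableT) => //; apply: emeasurable_funM; first exact/measurable_EFinP.
    exact: (measurable_mean_discount P D mk k0).
  have kwe0 y : D y -> (0 <= (k y)%:E * w y)%E by move=> _; rewrite wfin -EFinM lee_fin.
  have mhD : measurable_fun D (fun y => (h y)%:E).
    by apply/measurable_EFinP; exact: (measurable_funS measurableT).
  have m1 : measurable_fun D (fun y => ubar%:E * ((k y)%:E * w y))%E by exact: emeasurable_funM.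
  have p1 y : D y -> (0 <= ubar%:E * ((k y)%:E * w y))%E.
    by move=> Dy; apply: mule_ge0; [rewrite lee_fin|exact: kwe0].
  rewrite /F (ge0_integralD _ mD p1 m1 _ mhD); last by move=> y _; rewrite lee_fin.
  rewrite (ge0_integralZl_EFin _ mD kwe0 mkwD ubar0).
  have -> : (\int[nu]_(y in D) ((k y)%:E * w y) =
      \int[nu]_(y in D) ((c y)%:E * exit_discount P D c y))%E.
    by apply: eq_integral => y /set_mem Dy; rewrite ck// wE.
  have -> : (\int[nu]_(y in D) (h y)%:E = \int[nu]_(y in D) (Num.max (- g y) 0)%:E)%E.
    by apply: eq_integral => y /set_mem Dy; rewrite hD'.
  by [].
rewrite -FE; have := cvgeZl (isT : (psi x)%:E \is a fin_num) cvgF.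
by apply: cvge_le; exact: nearW.
Qed.
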